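(* Let $\alpha<0$, $a\ge0$, $b\in\mathbb{R}$, let $K$ be a measure on $[1/2,1)$ with $\int_{[1/2,1)}(1-y)^2K(\mathrm{d}y)<\infty$, and suppose that $\kappa$ is not non-increasing on $[0,\infty)$ and that $\inf_{q\ge0}\kappa(q)<0$. Let $\omega_+$ be the unique real number with $\kappa(\omega_+)=0$ and $\kappa'(\omega_+)>0$. (i) For every $t\ge0$ there exists a unique measure $\mu_t$ on $(0,\infty)$ such that $\langle\mu_t,h_{\omega_+}\rangle=1$ and, for every integer $k\ge1$, $$\langle\mu_t,h_{\omega_+-k\alpha}\rangle=1+\sum_{\ell=1}^k\frac{\kappa(\omega_+-\alpha k)\cdots\kappa(\omega_+-\alpha(k-\ell+1))}{\ell!}\,t^\ell.$$ In particular $\mu_0=\delta_1$, and the family $(\mu_t)_{t\ge0}$ solves $\partial_t\langle\mu_t,f\rangle=\langle\mu_t,\mathcal{L}_\alpha f\rangle$ for all $f\in\mathcal{C}_c^\infty(0,\infty)$. (ii) For every $t>0$ there exists a unique measure $\gamma_t$ on $(0,\infty)$ such that $\langle\gamma_t,h_{\omega_+}\rangle=1$ and $$\langle\gamma_t,h_{\omega_+-k\alpha}\rangle=t^k\,\frac{\kappa(\omega_+-\alpha)\cdots\kappa(\omega_+-\alpha k)}{k!}\qquad\text{for every integer }k\ge1.$$ If one further sets $\gamma_0\equiv0$, then the family $(\gamma_t)_{t\ge0}$ solves $\partial_t\langle\gamma_t,f\rangle=\langle\gamma_t,\mathcal{L}_\alpha f\rangle$ for all $f\in\mathcal{C}_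c^\infty(0,\infty)$.
   Context: Write $h_q(x)=x^q$ for $x>0$, $\langle\mu,f\rangle:=\int_{(0,\infty)}f\,\mathrm{d}\mu$, and $f(y\mid x):=f(yx)+f((1-y)x)$ for $x>0$, $y\in[1/2,1)$. The operator $\mathcal{L}_\alpha$ is $$\mathcal{L}_\alpha f(x):=x^\alpha\Bigl(a x^2f''(x)+b x f'(x)+\int_{[1/2,1)}\bigl(f(y\mid x)-f(x)+xf'(x)(1-y)\bigr)K(\mathrm{d}y)\Bigr).$$ The (convex) function $\kappa:[0,\infty)\to(-\infty,\infty]$ is $$\kappa(q):=aq^2+(b-a)q+\int_{[1/2,1)}\bigl(y^q+(1-y)^q-1+q(1-y)\bigr)K(\mathrm{d}y).$$ A family $(\mu_t)_{t\ge0}$ of locally finite measures on $(0,\infty)$ solves $\partial_t\langle\mu_t,f\rangle=\langle\mu_t,\mathcal{L}_\alpha f\rangle$ for all $f\in\mathcal{C}_c^\infty(0,\infty)$ (smooth functions with compact support in $(0,\infty)$) if for every such $f$ the function $s\mapsto\langle\mu_s,\mathcal{L}_\alpha f\rangle$ is well defined and locally integrable on $[0,\infty)$, and $\langle\mu_t,f\rangle=\langle\mu_0,f\rangle+\int_0^t\langle\mu_s,\mathcal{L}_\alpha f\rangle\,\mathrm{d}s$ for all $t\ge0$. *)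

(* Defs.v *)
From HB Require Import structures.
From mathcomp Require Import all_boot all_order all_algebra.
From mathcomp Require Import all_classical all_reals all_analysis.

Set Implicit Arguments.
Unset Strict Implicit.
Unset Printing Implicit Defensive.

Import Order.TTheory GRing.Theory Num.Theory.
Import numFieldNormedType.Exports.

Local Open Scope classical_set_scope.
Local Open Scope ring_scope.

(* Borel measures, possibly infinite.  A measure on a Borel set D is represented
   by a Borel measure on R giving no mass to the complement of D. *)
Notation borel_measure R := {measure set (measurableTypeR R) -> \bar R%type}.

Definition carried_by (R : realType) (D : set R) (mu : borel_measure R) : Prop :=
  mu (~` D) = 0%E.

(* The values of a [{measure set _ -> _}] on non-measurable sets are
   unconstrained, hence equality is tested on Borel sets only. *)
Definition measure_eq (R : realType) (mu nu : borel_measure R) : Prop :=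
  forall A : set (measurableTypeR R), measurable A -> mu A = nu A.

Definition the_unique_measure_on (R : realType) (D : set R)
    (P : borel_measure R -> Prop) (mu : borel_measure R) : Prop :=
  [/\ carried_by D mu, P mu &
      forall nu : borel_measure R, carried_by D nu -> P nu -> measure_eq nu mu].

(* \bar R-valued, as moments of an arbitrary measure may be infinite. *)
Definition pairing (R : realType) (mu : borel_measure R) (f : R -> R) : \bar R :=
  (\int[mu]_(x in `]0%R, +oo[) (f x)%:E)%E.

Definition h (R : realType) (q : R) : R -> R := fun x => x `^ q.

(* Only meaningful for 0 <= q.  The negative part of the integrand is
   K-integrable when (1 - y)^2 is, so that the integral is well defined
   in ]-oo, +oo]. *)
Definition kappa (R : realType) (a b : R) (K : borel_measure R) (q : R) : \bar R :=
  ((a * q ^+ 2 + (b - a) * q)%:E +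
   \int[K]_(y in `[(2^-1)%R, 1%R[)
     (y `^ q + (1 - y) `^ q - 1 + q * (1 - y))%:E)%E.

(* Differentiability of an extended-real-valued function at omega means that it
   is finite near omega and that its real-valued part is differentiable. *)
Definition is_omega_plus (R : realType) (a b : R) (K : borel_measure R)
    (omega : R) : Prop :=
  [/\ 0 <= omega, kappa a b K omega = 0%E,
      \forall q \near omega, kappa a b K q \is a fin_num,
      derivable (fun q => fine (kappa a b K q)) omega 1 &
      0 < derive1 (fun q => fine (kappa a b K q)) omega].

(* f(y | x) *)
Definition split_eval (R : realType) (f : R -> R) (y x : R) : R :=
  f (y * x) + f ((1 - y) * x).

(* For f smooth with compact support in ]0, +oo[ and 0 < x, the integrand is
   K-integrable when (1 - y)^2 is, so that the real-valued integral is
   faithful. *)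
Definition L (R : realType) (alpha a b : R) (K : borel_measure R)
    (f : R -> R) (x : R) : R :=
  x `^ alpha * (a * x ^+ 2 * derive1n 2 f x + b * x * derive1 f x +
    \int[K]_(y in `[2^-1, 1[)
      (split_eval f y x - f x + x * derive1 f x * (1 - y))).

(* A function on ]0, +oo[ with compact support in ]0, +oo[ is identified with
   its extension by 0 to R. *)
Definition Cc_infty (R : realType) (f : R -> R) : Prop :=
  [/\ forall (n : nat) (x : R), derivable (derive1n n f) x 1,
      compact (closure [set x | f x != 0]) &
      closure [set x | f x != 0] `<=` `]0, +oo[ ].

Definition locally_finite (R : realType) (mu : borel_measure R) : Prop :=
  forall C : set R, compact C -> C `<=` `]0, +oo[ -> (mu C < +oo)%E.

(* Integrability on each segment `[0, T] is local integrability on [0, +oo[. *)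
Definition solves (R : realType) (alpha a b : R) (K : borel_measure R)
    (mu : R -> borel_measure R) : Prop :=
  (forall t : R, 0 <= t -> carried_by `]0, +oo[ (mu t) /\ locally_finite (mu t))
  /\
  forall f : R -> R, Cc_infty f ->
  [/\ forall s : R, 0 <= s ->
        (mu s).-integrable `]0, +oo[ (fun x => (L alpha a b K f x)%:E),
      forall T : R, 0 <= T ->
        lebesgue_measure.-integrable `[0, T]
          (fun s => pairing (mu s) (L alpha a b K f)) &
      forall t : R, 0 <= t ->
        pairing (mu t) f =
        (pairing (mu 0%R) f +
         \int[lebesgue_measure]_(s in `[0%R, t])
           pairing (mu s) (L alpha a b K f))%E].

Definition moments_i (R : realType) (alpha a b : R) (K : borel_measure R)
    (omega t : R) (mu : borel_measure R) : Prop :=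
  pairing mu (h omega) = 1%E /\
  forall k : nat, (1 <= k)%N ->
    pairing mu (h (omega - k%:R * alpha)) =
    (1 + \sum_(1 <= l < k.+1)
       (\prod_((k - l).+1 <= j < k.+1) kappa a b K (omega - alpha * j%:R))
       * (t ^+ l / (l`!)%:R)%:E)%E.

Definition moments_ii (R : realType) (alpha a b : R) (K : borel_measure R)
    (omega t : R) (gamma : borel_measure R) : Prop :=
  pairing gamma (h omega) = 1%E /\
  forall k : nat, (1 <= k)%N ->
    pairing gamma (h (omega - k%:R * alpha)) =
    ((t ^+ k / (k`!)%:R)%:E *
     \prod_(1 <= j < k.+1) kappa a b K (omega - alpha * j%:R))%E.

(* Main.v *)
(* Write [beta = - alpha] and [kappa_k = kappa (omega + beta k)].  In the variable [z = x `^ beta], after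
   dividing test functions by [x `^ omega], the operator becomes [G] with [G z^k = kappa_k z^(k-1)], which
   lowers degrees, so [exp (t G)] is a finite sum on polynomials and the prescribed moments are the values
   of [exp (t G) z^k] at [z = 1] in (i) and at [z = 0] in (ii).  [G p >= 0] at a minimum point of a
   polynomial on [0, +oo[ (this uses [kappa omega = 0] and [kappa_1 > 0]), hence the implicit Euler scheme
   preserves positivity on [0, +oo[ and so does [exp (t G)]; Haviland's theorem then provides a measure
   [nu_t] on [0, +oo[ with these moments.  As [kappa] grows at most quadratically, [nu_t] has exponential
   moments, locally uniformly in [t]: it is determined by its moments, and the evolution equation, which
   holds for polynomials, passes to all C^2 functions with bounded jets by approximation.
   It remains to see that [nu_t] has no atom at 0, for its image weighted by [x `^ (- omega)] is then the
   required measure on ]0, +oo[.  In (i), pick [r < omega] with [kappa r < 0]: bounded concave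
   functions of [z `^ (- (omega - r) / beta)] are superharmonic, and they can be taken of order [N] at 0
   and at most 1 at 1.  In (ii), [nu_t] is the image of [nu_1] by [z |-> t z], so the atom does not depend
   on [t]; testing the equation against [exp (- n z)], divided by [n], shows that it vanishes. *)
Require Import Defs.
From HB Require Import structures.
From mathcomp Require Import all_boot all_order all_algebra.
From mathcomp Require Import all_classical all_reals all_analysis.
From mathcomp Require Import measurable_realfun.
From mathcomp Require Import ring lra.
From mathcomp Require polyrcf.

Set Implicit Arguments.
Unset Strict Implicit.
Unset Printing Implicit Defensive.

Import Order.TTheory GRing.Theory Num.Theory.
Import numFieldNormedType.Exports.

Local Open Scope classical_set_scope.
Local Open Scope ring_scope.

(** After division by x^omega the motion is conservative: [kappa omega = 0] means G 1 = 0, and the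
    condition on [h omega] says that the tilted measure is a probability. Splitting only produces
    smaller particles, so G g at z depends on g over [0, z] alone; hence locally uniform convergence
    of jets is enough to pass to the limit in G, whatever the growth at infinity. The obstacle is
    the size of the moments: a quadratic [kappa] allows moments of order k! C^k, so only small
    exponentials are known to be integrable, at a rate that shrinks as t grows. Every approximation
    must therefore be dominated by exp (theta z) with theta small, uniformly over a bounded time
    interval. This is arranged once, for an abstract class of functions closed under such dominated
    limits, and used twice: for determinacy and for the evolution equation. The two cases part at
    the origin because the superharmonic functions of (i) are large at 0, which is the starting
    point of the tilted motion in (ii). *)

Section integrable_EFin.
Context d (T : measurableType d) {R : realType}.
Variables (mu : {measure set T -> \bar R}) (D : set T) (mD : measurable D).
Implicit Types f g : T -> R.

Lemma integrableZl_EFin f c : mu.-integrable D (fun x => (f x)%:E) ->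
  mu.-integrable D (fun x => (c * f x)%:E).
Proof. by move=> fi; exact: (integrableZl mD c fi). Qed.

Lemma integrableD_EFin f g : mu.-integrable D (fun x => (f x)%:E) ->
  mu.-integrable D (fun x => (g x)%:E) ->
  mu.-integrable D (fun x => (f x + g x)%:E).
Proof. by move=> fi gi; exact: (integrableD mD fi gi). Qed.

Lemma measurable_fun_EFin_integrable f : mu.-integrable D (fun x => (f x)%:E) ->
  measurable_fun D f.
Proof. by move=> /measurable_int/measurable_EFinP. Qed.

Lemma le_integrable_EFin f g : measurable_fun D f ->
  mu.-integrable D (fun x => (g x)%:E) ->
  (forall x, D x -> `|f x| <= g x) -> mu.-integrable D (fun x => (f x)%:E).
Proof.
move=> mf gi fg; apply: (le_integrable mD _ _ gi).
  exact/measurable_EFinP.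
by move=> x Dx /=; rewrite lee_fin (le_trans (fg _ Dx))// ler_norm.
Qed.

End integrable_EFin.

(** * Second-order Taylor bounds and real powers *)

Section taylor.
Context {R : realType}.
Implicit Types (f : R -> R) (a b x y q : R).

Lemma is_derive_within f f' a b :
  (forall x, a <= x <= b -> is_derive x 1 f (f' x)) ->
  {within `[a, b], continuous f}.
Proof.
move=> fd; apply: derivable_within_continuous => x.
rewrite in_itv/= => xab; have H := fd x xab; exact: ex_derive.
Qed.

Lemma MVT_is_derive f f' a b : a <= b ->
  (forall x, a <= x <= b -> is_derive x 1 f (f' x)) ->
  exists2 c, a <= c <= b & f b - f a = f' c * (b - a).
Proof.
move=> ab fd.
have [x|c] := @MVT_segment R f f' a b ab _ (is_derive_within fd).
  by rewrite in_itv/= => /andP[/ltW ax /ltW xb]; apply: fd; rewrite ax.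
by rewrite in_itv/= => cab ->; exists c.
Qed.

(** Two applications of the mean value theorem; losing the factor 1/2 of Taylor's formula is
    harmless. The expansion is at the right end point because fragments lie to the left of their
    parent. *)
Lemma taylor2_bound f f1 f2 a b M : a <= b ->
  (forall x, a <= x <= b -> is_derive x 1 f (f1 x)) ->
  (forall x, a <= x <= b -> is_derive x 1 f1 (f2 x)) ->
  (forall x, a <= x <= b -> `|f2 x| <= M) ->
  `|f a - f b + f1 b * (b - a)| <= M * (b - a) ^+ 2.
Proof.
move=> ab fd f1d f2M.
have [c /andP[ac cb] fE] := MVT_is_derive ab fd.
have [d|d /andP[cd db] f1E] := @MVT_is_derive f1 f2 c b cb.
  by move=> /andP[cd db]; apply: f1d; rewrite db (le_trans ac).
have -> : f a - f b + f1 b * (b - a) = f2 d * ((b - c) * (b - a)).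
  by rewrite mulrA -f1E -opprB fE; ring.
rewrite normrM expr2 ler_pM//; first by apply: f2M; rewrite db (le_trans ac).
have bc0 : 0 <= b - c by rewrite subr_ge0.
have ba0 : 0 <= b - a by rewrite subr_ge0.
rewrite ger0_norm; last exact: mulr_ge0.
by rewrite ler_wpM2r// lerD2l lerN2.
Qed.

Lemma powRD_gt0 x q r : 0 < x -> x `^ (q + r) = x `^ q * x `^ r.
Proof. by move=> x0; rewrite powRD//; apply/implyP => _; rewrite gt_eqF. Qed.

Lemma powRB_gt0 x q r : 0 < x -> x `^ (q - r) = x `^ q / x `^ r.
Proof. by move=> x0; rewrite powRD_gt0// powRN. Qed.

Lemma is_derive2_powR q x : 0 < x ->
  is_derive x 1 (fun u => q * u `^ (q - 1)) (q * (q - 1) * x `^ (q - 2)).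
Proof.
move=> x0; have H := is_derive1_powR (q - 1) x0.
apply: is_derive_eq.
rewrite /GRing.scale/= -mulrA; congr (_ * (_ * _ `^ _)); ring.
Qed.

(** On [1/2, 1] the factor u^(q - 2) of the second derivative is at most u^(-2) <= 4, whence the
    constant. *)
Lemma powR_taylor q y : 0 <= q -> 2^-1 <= y < 1 ->
  `|y `^ q - 1 + q * (1 - y)| <= 4 * `|q * (q - 1)| * (1 - y) ^+ 2.
Proof.
move=> q0 /andP[y2 y1].
have y0 : 0 < y by apply: lt_le_trans y2; rewrite invr_gt0.
have := @taylor2_bound (fun u : R => u `^ q) (fun u => q * u `^ (q - 1))
  (fun u => q * (q - 1) * u `^ (q - 2)) y 1 (4 * `|q * (q - 1)|) (ltW y1).
rewrite !powR1 mulr1; apply => u /andP[yu u1];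
  have u0 : 0 < u by exact: lt_le_trans yu.
- exact: is_derive1_powR.
- exact: is_derive2_powR.
rewrite normrM mulrC ler_wpM2r// ger0_norm ?powR_ge0//.
rewrite powRB_gt0// ler_pdivrMr ?powR_gt0//.
apply: (@le_trans _ _ 1).
  by rewrite -[leRHS](@powRr0 _ u) ger_powR// u0.
rewrite (powR_mulrn 2 (ltW u0)).
have : 2^-1 <= u by exact: le_trans yu.
nra.
Qed.

End taylor.

(** * The function kappa and its last zero *)

Section kappa.
Context {R : realType}.
Variables (a b : R) (K : borel_measure R).
Hypothesis a_ge0 : 0 <= a.
Hypothesis K_fin : (\int[K]_(y in `[(2^-1)%R, 1%R[) ((1 - y) ^+ 2)%:E < +oo)%E.

Local Notation I := (`[2^-1, 1[%classic : set (measurableTypeR R)).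

(** For q >= 0 this is finiteness of [kappa] at q: the rest of its integrand is of order (1 - y)^2,
    and only (1 - y)^q can fail to be integrable, [K] being possibly infinite near 1. *)
Definition dom (q : R) : Prop := K.-integrable I (fun y => ((1 - y) `^ q)%:E).

Definition kint (q y : R) : R := y `^ q + (1 - y) `^ q - 1 + q * (1 - y).

(* Agrees with [kappa] only on [dom]: a divergent integral counts as 0 here. *)
Definition kap (q : R) : R :=
  a * q ^+ 2 + (b - a) * q + \int[K]_(y in I) kint q y.

Lemma measurable_I : measurable I.
Proof. exact: measurable_itv. Qed.
Local Hint Resolve measurable_I : core.

Lemma I_bounds y : I y -> [/\ 2^-1 <= y, y < 1, 0 < y & 0 < 1 - y].
Proof.
rewrite /= in_itv/= => /andP[y2 y1]; split => //; last by rewrite subr_gt0.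
by apply: lt_le_trans y2; rewrite invr_gt0.
Qed.

Lemma measurable_1B : measurable_fun I (fun y : R => 1 - y).
Proof. by apply: measurable_funB => //; exact: measurable_id. Qed.

Lemma measurable_1B_powR q : measurable_fun I (fun y : R => (1 - y) `^ q).
Proof.
rewrite (_ : (fun _ => _) = (@powR R ^~ q) \o (fun y => 1 - y))//.
apply: measurableT_comp; [exact: measurable_powR|exact: measurable_1B].
Qed.

Lemma integrable_sq : K.-integrable I (fun y : R => ((1 - y) ^+ 2)%:E).
Proof.
apply/integrableP; split.
  by apply/measurable_EFinP; apply: measurable_funX; exact: measurable_1B.
apply: le_lt_trans K_fin; apply: ge0_le_integral => //.
- apply: measurableT_comp => //.
  by apply/measurable_EFinP; apply: measurable_funX; exact: measurable_1B.
- by apply/measurable_EFinP; apply: measurable_funX; exact: measurable_1B.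
- by move=> y _; rewrite gee0_abs// lee_fin sqr_ge0.
Qed.

Lemma dom_le p q : p <= q -> dom p -> dom q.
Proof.
move=> pq; apply: le_integrable => //.
  by apply/measurable_EFinP; exact: measurable_1B_powR.
move=> y /I_bounds[y2 y1 y0 y10].
rewrite !gee0_abs ?lee_fin ?powR_ge0//.
by apply: ger_powR => //; rewrite y10/= gerBl ltW.
Qed.

Lemma measurable_kint q : measurable_fun I (kint q).
Proof.
apply: measurable_funD; last by apply: measurable_funM => //; exact: measurable_1B.
apply: measurable_funB => //; apply: measurable_funD.
  by apply: measurable_funTS; exact: measurable_powR.
exact: measurable_1B_powR.
Qed.

Lemma kint_bound q y : 0 <= q -> I y ->
  `|kint q y - (1 - y) `^ q| <= 4 * `|q * (q - 1)| * (1 - y) ^+ 2.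
Proof.
move=> q0 /I_bounds[y2 y1 y0 y10]; rewrite /kint.
have := @powR_taylor R q y q0; rewrite y2 y1 => /(_ isT).
by rewrite (_ : y `^ q + (1 - y) `^ q - 1 + q * (1 - y) - (1 - y) `^ q =
  y `^ q - 1 + q * (1 - y)); last by ring.
Qed.

Lemma kint_abs_bound q y : 0 <= q -> I y ->
  `|kint q y| <= (1 - y) `^ q + 4 * `|q * (q - 1)| * (1 - y) ^+ 2.
Proof.
move=> q0 Iy; have := kint_bound q0 Iy.
have := powR_ge0 (1 - y) q.
move: (_ `^ _) (kint q y) => v k; rewrite !ler_norml; lra.
Qed.

Lemma integrable_bound (f : R -> R) q C D : dom q ->
  measurable_fun I f ->
  (forall y, I y -> `|f y| <= C * (1 - y) `^ q + D * (1 - y) ^+ 2) ->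
  K.-integrable I (fun y => (f y)%:E).
Proof.
move=> dq mf fb; apply: (@le_integrable _ _ _ K _ measurable_I _
  (fun y => C%:E * ((1 - y) `^ q)%:E + D%:E * ((1 - y) ^+ 2)%:E)%E).
- exact/measurable_EFinP.
- move=> y Iy; rewrite -!EFinM -EFinD/= lee_fin (le_trans (fb _ Iy))// ler_norm//.
- apply: integrableD => //; apply: integrableZl => //; exact: integrable_sq.
Qed.

Lemma integrable_kint q : 0 <= q -> dom q -> K.-integrable I (fun y => (kint q y)%:E).
Proof.
move=> q0 dq; apply: (integrable_bound (C := 1) dq (@measurable_kint q)) => y Iy.
by rewrite mul1r; exact: kint_abs_bound.
Qed.

Lemma kappa_dom q : 0 <= q -> dom q -> kappa a b K q = (kap q)%:E.
Proof.
move=> q0 dq; rewrite /kappa /kap [in RHS]EFinD; congr (_ + _)%E.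
rewrite /Rintegral fineK//; apply: integrable_fin_num => //.
exact: integrable_kint.
Qed.

(** The integrand differs from (1 - y)^q by an integrable function. Its positive part therefore has
    infinite integral, while its negative part is at most that of the difference, hence finite. *)
Lemma kappa_ndom q : 0 <= q -> ~ dom q -> kappa a b K q = +oo%E.
Proof.
move=> q0 dq; rewrite /kappa.
have mp : measurable_fun I (fun y : R => ((1 - y) `^ q)%:E).
  by apply/measurable_EFinP; exact: measurable_1B_powR.
have mk : measurable_fun I (fun y => (kint q y - (1 - y) `^ q)).
  by apply: measurable_funB; [exact: measurable_kint|exact: measurable_1B_powR].
have ib : K.-integrable I (fun y => (kint q y - (1 - y) `^ q)%:E).
  apply: (@le_integrable _ _ _ K _ measurable_I _
    (fun y => (4 * `|q * (q - 1)|)%:E * ((1 - y) ^+ 2)%:E)%E).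
  - exact/measurable_EFinP.
  - move=> y Iy; rewrite -EFinM/= lee_fin (le_trans (kint_bound q0 Iy))//.
    by rewrite ler_norm.
  - by apply: integrableZl => //; exact: integrable_sq.
have pi : (\int[K]_(y in I) ((1 - y) `^ q)%:E = +oo)%E.
  apply/eqP; rewrite -leye_eq leNgt; apply/negP => lt; apply: dq.
  apply/integrableP; split => //.
  by under eq_integral do rewrite gee0_abs ?lee_fin ?powR_ge0//.
have mkE : measurable_fun I (fun y => (kint q y)%:E).
  by apply/measurable_EFinP; exact: measurable_kint.
suff -> : (\int[K]_(y in I) (kint q y)%:E = +oo)%E by [].
rewrite integralE.
have -> : (\int[K]_(y in I) (fun y => (kint q y)%:E)^\+ y = +oo)%E.
  apply/eqP; rewrite -leye_eq leNgt; apply/negP => lt; apply: dq.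
  apply: (@le_integrable _ _ _ K _ measurable_I _
    ((fun y => (kint q y)%:E)^\+ \+ (abse \o (fun y => (kint q y - (1 - y) `^ q)%:E)))%E) => //.
  - move=> y Iy; rewrite gee0_abs ?lee_fin ?powR_ge0//.
    rewrite gee0_abs; last by rewrite adde_ge0//= abse_ge0.
    rewrite /= funeposE -EFin_max -EFinD lee_fin.
    rewrite distrC; have := ler_norm ((1 - y) `^ q - kint q y).
    have : kint q y <= Num.max (kint q y) 0 by rewrite le_max lexx.
    by lra.
  - apply: integrableD => //; last exact: integrable_abse.
    apply/integrableP; split; first exact: measurable_funepos.
    by under eq_integral do rewrite gee0_abs//.
rewrite addye//; apply/eqP => h.
have /integral_funeneg_lt_pinfty : K.-integrable I (fun y => (kint q y - (1 - y) `^ q)%:E) by [].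
suff le : (\int[K]_(y in I) (fun y => (kint q y)%:E)^\- y <=
  \int[K]_(y in I) (fun y => (kint q y - (1 - y) `^ q)%:E)^\- y)%E.
  by move=> /(_ measurable_I)/(le_lt_trans le); move/eqP: h; rewrite eqe_oppLR/= => /eqP ->.
apply: ge0_le_integral => //.
- exact: measurable_funeneg.
- by apply: measurable_funeneg; exact/measurable_EFinP.
- move=> y Iy; rewrite !funenegE -!EFinN -!EFin_max lee_fin ge_max !le_max lexx orbT andbT.
  by rewrite lerN2 gerBl powR_ge0.
Qed.

(** Convexity of q -> c^q is read off the tangent at the mean exponent m, namely c^q >= c^m (1 + (q
    - m) ln c), whose first-order terms cancel in the average. The remaining terms are affine in
    q. *)
Lemma kint_convex y p r t : I y -> 0 <= t <= 1 ->
  kint (t * p + (1 - t) * r) y <= t * kint p y + (1 - t) * kint r y.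
Proof.
move=> /I_bounds[y2 y1 y0 y10] /andP[t0 t1]; rewrite /kint.
have H c : 0 < c -> c `^ (t * p + (1 - t) * r) <= t * c `^ p + (1 - t) * c `^ r.
  move=> c0; set m := t * p + (1 - t) * r.
  have E q : c `^ m * (1 + (q - m) * ln c) <= c `^ q.
    have := powRD_gt0 m (q - m) c0; rewrite (addrC m) subrK => ->.
    rewrite ler_wpM2l ?powR_ge0// [c `^ (_ - _)]/powR gt_eqF//.
    exact: expR_ge1Dx.
  have := ler_wpM2l t0 (E p).
  have := ler_wpM2l (_ : 0 <= 1 - t) (E r); rewrite subr_ge0 => /(_ t1).
  move=> /lerD h /h; rewrite [leRHS]addrC; apply: le_trans.
  by rewrite le_eqVlt; apply/orP; left; apply/eqP; rewrite /m; ring.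
have := H _ y0; have := H _ y10.
set u := _ `^ _; set v := _ `^ _; set w := _ `^ _.
set u' := _ `^ _; set v' := _ `^ _; set w' := _ `^ _.
lra.
Qed.

Lemma kap_convex p r t : 0 <= p -> p <= r -> dom p -> 0 <= t <= 1 ->
  kap (t * p + (1 - t) * r) <= t * kap p + (1 - t) * kap r.
Proof.
move=> p0 pr dp /andP[t0 t1].
set m := t * p + (1 - t) * r.
have t10 : 0 <= 1 - t by rewrite subr_ge0.
have pm : p <= m by rewrite /m; nra.
have m0 : 0 <= m := le_trans p0 pm.
have r0 : 0 <= r := le_trans p0 pr.
have dr := dom_le pr dp; have dm := dom_le pm dp.
rewrite /kap.
have : \int[K]_(y in I) kint m y <=
  t * \int[K]_(y in I) kint p y + (1 - t) * \int[K]_(y in I) kint r y.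
  have ip := integrable_kint p0 dp; have ir := integrable_kint r0 dr.
  rewrite -!RintegralZl// -RintegralD//.
  - apply: le_Rintegral => //.
    + exact: integrable_kint.
    + rewrite (_ : _ \o _ = (fun y => t%:E * (kint p y)%:E + (1 - t)%:E * (kint r y)%:E)%E)//.
      by apply: integrableD => //; apply: integrableZl.
    + by move=> y Iy; apply: kint_convex => //; rewrite t0.
  - rewrite (_ : _ \o _ = (fun y => t%:E * (kint p y)%:E)%E)//; exact: integrableZl.
  - rewrite (_ : _ \o _ = (fun y => (1 - t)%:E * (kint r y)%:E)%E)//; exact: integrableZl.
have : a * m ^+ 2 + (b - a) * m <= t * (a * p ^+ 2 + (b - a) * p) + (1 - t) * (a * r ^+ 2 + (b - a) * r).
  have : 0 <= a * (t * (1 - t) * (p - r) ^+ 2) by apply: mulr_ge0 => //; apply: mulr_ge0; [exact: mulr_ge0|exact: sqr_ge0].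
  by rewrite /m; lra.
lra.
Qed.

(** The chord inequality cleared of denominators, the form in which convexity locates the zero of
    [kap] and gives the sign of its derivative there. *)
Lemma kap_slope (p q r : R) : 0 <= p -> dom p -> p <= q -> q <= r ->
  kap q * (r - p) <= kap p * (r - q) + kap r * (q - p).
Proof.
move=> p0 dp pq qr; have [pr|] := ltP p r; last first.
  move=> rp; have pE : p = q by apply/eqP; rewrite eq_le pq (le_trans qr).
  have -> : r = q by apply/eqP; rewrite eq_le qr -pE rp.
  by rewrite pE; lra.
have rp0 : 0 < r - p by rewrite subr_gt0.
have := @kap_convex p r ((r - q) / (r - p)) p0 (ltW pr) dp.
have -> : (r - q) / (r - p) * p + (1 - (r - q) / (r - p)) * r = q.
  by field; rewrite gt_eqF.
rewrite ler_pdivlMr// ler_pdivrMr// mul0r mul1r subr_ge0 qr lerD2l lerN2 pq.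
move=> /(_ isT) /(ler_wpM2r (ltW rp0)).
suff -> : ((r - q) / (r - p) * kap p + (1 - (r - q) / (r - p)) * kap r) * (r - p) =
  kap p * (r - q) + kap r * (q - p) by [].
by field; rewrite gt_eqF.
Qed.

Lemma is_derive_kint (y q : R) : I y -> is_derive q 1 (kint^~ y)
  (ln y * y `^ q + ln (1 - y) * (1 - y) `^ q + (1 - y)).
Proof.
move=> /I_bounds[y2 y1 y0 y10].
have H c : 0 < c -> is_derive q 1 (fun q => c `^ q) (ln c * c `^ q).
  move=> c0; rewrite (_ : (fun _ => _) = expR \o (fun q => q * ln c)); last first.
    by apply/funext => u; rewrite /powR/= gt_eqF.
  rewrite /powR gt_eqF//.
  have l : is_derive q 1 (fun q => q * ln c) (ln c).
    by apply: is_derive_eq; rewrite /GRing.scale/= mulr0 add0r mulr1.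
  by apply: is_derive_eq; rewrite mulrC.
have H1 := H _ y0; have H2 := H _ y10.
rewrite /kint; apply: is_derive_eq.
rewrite /GRing.scale/=; ring.
Qed.

(** Domination for differentiating [kap] under the integral. The part ln y * y^q + (1 - y) is of
    second order at y = 1, and a margin e in the exponent absorbs the other logarithm, since |ln v|
    v^e <= 1 / e on ]0, 1[. *)
Lemma dkint_bound (p q e y : R) : 0 <= p -> 0 < e -> p + e <= q -> I y ->
  `|ln y * y `^ q + ln (1 - y) * (1 - y) `^ q + (1 - y)| <=
  e^-1 * (1 - y) `^ p + (2 + 4 * q) * (1 - y) ^+ 2.
Proof.
move=> p0 e0 peq /I_bounds[y2 y1 y0 y10].
have q0 : 0 <= q by lra.
have A : `|ln y * y `^ q + (1 - y)| <= (2 + 4 * q) * (1 - y) ^+ 2.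
  have L1 : ln y <= y - 1 by have := @le_ln1Dx R (y - 1); rewrite subrKC => -> //; lra.
  have L2 : - ln y <= (1 - y) + 2 * (1 - y) ^+ 2.
    rewrite -lnV// (le_trans (_ : _ <= y^-1 - 1))//.
      by have := @le_ln1Dx R (y^-1 - 1); rewrite subrKC; apply; rewrite ltrBrDr addNr invr_gt0.
    have w2 : y^-1 <= 2 by rewrite -[leRHS]invrK lef_pV2 ?posrE ?invr_gt0.
    have wE : y^-1 - 1 = y^-1 * (1 - y) by rewrite mulrBr mulr1 mulVf// gt_eqF.
    have : y^-1 - 1 <= 2 * (1 - y) by rewrite wE ler_wpM2r// ltW.
    move=> h; have := ler_wpM2r (ltW y10) h; rewrite mulrBl -wE mul1r.
    by rewrite expr2; lra.
  have P1 : y `^ q <= 1 by rewrite -(@powRr0 _ y) ger_powR// y0 ltW.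
  have P2 : 1 + q * ln y <= y `^ q by rewrite /powR gt_eqF// expR_ge1Dx.
  have L3 : - ln y <= 2 * (1 - y) by nra.
  rewrite ler_norml; apply/andP; split.
    by nra.
  have : - ln y * (1 + q * ln y) <= - ln y * y `^ q by rewrite ler_wpM2l//; lra.
  have : ln y * ln y <= (2 * (1 - y)) ^+ 2.
    by rewrite -mulrNN -expr2 ler_pXn2r// nnegrE; lra.
  move=> h1 h2; have := ler_wpM2l q0 h1; nra.
have B : `|ln (1 - y) * (1 - y) `^ q| <= e^-1 * (1 - y) `^ p.
  rewrite normrM (ger0_norm (powR_ge0 _ _)).
  have l0 : ln (1 - y) <= 0 by apply: ln_le0; lra.
  have -> : (1 - y) `^ q = (1 - y) `^ (q - p) * (1 - y) `^ p by rewrite -powRD_gt0// subrK.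
  rewrite mulrA ler_wpM2r ?powR_ge0// ler0_norm// -(ler_pM2l e0) mulfV ?gt_eqF//.
  apply: (@le_trans _ _ (e * (- ln (1 - y) * (1 - y) `^ e))).
    rewrite ler_wpM2l ?(ltW e0)// ler_wpM2l ?oppr_ge0// ger_powR//; last by lra.
    by rewrite y10/=; lra.
  rewrite mulrA /powR gt_eqF//.
  have := @expR_ge1Dx R (e * - ln (1 - y)).
  rewrite -(ler_pM2r (expR_gt0 (e * ln (1 - y)))) -expRD -mulrDr addNr mulr0 expR0.
  by have := expR_gt0 (e * ln (1 - y)); nra.
by rewrite addrAC (le_trans (ler_normD _ _))// [leRHS]addrC lerD.
Qed.

Lemma kap_derivable (p q : R) : 0 <= p -> p < q -> dom p -> derivable kap q 1.
Proof.
move=> p0 pq dp.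
pose e := (q - p) / 2; have e0 : 0 < e by rewrite divr_gt0// subr_gt0.
have dx x : p + e < x < q + 1 -> 0 <= x /\ dom x.
  by move=> /andP[pex _]; split; [lra|apply: dom_le dp; lra].
have qI : `]p + e, q + 1[%classic q by rewrite /= in_itv/= ltrDl ltr01 andbT /e; lra.
have Hd : derivable (fun x => \int[K]_(y in I) kint x y) q 1.
  apply: (@derivable_under_integral R _ _ K kint I measurable_I q (p + e) (q + 1) qI _ _
    (fun y => e^-1 * (1 - y) `^ p + (2 + 4 * (q + 1)) * (1 - y) ^+ 2)).
  - by move=> x; rewrite /= in_itv/= => /dx[x0 dx']; exact: integrable_kint.
  - by move=> x y _ Iy; have H := is_derive_kint x Iy; exact: ex_derive.
  - move=> y; rewrite addr_ge0// mulr_ge0 ?invr_ge0 ?powR_ge0 ?sqr_ge0 ?(ltW e0)//.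
    by lra.
  - rewrite (_ : _ \o _ = (fun y : R => e^-1%:E * ((1 - y) `^ p)%:E +
      (2 + 4 * (q + 1))%:E * ((1 - y) ^+ 2)%:E)%E); last by [].
    by apply: integrableD => //; apply: integrableZl => //; exact: integrable_sq.
  - move=> x y; rewrite /= in_itv/= => /andP[px xq] Iy.
    rewrite partial1of2E; have H := is_derive_kint x Iy; rewrite derive_val.
    apply: (le_trans (dkint_bound p0 e0 (ltW px) Iy)).
    rewrite lerD2l ler_wpM2r ?sqr_ge0//; lra.
apply: derivableD; last exact: Hd.
have P : is_derive q 1 (fun x => a * x ^+ 2 + (b - a) * x) (a * (q *+ 2) + (b - a)).
  by apply: is_derive_eq; rewrite /GRing.scale/=; ring.
exact: (@ex_derive _ _ _ _ _ _ _ P).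
Qed.

(** A convex function that is negative somewhere and increases somewhere is carried to +oo by a
    chord, hence crosses 0 upwards, and does so only once. The point [r] of negative value is kept
    for the superharmonic functions that exclude an atom in (i). *)
Lemma omega_exists :
  ~ (forall p q : R, 0 <= p -> p <= q -> (kappa a b K q <= kappa a b K p)%E) ->
  (ereal_inf [set kappa a b K q | q in `[0%R, +oo[ ] < 0)%E ->
  exists omega r : R, [/\ 0 <= r < omega, dom r, kap r < 0,
     kap omega = 0 /\ (forall q, omega < q -> 0 < kap q) &
     unique (is_omega_plus a b K) omega].
Proof.
move=> nn /ereal_inf_lt[_ [r0 + <-]]; rewrite /= in_itv/= andbT => r00 kr0.
have lt_dom (q : R) z : 0 <= q -> (kappa a b K q < z)%E -> dom q.
  move=> q0 kz; apply: contrapT => /(kappa_ndom q0) kE.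
  by move: kz; rewrite kE ltNge leey.
have dr0 := lt_dom _ _ r00 kr0.
move: kr0; rewrite kappa_dom// lte_fin => kr0.
have [p [q [p0 pq dp kpq]]] : exists p q : R, [/\ 0 <= p, p < q, dom p & kap p < kap q].
  apply: contrapT => nex; apply: nn => p q p0 pq; rewrite leNgt; apply/negP => lt.
  have dp := lt_dom _ _ p0 lt; apply: nex; exists p, q.
  have dq := dom_le pq dp.
  move: lt; rewrite !kappa_dom ?(le_trans p0 pq)// lte_fin => kpq.
  split => //; rewrite lt_neqAle pq andbT; apply/eqP => pqE.
  by move: kpq; rewrite pqE ltxx.
(* Beyond q, [kap] lies above the line through its values at p and q, of slope [s]; the abscissa [X]
   is far enough for this line to be positive, and lies to the right of [r0]. *)
pose s := (kap q - kap p) / (q - p).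
have s0 : 0 < s by rewrite divr_gt0// subr_gt0.
pose X := Num.max q r0 + 1 + `|kap p| / s.
have sp : 0 <= `|kap p| / s by rewrite divr_ge0 // ltW.
have qX : q < X by rewrite /X; have := le_max q q r0; rewrite lexx/=; lra.
have rX : r0 < X by rewrite /X; have := le_max r0 q r0; rewrite lexx orbT/=; lra.
have kX : 0 < kap X.
  have := kap_slope p0 dp (ltW pq) (ltW qX).
  have -> : kap q = kap p + s * (q - p).
    by rewrite /s; field; rewrite gt_eqF// subr_gt0.
  move=> h; have {h} : s * (X - p) <= kap X - kap p.
    rewrite -(@ler_pM2r _ (q - p)) ?subr_gt0//; lra.
  have qm : q <= Num.max q r0 by rewrite le_max lexx.
  have : s * (1 + `|kap p| / s) <= s * (X - p) by rewrite ler_pM2l// /X; lra.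
  rewrite mulrDr mulr1 mulrCA divff ?gt_eqF// mulr1.
  by have := ler_norm (- kap p); rewrite normrN; lra.
(* [r0] may be the left end of [dom], where [kap_derivable] gives nothing. Moving towards [X] by the
   fraction [e] reaches a point where convexity still gives [kap] at most half of its negative value
   at [r0]. *)
pose e := - kap r0 / (2 * (kap X - kap r0)).
have De : 0 < 2 * (kap X - kap r0) by lra.
have e0 : 0 < e by rewrite divr_gt0//; lra.
have e1 : e <= 1 by rewrite ler_pdivrMr//; lra.
pose r := (1 - e) * r0 + (1 - (1 - e)) * X.
have r0r : r0 < r by rewrite /r; nra.
have rleX : r <= X by rewrite /r; nra.
have kr : kap r < 0.
  have := @kap_convex r0 X (1 - e) r00 (ltW rX) dr0.
  rewrite subr_ge0 e1 gerBl (ltW e0) => /(_ isT).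
  have -> : (1 - e) * kap r0 + (1 - (1 - e)) * kap X = kap r0 / 2.
    by rewrite /e; field; rewrite gt_eqF//; lra.
  by rewrite -/r; lra.
have dr := dom_le (ltW r0r) dr0.
have [w wI kw0] : exists2 w, w \in `[r, X] & kap w = 0.
  apply: IVT => //.
    apply: derivable_within_continuous => x; rewrite in_itv/= => /andP[rx _].
    by apply: kap_derivable dr0 => //; apply: lt_le_trans rx.
  by rewrite ge_min le_max (ltW kr) (ltW kX) orbT.
move: wI; rewrite in_itv/= => /andP[rw wX].
have {}rw : r < w.
  by rewrite lt_neqAle rw andbT; apply/eqP => E; move: kr; rewrite E kw0 ltxx.
have rge0 : 0 <= r by rewrite (le_trans r00) ?ltW.
have pos x : w < x -> 0 < kap x.
  move=> wx; have := kap_slope rge0 dr (ltW rw) (ltW wx).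
  rewrite kw0 mul0r => h.
  by rewrite -(@pmulr_lgt0 _ (w - r)) ?subr_gt0//; nra.
have w0 : 0 <= w by rewrite (le_trans rge0) ?ltW.
have dw := dom_le (ltW rw) dr.
have near_kap : \forall x \near w, kap x = fine (kappa a b K x).
  near=> x; have rx : r < x by near: x; exact: lt_nbhsr.
  by rewrite kappa_dom// ?(le_trans rge0) ?ltW//; apply: dom_le dr; exact: ltW.
exists w, r; split => //; first by rewrite rge0.
split.
  split => //.
  - by rewrite kappa_dom// kw0.
  - near=> x; have rx : r < x by near: x; exact: lt_nbhsr.
    by rewrite kappa_dom// ?(le_trans rge0) ?ltW//; apply: dom_le dr; exact: ltW.
  - exact: (near_eq_derivable near_kap (kap_derivable rge0 rw dr)).
  - rewrite derive1E (_ : 'D_1 _ w = 'D_1 kap w); last exact/esym/near_eq_derive.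
    have dk := kap_derivable rge0 rw dr.
    (* The slope of the chord from [r] to [w]. By convexity it bounds from below the difference
       quotients at [w], on both sides. *)
    pose m := - kap r / (w - r).
    have m0 : 0 < m by rewrite divr_gt0 ?subr_gt0//; lra.
    apply: lt_le_trans m0 _.
    have mE : m * (w - r) = - kap r by rewrite /m divfK// gt_eqF// subr_gt0.
    apply: limr_ge; first exact: dk.
    near=> t; rewrite /= kw0 subr0 scaler1 /GRing.scale/=.
    have t0 : t != 0 by near: t; exact: nbhs_dnbhs_neq.
    have tr : r < t + w.
      rewrite -ltrBlDr; near: t; apply: nbhs_dnbhs; apply: lt_nbhsr; lra.
    have wr0 : 0 < w - r by rewrite subr_gt0.
    have [tp|] := ltP 0 t.
      have H := @kap_slope r w (t + w) rge0 dr (ltW rw) ltac:(lra).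
      rewrite mulrC ler_pdivlMr// -(ler_pM2r wr0) mulrAC mE.
      by move: H; rewrite kw0; lra.
    rewrite le_eqVlt (negbTE t0)/= => tn.
    have H := @kap_slope r (t + w) w rge0 dr (ltW tr) ltac:(lra).
    rewrite mulrC ler_ndivlMr// -(ler_pM2r wr0) mulrAC mE.
    by move: H; rewrite kw0; lra.
move=> x [x0 kx0 _ dx Dx].
have dmx : dom x by apply: (lt_dom _ 1%E x0); rewrite kx0 lte_fin.
move: kx0; rewrite kappa_dom// => -[kx0].
have [xw|wx|//] := ltgtP x w; last by have := pos _ wx; rewrite kx0 ltxx.
(* An earlier zero with positive derivative would make [kap] positive just to its right, whereas
   convexity keeps it at most 0 between two zeros. *)
exfalso; move: Dx; rewrite derive1E => Dx.
have /cvg_dnbhs_at_right/cvgr_gt/(_ _ Dx) H :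
    h^-1 *: (fine (kappa a b K (h *: 1 + x)) - fine (kappa a b K x))
   @[h --> (0:R)^'] --> 'D_1 (fun q => fine (kappa a b K q)) x by exact: dx.
have : exists t : R, [/\ 0 < t, t < w - x &
    0 < t^-1 *: (fine (kappa a b K (t *: 1 + x)) - fine (kappa a b K x))].
  near (0:R)^'+ => t; exists t; split => //; near: t.
  - by apply: nbhs_right_lt; rewrite subr_gt0.
  - exact: H.
move=> [t [t0 tw]]; rewrite scaler1 /GRing.scale/= pmulr_rgt0 ?invr_gt0//.
have dt : dom (t + x) by apply: dom_le dmx; lra.
rewrite !kappa_dom//=; last by lra.
rewrite kx0 subr0.
have := @kap_slope x (t + x) w x0 dmx ltac:(lra) ltac:(lra).
rewrite kx0 kw0 !mul0r addr0; nra.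
Unshelve. all: by end_near. Qed.

(** The exponent enters the bound on the integrand only through q (q - 1) in front of (1 - y)^2. The
    resulting quadratic growth is what yields exponential moments. *)
Lemma kap_growth (p : R) : 0 <= p -> dom p ->
  exists2 C, 0 <= C & forall q, p <= q -> `|kap q| <= C * (1 + q) ^+ 2.
Proof.
move=> p0 dp.
pose A := \int[K]_(y in I) (1 - y) `^ p.
pose B := \int[K]_(y in I) (1 - y) ^+ 2.
have A0 : 0 <= A by apply: Rintegral_ge0 => y _; exact: powR_ge0.
have B0 : 0 <= B by apply: Rintegral_ge0 => y _; exact: sqr_ge0.
exists (a + `|b - a| + A + 4 * B); first by rewrite !addr_ge0 ?mulr_ge0.
move=> q pq; have q0 : 0 <= q := le_trans p0 pq.
have iq := integrable_kint q0 (dom_le pq dp).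
have H : `|\int[K]_(y in I) kint q y| <= A + 4 * `|q * (q - 1)| * B.
  apply: (le_trans (le_normr_Rintegral measurable_I iq)).
  rewrite -RintegralZl//; last exact: integrable_sq.
  have i2 : K.-integrable I (fun y => (4 * `|q * (q - 1)| * (1 - y) ^+ 2)%:E).
    by apply: integrableZl_EFin => //; exact: integrable_sq.
  rewrite -RintegralD//; apply: le_Rintegral => //.
  - by have := integrable_norm iq.
  - exact: integrableD_EFin.
  - move=> y Iy; apply: (le_trans (kint_abs_bound q0 Iy)).
    have [y2 y1 y0 y10] := I_bounds Iy.
    by rewrite lerD2r ger_powR// y10/= gerBl ltW.
have Q : `|q * (q - 1)| <= (1 + q) ^+ 2 by rewrite ler_norml; nra.
have Q1 : q <= (1 + q) ^+ 2 by nra.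
have Q2 : 1 <= (1 + q) ^+ 2 by nra.
have Q3 : q ^+ 2 <= (1 + q) ^+ 2 by nra.
rewrite /kap !(le_trans (ler_normD _ _))//.
apply: (@le_trans _ _ (a * q ^+ 2 + `|b - a| * q + (A + 4 * `|q * (q - 1)| * B))).
  apply: lerD => //; apply: (le_trans (ler_normD _ _)).
  rewrite !normrM (ger0_norm a_ge0) (ger0_norm q0) lerD//.
have := ler_wpM2l a_ge0 Q3.
have := ler_wpM2l (normr_ge0 (b - a)) Q1.
have := ler_wpM2l A0 Q2.
have := ler_wpM2l B0 Q.
lra.
Qed.

End kappa.

(** * The operator L on twice differentiable functions *)

Section jets.
Context {R : realType}.
Implicit Types (f g : R -> R) (x y q S : R).

(** The derivatives are separate arguments rather than [derive1], so that jets can be combined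
    linearly and given by formulas. *)
Definition C2_pos (f f1 f2 : R -> R) : Prop := forall x, 0 < x ->
  is_derive x 1 f (f1 x) /\ is_derive x 1 f1 (f2 x).

Lemma C2_pos_lin c d f f1 f2 g g1 g2 : C2_pos f f1 f2 -> C2_pos g g1 g2 ->
  C2_pos (fun x => c * f x + d * g x) (fun x => c * f1 x + d * g1 x)
         (fun x => c * f2 x + d * g2 x).
Proof.
move=> fd gd x x0; have [fd1 fd2] := fd _ x0; have [gd1 gd2] := gd _ x0.
split; exact: is_derive_eq.
Qed.

Lemma C2_pos_powR q :
  C2_pos (fun x => x `^ q) (fun x => q * x `^ (q - 1)) (fun x => q * (q - 1) * x `^ (q - 2)).
Proof. by move=> x x0; split; [exact: is_derive1_powR|exact: is_derive2_powR]. Qed.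

Lemma C2_pos_derive1 f f1 f2 x : C2_pos f f1 f2 -> 0 < x ->
  derive1 f x = f1 x /\ derive1n 2 f x = f2 x.
Proof.
move=> fC x0; have [fd fd1] := fC _ x0; split.
  by rewrite derive1E; have := fd => ?; rewrite derive_val.
rewrite /derive1n/= derive1E (_ : 'D_1 _ x = 'D_1 f1 x).
  by have := fd1 => ?; rewrite derive_val.
apply: near_eq_derive; near=> u.
have u0 : 0 < u by near: u; exact: lt_nbhsr.
have [ud _] := fC _ u0; rewrite derive1E.
by have := ud => ?; rewrite derive_val.
Unshelve. all: by end_near. Qed.

Lemma is_derive_continuous f a x : is_derive x 1 f a -> {for x, continuous f}.
Proof.
by move=> fd; apply/differentiable_continuous/derivable1_diffP; exact: ex_derive.
Qed.

(** If [f2 x] were negative, [f1] would be negative just to the right of [x], and the mean value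
    theorem would take [f] below its minimum. *)
Lemma second_derive_min_ge0 f f1 f2 x : C2_pos f f1 f2 -> 0 < x ->
  (forall u, 0 < u -> f x <= f u) -> f1 x = 0 /\ 0 <= f2 x.
Proof.
move=> fC x0 fmin; have [fd fd1] := fC _ x0.
have f10 : f1 x = 0.
  have : is_derive x 1 f 0.
    apply: (@derive1_at_min R f (x / 2) (x * 2) x) => [|t||t]; rewrite ?in_itv/=; try lra.
      by move=> /andP[xt _]; have [ft _] := fC t ltac:(lra); exact: ex_derive.
    by move=> /andP[xt _]; apply: fmin; lra.
  by move=> fd0; rewrite -(@derive_val _ _ _ _ _ _ _ fd) derive_val.
split => //.
rewrite leNgt; apply/negP => f2x.
have /cvg_dnbhs_at_right/cvgr_lt/(_ _ f2x) H : h^-1 *: (f1 (h *: 1 + x) - f1 x)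
    @[h --> (0:R)^'] --> f2 x.
  by have -> : f2 x = 'D_1 f1 x; [rewrite derive_val|exact: (@ex_derive _ _ _ _ _ _ _ fd1)].
have [e /= e0 He] : exists2 e : R, 0 < e & forall h, 0 < h < e -> f1 (h + x) < 0.
  have [e /= e0 He] := H; exists e => // h /andP[h0 he].
  have := He h; rewrite /= sub0r normrN gtr0_norm// => /(_ he h0).
  by rewrite scaler1 f10 subr0 /GRing.scale/= pmulr_rlt0 ?invr_gt0.
have xe : x < x + e / 2 by lra.
have cf : {within `[x, x + e / 2], continuous f}.
  by apply: (@is_derive_within R f f1) => u /andP[xu _]; have [] := fC u ltac:(lra).
have [u|c] := @MVT _ f f1 _ _ xe _ cf.
  by rewrite in_itv/= => /andP[xu _]; have [] := fC u ltac:(lra).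
rewrite in_itv/= => /andP[xc ce] fE.
have := He (c - x) ltac:(lra); rewrite subrK => f1c.
have := fmin (x + e / 2) ltac:(lra); rewrite -subr_ge0 fE pmulr_lge0 ?leNgt ?f1c//; lra.
Qed.

End jets.

Section operator.
Context {R : realType}.
Variables (alpha a b : R) (K : borel_measure R).
Hypothesis a_ge0 : 0 <= a.
Hypothesis K_fin : (\int[K]_(y in `[(2^-1)%R, 1%R[) ((1 - y) ^+ 2)%:E < +oo)%E.
Implicit Types (f g : R -> R) (x y q S : R).

Local Notation I := (`[2^-1, 1[%classic : set (measurableTypeR R)).
Local Notation dom := (dom K).

Definition jump f f1 x y := split_eval f y x - f x + x * f1 x * (1 - y).

Definition genL f f1 f2 x : R :=
  x `^ alpha * (a * x ^+ 2 * f2 x + b * x * f1 x + \int[K]_(y in I) jump f f1 x y).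

Lemma L_genL f f1 f2 x : C2_pos f f1 f2 -> 0 < x ->
  L alpha a b K f x = genL f f1 f2 x.
Proof. by move=> fC x0; have [E1 E2] := C2_pos_derive1 fC x0; rewrite /L E1 E2. Qed.

(** A scale-invariant control, adapted to the powers u^q. It is asked below [x] only, since the
    fragments of [x] are smaller than [x]. *)
Definition jet_bound q S x f f1 f2 := forall u, 0 < u <= x ->
  [/\ `|f u| <= S * u `^ q, `|u * f1 u| <= S * u `^ q & `|u ^+ 2 * f2 u| <= S * u `^ q].

(** The small fragment contributes (1 - y)^q through the size of [f] alone. The large one stays in
    [x/2, x], where the compensated difference is of second order; the 4 comes from x^2 <= 4 u^2. *)
Lemma jump_bound q S f f1 f2 x y : 0 <= q -> C2_pos f f1 f2 -> 0 < x ->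
  jet_bound q S x f f1 f2 -> I y ->
  `|jump f f1 x y| <= S * x `^ q * ((1 - y) `^ q + 4 * (1 - y) ^+ 2).
Proof.
move=> q0 fC x0 fb /I_bounds[y2 y1 y0 y10].
have S0 : 0 <= S.
  have [+ _ _] := fb x ltac:(lra).
  by move=> /(le_trans (normr_ge0 _)); rewrite pmulr_lge0// powR_gt0.
have yx0 : 0 < y * x by rewrite mulr_gt0.
have yx : y * x <= x by rewrite ler_piMl// ltW.
have y1x : 0 < (1 - y) * x <= x by rewrite mulr_gt0//= ler_piMl// ?(ltW x0)// gerBl ltW.
have [B1 _ _] := fb _ y1x.
rewrite powRM ?(ltW y10) ?(ltW x0)// in B1.
have := @taylor2_bound R f f1 f2 (y * x) x (S * x `^ q * 4 / x ^+ 2) yx.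
move=> /(_ (fun u hu => (fC u ltac:(lra)).1) (fun u hu => (fC u ltac:(lra)).2)).
have -> : x - y * x = (1 - y) * x by ring.
have -> : S * x `^ q * 4 / x ^+ 2 * ((1 - y) * x) ^+ 2 = S * x `^ q * 4 * (1 - y) ^+ 2.
  by field; rewrite gt_eqF.
move=> H; have {H} : `|f (y * x) - f x + f1 x * ((1 - y) * x)| <= S * x `^ q * 4 * (1 - y) ^+ 2.
  apply: H => u /andP[yu ux]; have u0 : 0 < u := lt_le_trans yx0 yu.
  have [_ _] := fb u ltac:(lra).
  rewrite normrM ger0_norm ?sqr_ge0// => h.
  rewrite ler_pdivlMr ?exprn_gt0//.
  have uq : u `^ q <= x `^ q by rewrite ge0_ler_powR// nnegrE ltW.
  have xu : x ^+ 2 <= 4 * u ^+ 2 by have x2u : x <= 2 * u; nra.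
  have := ler_wpM2l (normr_ge0 (f2 u)) xu.
  have := ler_wpM2l S0 uq; lra.
rewrite /jump /split_eval.
have -> : f (y * x) + f ((1 - y) * x) - f x + x * f1 x * (1 - y) =
  f ((1 - y) * x) + (f (y * x) - f x + f1 x * ((1 - y) * x)) by ring.
move=> H; apply: (le_trans (ler_normD _ _)); lra.
Qed.

Lemma measurable_jump f f1 f2 x : C2_pos f f1 f2 -> 0 < x ->
  measurable_fun I (jump f f1 x).
Proof.
move=> fC x0.
have H (k : R -> R) : (forall y, 0 < y < 1 -> 0 < k y) -> continuous k ->
    measurable_fun I (fun y => f (k y)).
  move=> k0 kc; apply: (@measurable_funS _ _ _ _ (`]0, 1[%classic : set (measurableTypeR R))) => //.
    by move=> y /I_bounds[y2 y1 y0 y10]; rewrite /= in_itv/= y0.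
  apply: open_continuous_measurable_fun; first exact: interval_open.
  move=> y; rewrite inE/= in_itv/= => /k0 ky.
  apply: continuous_comp; first exact: kc.
  by have [+ _] := fC _ ky; exact: is_derive_continuous.
rewrite /jump /split_eval; apply: measurable_funD.
  apply: measurable_funB => //; apply: measurable_funD; apply: H.
  - by move=> y /andP[y0 _]; rewrite mulr_gt0.
  - by move=> y; apply: cvgM; [exact: cvg_id|exact: cvg_cst].
  - by move=> y /andP[_ y1]; rewrite mulr_gt0// subr_gt0.
  - move=> y; apply: cvgM; last exact: cvg_cst.
    by apply: cvgB; [exact: cvg_cst|exact: cvg_id].
by apply: measurable_funM => //; exact: measurable_1B.
Qed.

Lemma integrable_jump q S f f1 f2 x : 0 <= q -> dom q -> C2_pos f f1 f2 -> 0 < x ->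
  jet_bound q S x f f1 f2 -> K.-integrable I (fun y => (jump f f1 x y)%:E).
Proof.
move=> q0 dq fC x0 fb.
apply: (integrable_bound K_fin dq (measurable_jump fC x0)) => y Iy.
by apply: (le_trans (jump_bound q0 fC x0 fb Iy)); rewrite mulrDr mulrA.
Qed.

Lemma genL_bound q : 0 <= q -> dom q -> exists2 C, 0 <= C &
  forall f f1 f2 x S, C2_pos f f1 f2 -> 0 < x -> jet_bound q S x f f1 f2 ->
  `|genL f f1 f2 x| <= C * S * x `^ (q + alpha).
Proof.
move=> q0 dq.
pose J := \int[K]_(y in I) ((1 - y) `^ q + 4 * (1 - y) ^+ 2).
have J0 : 0 <= J.
  by apply: Rintegral_ge0 => y _; rewrite addr_ge0 ?powR_ge0// mulr_ge0// sqr_ge0.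
have mI := @measurable_I R.
have iJ : K.-integrable I (fun y => ((1 - y) `^ q + 4 * (1 - y) ^+ 2)%:E).
  apply: integrableD_EFin => //; apply: integrableZl_EFin => //.
  exact: integrable_sq.
exists (a + `|b| + J); first by rewrite !addr_ge0.
move=> f f1 f2 x S fC x0 fb.
have [f0b f1b f2b] := fb x ltac:(lra).
rewrite powRD_gt0// /genL normrM (ger0_norm (powR_ge0 _ _)) mulrC [leRHS]mulrA.
rewrite ler_wpM2r ?powR_ge0//.
have Jb : `|\int[K]_(y in I) jump f f1 x y| <= S * x `^ q * J.
  have ij := integrable_jump q0 dq fC x0 fb.
  apply: (le_trans (le_normr_Rintegral mI ij)).
  rewrite -RintegralZl//; apply: le_Rintegral => //.
  - by have := integrable_norm ij.
  - exact: integrableZl_EFin.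
  - by move=> y Iy; exact: (jump_bound q0 fC x0 fb Iy).
apply: (le_trans (ler_normD _ _)).
have := ler_normD (a * x ^+ 2 * f2 x) (b * x * f1 x).
rewrite (_ : a * x ^+ 2 * f2 x = a * (x ^+ 2 * f2 x)); last by ring.
rewrite (_ : b * x * f1 x = b * (x * f1 x)); last by ring.
rewrite (normrM a) (normrM b) (ger0_norm a_ge0).
have := ler_wpM2l a_ge0 f2b; have := ler_wpM2l (normr_ge0 b) f1b.
lra.
Qed.

Lemma genL_lin c d f f1 f2 g g1 g2 x :
  K.-integrable I (fun y => (jump f f1 x y)%:E) ->
  K.-integrable I (fun y => (jump g g1 x y)%:E) ->
  genL (fun u => c * f u + d * g u) (fun u => c * f1 u + d * g1 u)
       (fun u => c * f2 u + d * g2 u) x =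
  c * genL f f1 f2 x + d * genL g g1 g2 x.
Proof.
move=> fi gi; rewrite /genL.
have mI := @measurable_I R.
have -> : \int[K]_(y in I) jump (fun u => c * f u + d * g u) (fun u => c * f1 u + d * g1 u) x y =
  c * \int[K]_(y in I) jump f f1 x y + d * \int[K]_(y in I) jump g g1 x y.
  rewrite -!RintegralZl// -RintegralD//; last 2 first.
  - exact: integrableZl_EFin.
  - exact: integrableZl_EFin.
  by apply: eq_Rintegral => y _; rewrite /jump /split_eval; ring.
ring.
Qed.

(** The minimum principle. The minimal value has to be 0: a split puts two values of [f] in place of
    one, so that [genL] does not annihilate constants. *)
Lemma genL_min_ge0 f f1 f2 x : C2_pos f f1 f2 -> 0 < x ->
  (forall u, 0 < u -> 0 <= f u) -> f x = 0 -> 0 <= genL f f1 f2 x.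
Proof.
move=> fC x0 f0 fx0.
have [f1x f2x] := second_derive_min_ge0 fC x0 (fun u u0 => eq_ind_r (fun r => r <= f u) (f0 u u0) fx0).
rewrite /genL f1x mulr0 addr0 mulr_ge0 ?powR_ge0// addr_ge0//.
  by apply: mulr_ge0 => //; apply: mulr_ge0 => //; exact: sqr_ge0.
apply: Rintegral_ge0 => y /I_bounds[y2 y1 y0 y10].
rewrite /jump /split_eval fx0 f1x subr0 mulr0 mul0r addr0 addr_ge0// f0// mulr_gt0//.
Qed.

Lemma genL_powR q x : 0 <= q -> dom q -> 0 < x ->
  genL (fun u => u `^ q) (fun u => q * u `^ (q - 1)) (fun u => q * (q - 1) * u `^ (q - 2)) x
  = kap a b K q * x `^ (q + alpha).
Proof.
move=> q0 dq x0; have mI := @measurable_I R.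
have E1 : x * x `^ (q - 1) = x `^ q by rewrite powRB_gt0// powRr1 ?ltW// mulrC divfK ?gt_eqF.
have E2 : x ^+ 2 * x `^ (q - 2) = x `^ q.
  by rewrite powRB_gt0// (powR_mulrn 2) ?ltW// mulrC divfK// gt_eqF// exprn_gt0.
rewrite /genL.
have -> : \int[K]_(y in I) jump (fun u => u `^ q) (fun u => q * u `^ (q - 1)) x y =
    x `^ q * \int[K]_(y in I) kint q y.
  rewrite -RintegralZl//; last exact: integrable_kint.
  apply: eq_Rintegral => y; rewrite inE => /I_bounds[y2 y1 y0 y10].
  rewrite /jump /split_eval /kint !powRM ?ltW// [x * (q * _)]mulrCA E1; ring.
rewrite [x `^ (q + alpha)]powRD_gt0// /kap.
have -> : a * x ^+ 2 * (q * (q - 1) * x `^ (q - 2)) = a * q * (q - 1) * x `^ q.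
  by rewrite -E2; ring.
have -> : b * x * (q * x `^ (q - 1)) = b * q * x `^ q by rewrite -E1; ring.
ring.
Qed.

Lemma jet_bound_powR q x : exists S, jet_bound q S x (fun u => u `^ q)
  (fun u => q * u `^ (q - 1)) (fun u => q * (q - 1) * u `^ (q - 2)).
Proof.
exists (1 + `|q| + `|q * (q - 1)|) => u /andP[u0 _].
have uq := powR_ge0 u q.
have E1 : u * u `^ (q - 1) = u `^ q by rewrite powRB_gt0// powRr1 ?ltW// mulrC divfK ?gt_eqF.
have E2 : u ^+ 2 * u `^ (q - 2) = u `^ q.
  by rewrite powRB_gt0// (powR_mulrn 2) ?ltW// mulrC divfK// gt_eqF// exprn_gt0.
have n1 := normr_ge0 q; have n2 := normr_ge0 (q * (q - 1)).
split.
- by rewrite ger0_norm//; nra.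
- by rewrite mulrCA E1 normrM (ger0_norm uq); nra.
- by rewrite mulrCA E2 normrM (ger0_norm uq); nra.
Qed.

End operator.

(** * Functions of class C^2 on the whole line *)

Section C2.
Context {R : realType}.
Implicit Types (f g : R -> R) (x y z q S : R).

Definition C2 g g1 g2 : Prop :=
  [/\ forall x, is_derive x 1 g (g1 x), forall x, is_derive x 1 g1 (g2 x) & continuous g2].

Lemma C2_lin c d f f1 f2 g g1 g2 : C2 f f1 f2 -> C2 g g1 g2 ->
  C2 (fun x => c * f x + d * g x) (fun x => c * f1 x + d * g1 x)
     (fun x => c * f2 x + d * g2 x).
Proof.
move=> [fd fd1 fc] [gd gd1 gc]; split => x.
- by have := fd x; have := gd x => ? ?; exact: is_derive_eq.
- by have := fd1 x; have := gd1 x => ? ?; exact: is_derive_eq.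
- by apply: cvgD; apply: cvgM => //; [exact: cvg_cst|exact: fc|exact: cvg_cst|exact: gc].
Qed.

Lemma C2_cst c : C2 (fun=> c) (fun=> 0) (fun=> 0).
Proof. by split=> x; [exact: is_derive_cst|exact: is_derive_cst|exact: cvg_cst]. Qed.

Lemma C2_poly (p : {poly R}) : C2 (horner p) (horner p^`()) (horner p^`()^`()).
Proof.
split=> x; [exact: is_derive_poly|exact: is_derive_poly|].
exact: is_derive_continuous (is_derive_poly _ _).
Qed.

Lemma C2_continuous g g1 g2 : C2 g g1 g2 -> [/\ continuous g, continuous g1 & continuous g2].
Proof.
move=> [gd gd1 gc]; split => // x; [exact: is_derive_continuous (gd x)|].
exact: is_derive_continuous (gd1 x).
Qed.

Lemma continuous_bounded g z : continuous g ->
  exists2 M, 0 <= M & forall u, 0 <= u <= z -> `|g u| <= M.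
Proof.
move=> gc; have [z0|z0] := leP 0 z; last first.
  by exists 0 => // u /andP[u0 uz]; have := le_lt_trans (le_trans u0 uz) z0; rewrite ltxx.
have [|c _ H] := @EVT_max R (fun u => `|g u|) 0 z z0.
  apply: continuous_subspaceT => u; apply: cvg_norm; exact: gc.
by exists `|g c| => // u uz; apply: H; rewrite in_itv.
Qed.

Lemma C2_bounded g g1 g2 z : C2 g g1 g2 -> exists2 M, 0 <= M &
  forall u, 0 <= u <= z -> [/\ `|g u| <= M, `|g1 u| <= M & `|g2 u| <= M].
Proof.
move=> /C2_continuous[gc g1c g2c].
have [A A0 HA] := continuous_bounded z gc.
have [B B0 HB] := continuous_bounded z g1c.
have [C C0 HC] := continuous_bounded z g2c.
exists (A + B + C); first by rewrite !addr_ge0.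
by move=> u uz; have := HA u uz; have := HB u uz; have := HC u uz; split; lra.
Qed.

End C2.

(** * The tilted generator *)

Section tilt.
Context {R : realType}.
Variables (beta a b : R) (K : borel_measure R) (omega : R).
Hypothesis beta_gt0 : 0 < beta.
Hypothesis a_ge0 : 0 <= a.
Hypothesis K_fin : (\int[K]_(y in `[(2^-1)%R, 1%R[) ((1 - y) ^+ 2)%:E < +oo)%E.
Hypothesis omega_ge0 : 0 <= omega.
Hypothesis dom_omega : dom K omega.
Hypothesis kap_omega : kap a b K omega = 0.
Implicit Types (f g : R -> R) (x y z q S : R).

Local Notation I := (`[2^-1, 1[%classic : set (measurableTypeR R)).
Local Notation genL := (genL (- beta) a b K).

(* [tilt1] and [tilt2] are the first two derivatives of [tilt g] in terms of those of [g]. *)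
Definition tilt g x := x `^ omega * g (x `^ beta).
Definition tilt1 g g1 x := let z := x `^ beta in
  x `^ (omega - 1) * (omega * g z + beta * z * g1 z).
Definition tilt2 g g1 g2 x := let z := x `^ beta in
  x `^ (omega - 2) * (omega * (omega - 1) * g z +
    (2 * omega * beta + beta * (beta - 1)) * z * g1 z + beta ^+ 2 * z ^+ 2 * g2 z).

Lemma powRB1 x q : 0 < x -> x `^ (q - 1) = x `^ q / x.
Proof. by move=> x0; rewrite powRB_gt0// powRr1// ltW. Qed.

Lemma powRB2 x q : 0 < x -> x `^ (q - 2) = x `^ q / x ^+ 2.
Proof. by move=> x0; rewrite powRB_gt0// (powR_mulrn 2)// ltW. Qed.

Lemma C2_pos_tilt g g1 g2 : C2 g g1 g2 ->
  C2_pos (tilt g) (tilt1 g g1) (tilt2 g g1 g2).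
Proof.
move=> [gd gd1 _] x x0.
have P q := is_derive1_powR q x0.
have G := @is_derive1_comp R g (fun u => u `^ beta) x _ _ (gd _) (P beta).
have G1 := @is_derive1_comp R g1 (fun u => u `^ beta) x _ _ (gd1 _) (P beta).
have Pb := P beta; have Po := P omega; have Po1 := P (omega - 1).
have xn0 : x != 0 by rewrite gt_eqF.
split.
  apply: (@is_derive_eq _ _ _ ((fun u => u `^ omega) * (g \o (fun u => u `^ beta)))).
  rewrite /GRing.scale/= /tilt1 !powRB1//; field.
  by [].
have -> : tilt1 g g1 = (fun u => u `^ (omega - 1)) *
    (omega \*: (g \o (fun u => u `^ beta)) +
     beta \*: ((fun u => u `^ beta) * (g1 \o (fun u => u `^ beta)))).
  by apply/funext => u; rewrite /tilt1/= -(mulrA beta).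
apply: is_derive_eq.
rewrite /GRing.scale/= /tilt2 powRB2// !powRB1//.
rewrite (_ : (omega \*: _ + beta \*: _) x =
  omega * g (x `^ beta) + beta * (x `^ beta * g1 (x `^ beta)))//.
by rewrite /GRing.scale/=; field.
Qed.

(* The value at 0 is the one that makes [genG_poly] hold on all of [0, +oo[, the term of degree 0
   being killed by [kappa omega = 0]. *)
Definition genG g g1 g2 z : R :=
  if z <= 0 then kap a b K (omega + beta) * g1 0 else
  let x := z `^ beta^-1 in x `^ (- omega) * genL (tilt g) (tilt1 g g1) (tilt2 g g1 g2) x.

Lemma genL_tilt g g1 g2 x : 0 < x ->
  genL (tilt g) (tilt1 g g1) (tilt2 g g1 g2) x = x `^ omega * genG g g1 g2 (x `^ beta).
Proof.
move=> x0; have xE : (x `^ beta) `^ beta^-1 = x.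
  by rewrite -powRrM mulfV ?gt_eqF// powRr1// ltW.
rewrite /genG leNgt powR_gt0//= xE.
by rewrite mulrA -powRD_gt0// subrr powRr0 mul1r.
Qed.

(** The change of variable z = x^beta multiplies the logarithmic derivative u d/du by a constant
    only, so scale-invariant bounds in z become scale-invariant bounds in x. *)
Lemma jet_bound_tilt : exists2 C, 0 <= C & forall g g1 g2 S x, 0 < x ->
  (forall u, 0 < u <= x `^ beta ->
    [/\ `|g u| <= S, `|u * g1 u| <= S & `|u ^+ 2 * g2 u| <= S]) ->
  jet_bound omega (C * S) x (tilt g) (tilt1 g g1) (tilt2 g g1 g2).
Proof.
pose C := 1 + omega + beta + `|omega * (omega - 1)| +
  `|2 * omega * beta + beta * (beta - 1)| + beta ^+ 2.
have C0 : 0 <= C by rewrite !addr_ge0// ?sqr_ge0// ltW.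
exists C => // g g1 g2 S x x0 gb u /andP[u0 ux].
have ub : 0 < u `^ beta <= x `^ beta.
  by rewrite powR_gt0//= ge0_ler_powR// ?nnegrE ltW.
have [b0 b1 b2] := gb _ ub.
have uo : 0 <= u `^ omega by exact: powR_ge0.
have S0 : 0 <= S by apply: le_trans b0.
have n0 := normr_ge0 (omega * (omega - 1)).
have n1 := normr_ge0 (2 * omega * beta + beta * (beta - 1)).
have n2 := sqr_ge0 beta.
have bb := ltW beta_gt0.
have un0 : u != 0 by rewrite gt_eqF.
move: b0 b1 b2; rewrite /tilt /tilt1 /tilt2/=; set z := u `^ beta => b0 b1 b2.
rewrite powRB1// powRB2//; split.
- rewrite normrM (ger0_norm uo) [leLHS]mulrC ler_wpM2r// (le_trans b0)//.
  by have := mulr_ge0 omega_ge0 S0; have := mulr_ge0 bb S0;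
  have := mulr_ge0 n0 S0; have := mulr_ge0 n1 S0; have := mulr_ge0 n2 S0; rewrite /C; lra.
- rewrite (_ : u * _ = u `^ omega * (omega * g z + beta * (z * g1 z))); last by field.
  rewrite normrM (ger0_norm uo) [leLHS]mulrC ler_wpM2r//.
  apply: (le_trans (ler_normD _ _)); rewrite !(normrM omega) !(normrM beta).
  rewrite (ger0_norm omega_ge0) (ger0_norm bb) /C.
  have := ler_wpM2l omega_ge0 b0; have := ler_wpM2l bb b1.
  have := mulr_ge0 n0 S0; have := mulr_ge0 n1 S0; have := mulr_ge0 n2 S0; lra.
- rewrite (_ : u ^+ 2 * _ = u `^ omega * (omega * (omega - 1) * g z +
    (2 * omega * beta + beta * (beta - 1)) * (z * g1 z) + beta ^+ 2 * (z ^+ 2 * g2 z))); last by field.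
  rewrite normrM (ger0_norm uo) [leLHS]mulrC ler_wpM2r//.
  apply: (le_trans (ler_normD _ _)).
  have := ler_normD (omega * (omega - 1) * g z) ((2 * omega * beta + beta * (beta - 1)) * (z * g1 z)).
  rewrite (normrM (omega * (omega - 1)) (g z)) (normrM (_ + _) (z * g1 z)).
  rewrite (normrM (beta ^+ 2)) (ger0_norm n2).
  have := ler_wpM2l n0 b0; have := ler_wpM2l n1 b1; have := ler_wpM2l n2 b2.
  have := mulr_ge0 omega_ge0 S0; have := mulr_ge0 bb S0; rewrite /C; lra.
Qed.

(** [genL] scales like x^(omega - beta), and removing the tilt leaves x^(- beta) = 1 / z. The bound
    controls [genG] near 0 and also makes G (exp (- n z)) / n vanish away from 0 as n grows. *)
Lemma genG_decay : exists2 C, 0 <= C & forall g g1 g2 S z, C2 g g1 g2 -> 0 < z ->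
  (forall u, 0 < u <= z ->
    [/\ `|g u| <= S, `|u * g1 u| <= S & `|u ^+ 2 * g2 u| <= S]) ->
  `|genG g g1 g2 z| <= C * S / z.
Proof.
have [C C0 HC] := jet_bound_tilt.
have [D D0 HD] := @genL_bound R (- beta) a b K a_ge0 K_fin omega omega_ge0 dom_omega.
exists (D * C); first by rewrite mulr_ge0.
move=> g g1 g2 S z gC z0 gb.
pose x := z `^ beta^-1.
have x0 : 0 < x by rewrite powR_gt0.
have zE : z = x `^ beta by rewrite /x -powRrM mulVf ?gt_eqF// powRr1 ?ltW.
have := HD _ _ _ x (C * S) (C2_pos_tilt gC) x0.
rewrite genL_tilt// -zE normrM ger0_norm ?powR_ge0// powRB_gt0// -zE => H.
have {}H := H (HC g g1 g2 S x x0 ltac:(rewrite -zE; exact: gb)).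
rewrite -(ler_pM2l (powR_gt0 omega x0)) (le_trans H)//.
by rewrite le_eqVlt; apply/orP; left; apply/eqP; ring.
Qed.

Lemma genL_ext f f1 f2 g g1 g2 x : 0 < x -> (forall u, 0 < u -> f u = g u) ->
  f1 x = g1 x -> f2 x = g2 x -> genL f f1 f2 x = genL g g1 g2 x.
Proof.
move=> x0 fg E1 E2; rewrite /genL E1 E2; congr (_ * (_ + _)).
apply: eq_Rintegral => y; rewrite inE => /I_bounds[y2 y1 y0 y10].
by rewrite /jump /split_eval E1 !fg// mulr_gt0.
Qed.

Lemma integrable_jump_tilt g g1 g2 x : C2 g g1 g2 -> 0 < x ->
  K.-integrable I (fun y => (jump (tilt g) (tilt1 g g1) x y)%:E).
Proof.
move=> gC x0; have [C C0 HC] := jet_bound_tilt.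
have [M M0 HM] := C2_bounded (x `^ beta) gC.
set z := x `^ beta in HM.
apply: (integrable_jump K_fin omega_ge0 dom_omega (C2_pos_tilt gC) x0
  (HC g g1 g2 (M * (1 + z + z ^+ 2)) x x0 _)) => u /andP[u0]; rewrite -/z => uz.
have [b0 b1 b2] := HM u ltac:(rewrite (ltW u0)//).
have z0 : 0 <= z by exact: powR_ge0.
have u2 : u ^+ 2 <= z ^+ 2 by rewrite ler_pXn2r// nnegrE ltW.
have Mz : 0 <= M * z by exact: mulr_ge0.
have Mz2 : 0 <= M * z ^+ 2 by rewrite mulr_ge0// sqr_ge0.
split; rewrite !mulrDr mulr1.
- lra.
- rewrite normrM gtr0_norm//; have := ler_pM (ltW u0) (normr_ge0 _) uz b1; lra.
- rewrite normrM (ger0_norm (sqr_ge0 u)).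
  have := ler_pM (sqr_ge0 u) (normr_ge0 _) u2 b2; lra.
Qed.

Lemma genG_lin c d f f1 f2 g g1 g2 z : C2 f f1 f2 -> C2 g g1 g2 ->
  genG (fun x => c * f x + d * g x) (fun x => c * f1 x + d * g1 x)
     (fun x => c * f2 x + d * g2 x) z = c * genG f f1 f2 z + d * genG g g1 g2 z.
Proof.
move=> fC gC; rewrite /genG; case: ifPn => [_|]; first by ring.
rewrite -ltNge => z0; set x := z `^ beta^-1.
have x0 : 0 < x by exact: powR_gt0.
have := genL_lin (- beta) a b c d (tilt2 f f1 f2) (tilt2 g g1 g2)
  (integrable_jump_tilt fC x0) (integrable_jump_tilt gC x0).
set A := genL (tilt f) _ _ x; set B := genL (tilt g) _ _ x => H.
rewrite (_ : c * (_ * A) + d * (_ * B) = x `^ (- omega) * (c * A + d * B)); last by ring.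
rewrite -H; congr (_ * _).
apply: genL_ext => // [u u0||].
- by rewrite /tilt; ring.
- by rewrite /tilt1/=; ring.
- by rewrite /tilt2/=; ring.
Qed.

(** The tilt of a constant is a multiple of x^omega, which [genL] multiplies by a quantity
    proportional to [kap omega]. *)
Lemma genG_cst c z : genG (fun=> c) (fun=> 0) (fun=> 0) z = 0.
Proof.
rewrite /genG; case: ifPn => [_|]; first by rewrite mulr0.
rewrite -ltNge => z0; set x := z `^ beta^-1.
have x0 : 0 < x by exact: powR_gt0.
have [S HS] := jet_bound_powR omega x.
have ij := integrable_jump K_fin omega_ge0 dom_omega (C2_pos_powR omega) x0 HS.
have := genL_lin (- beta) a b c 0 (fun u => omega * (omega - 1) * u `^ (omega - 2))
  (fun u => omega * (omega - 1) * u `^ (omega - 2)) ij ij.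
rewrite genL_powR// kap_omega !mul0r mulr0 addr0 => E.
apply/eqP; rewrite mulf_eq0; apply/orP; right; apply/eqP; rewrite -[RHS]E.
apply: genL_ext => // [u u0||]; rewrite /tilt /tilt1 /tilt2/=; ring.
Qed.

(** Subtracting g 0, which [genG] does not see, leaves a function of size at most z S on [0, z];
    this z cancels the 1 / z of [genG_decay]. *)
Lemma genG_bound : exists2 C, 0 <= C & forall g g1 g2 S z, C2 g g1 g2 -> 0 <= z ->
  (forall u, 0 <= u <= z -> `|g1 u| <= S /\ `|u * g2 u| <= S) ->
  `|genG g g1 g2 z| <= C * S.
Proof.
have [C C0 HC] := genG_decay.
exists (C + `|kap a b K (omega + beta)|); first by rewrite addr_ge0.
move=> g g1 g2 S z gC z0 gb.
have S0 : 0 <= S by have [+ _] := gb z ltac:(rewrite z0 lexx//); apply: le_trans.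
have := mulr_ge0 C0 S0; have := mulr_ge0 (normr_ge0 (kap a b K (omega + beta))) S0.
have [zp|zn] := ltP 0 z; last first.
  rewrite /genG zn normrM => h1 h2.
  have [b1 _] := gb 0 ltac:(rewrite lexx z0//).
  have := ler_wpM2l (normr_ge0 (kap a b K (omega + beta))) b1; lra.
move=> h1 h2; rewrite mulrDl; apply: (@le_trans _ _ (C * S)); last by lra.
have -> : genG g g1 g2 z = genG (fun x => 1 * g x + 1 * (- g 0))
    (fun x => 1 * g1 x + 1 * 0) (fun x => 1 * g2 x + 1 * 0) z.
  by rewrite genG_lin ?genG_cst//; [ring|exact: C2_cst].
have gC' := C2_lin 1 1 gC (C2_cst (- g 0)).
have := HC _ _ _ (z * S) z gC' zp.
rewrite (_ : C * (z * S) / z = C * S); last by field; rewrite gt_eqF.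
apply => u /andP[u0 uz]; have [b1 b2] := gb u ltac:(rewrite (ltW u0)//).
rewrite !mul1r !addr0; split.
- have [gd _ _] := gC.
  have [c /andP[c0 cu] ->] := MVT_is_derive (ltW u0) (fun x _ => gd x).
  rewrite subr0 normrM (gtr0_norm u0) mulrC.
  have [b3 _] := gb c ltac:(rewrite c0 (le_trans cu)//).
  exact: ler_pM (ltW u0) _ uz b3.
- by rewrite normrM (gtr0_norm u0); exact: ler_pM (ltW u0) _ uz b1.
- by rewrite expr2 -mulrA normrM (gtr0_norm u0); exact: ler_pM (ltW u0) _ uz b2.
Qed.

Definition coefG k := kap a b K (omega + beta * k%:R).

Definition polyG (p : {poly R}) : {poly R} :=
  \poly_(i < (size p).-1) (coefG i.+1 * p`_i.+1).

Lemma coef_polyG p i : (polyG p)`_i = coefG i.+1 * p`_i.+1.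
Proof.
rewrite coef_poly; case: ltnP => // h; rewrite nth_default ?mulr0//.
by case: (size p) h => //= n; rewrite ltnS.
Qed.

Lemma polyG_lin (c d : R) (p q : {poly R}) : polyG (c *: p + d *: q) = c *: polyG p + d *: polyG q.
Proof. by apply/polyP => i; rewrite !(coef_polyG, coefD, coefZ); ring. Qed.

Lemma dom_coefG k : 0 <= omega + beta * k%:R /\ dom K (omega + beta * k%:R).
Proof.
have h : 0 <= beta * k%:R by rewrite mulr_ge0// ltW.
by split; [exact: addr_ge0|apply: dom_le dom_omega; rewrite lerDl].
Qed.

Lemma genG_Xn k z : 0 < z ->
  genG (horner 'X^k) (horner 'X^k^`()) (horner 'X^k^`()^`()) z = (polyG 'X^k).[z].
Proof.
(* Writing the power k - 1 as a quotient includes k = 0, where both sides vanish by [kap_omega]. *)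
move=> z0; have -> : (polyG 'X^k).[z] = coefG k * z ^+ k / z.
  case: k => [|k].
    have -> : polyG 'X^0 = 0.
      by apply/polyP => i; rewrite coef_polyG coefXn coef0 mulr0.
    by rewrite horner0 /coefG mulr0 addr0 kap_omega !mul0r.
  have -> : polyG 'X^(k.+1) = coefG k.+1 *: 'X^k.
    apply/polyP => i; rewrite coef_polyG coefZ !coefXn eqSS.
    by case: eqP => [->//|]; rewrite !mulr0.
  by rewrite hornerZ hornerXn exprSr; field; rewrite gt_eqF.
rewrite /genG leNgt z0/=; set x := z `^ beta^-1.
have x0 : 0 < x by exact: powR_gt0.
have zE : x `^ beta = z by rewrite /x -powRrM mulVf ?gt_eqF// powRr1// ltW.
have [q0 dq] := dom_coefG k; set q := omega + _ in q0 dq.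
have E u : 0 < u -> u `^ omega * (u `^ beta) ^+ k = u `^ q.
  by move=> u0; rewrite -powR_mulrn ?powR_ge0// -powRrM -powRD_gt0.
have := genL_powR (- beta) a b K_fin q0 dq x0.
rewrite (_ : x `^ (q - beta) = x `^ omega * (z ^+ k / z)); last first.
  by rewrite powRB_gt0// -E// zE; ring.
rewrite /coefG -/q => H.
have -> : kap a b K q * z ^+ k / z = x `^ (- omega) * (kap a b K q * (x `^ omega * (z ^+ k / z))).
  rewrite powRN; field; rewrite !gt_eqF//; exact: powR_gt0.
rewrite -H; congr (_ * _).
have zn0 : z != 0 by rewrite gt_eqF.
have xn0 : x != 0 by rewrite gt_eqF.
have D1 : z * ('X^k^`()).[z] = k%:R * z ^+ k.
  rewrite derivXn hornerMn hornerXn -mulr_natl mulrCA.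
  by case: (k) => [|n]; rewrite ?mul0r//= -exprS.
have D2 : z ^+ 2 * ('X^k^`()^`()).[z] = k%:R * (k%:R - 1) * z ^+ k.
  rewrite derivXn derivMn derivXn !hornerMn hornerXn -mulrnA.
  rewrite -(mulr_natl _ (k.-1 * k)) natrM.
  case: (k) => [|[|n]]; rewrite ?mul0r ?mulr0 ?subrr ?mulr0 ?mul0r//=.
  by rewrite -[n.+2%:R]natr1 addrK !exprS; ring.
apply: genL_ext => // [u u0||].
- by rewrite /tilt hornerXn E.
- rewrite /tilt1/= powRB1// [in RHS]powRB1// -E// zE -(mulrA _ z _) D1 hornerXn /q.
  by field.
- rewrite /tilt2/= powRB2// [in RHS]powRB2// -E// zE -(mulrA _ z _) -(mulrA _ (z ^+ 2) _) D1 D2 hornerXn /q.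
  by field.
Qed.

Lemma genG_poly p z : 0 <= z ->
  genG (horner p) (horner p^`()) (horner p^`()^`()) z = (polyG p).[z].
Proof.
rewrite le_eqVlt => /predU1P[<-|z0].
  by rewrite /genG lexx !horner_coef0 coef_deriv coef_polyG /coefG mulr1 mulr1n.
pose P (p : {poly R}) := genG (horner p) (horner p^`()) (horner p^`()^`()) z = (polyG p).[z].
have Plin c d (q r : {poly R}) : P q -> P r -> P (c *: q + d *: r).
  have E (s t : {poly R}) : horner (c *: s + d *: t) = (fun u => c * s.[u] + d * t.[u]).
    by apply/funext => u; rewrite hornerD !hornerZ.
  rewrite /P polyG_lin hornerD !hornerZ => <- <-.
  by rewrite -(genG_lin c d z (C2_poly q) (C2_poly r)) !(derivD, derivZ) !E.
rewrite -/(P p) -[p]coefK poly_def.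
elim/big_ind : _ => [|q r Pq Pr|i _].
- rewrite -[0](_ : 0 *: (1 : {poly R}) + 0 *: (1 : {poly R}) = 0); last by rewrite !scale0r addr0.
  have P1 : P 1 by have := genG_Xn 0 z0.
  exact: Plin.
- by rewrite -[q]scale1r -[r]scale1r; exact: Plin.
- rewrite -[_ *: _]addr0 -[X in _ + X](scale0r 'X^i); apply: Plin; exact: genG_Xn.
Qed.

End tilt.

(** * Positivity of the semigroup on polynomials *)

Section poly_min.
Context {R : realType}.
Implicit Types (p q : {poly R}).

Lemma ge0_lead_coef_gt0 p : (1 < size p)%N -> (forall z, 0 <= z -> 0 <= p.[z]) ->
  0 < lead_coef p.
Proof.
move=> sp p0; rewrite lt_neqAle eq_sym lead_coef_eq0 -size_poly_gt0 (ltnW sp)/=.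
rewrite leNgt; apply/negP => lp.
have [n Hn] := @polyrcf.poly_lim_infty _ (- p) 1 ltac:(rewrite lead_coefN oppr_gt0//)
  ltac:(rewrite size_polyN//).
have := Hn (Num.max n 0) ltac:(rewrite le_max lexx//).
have := p0 (Num.max n 0) ltac:(rewrite le_max lexx orbT//).
by rewrite hornerN; lra.
Qed.

Lemma poly_argmin p : (1 < size p)%N -> 0 < lead_coef p ->
  exists2 z, 0 <= z & forall u, 0 <= u -> p.[z] <= p.[u].
Proof.
move=> sp lp; have [n Hn] := @polyrcf.poly_lim_infty _ p p.[0] lp sp.
pose m := Num.max n 0.
have m0 : 0 <= m by rewrite le_max lexx orbT.
have [|z] := @EVT_min R (horner p) 0 m m0.
  apply: continuous_subspaceT => u; exact: is_derive_continuous (is_derive_poly _ _).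
rewrite in_itv/= => /andP[z0 zm] H; exists z => // u u0.
have [um|mu] := leP u m; first by apply: H; rewrite in_itv/= u0.
apply: (le_trans (H 0 _)); first by rewrite in_itv/= lexx.
by apply: Hn; apply: le_trans (ltW mu); rewrite le_max lexx.
Qed.

Lemma poly_min0_coef1 p : (forall u, 0 <= u -> p.[0] <= p.[u]) -> 0 <= p`_1.
Proof.
move=> pmin; have -> : p`_1 = p^`().[0] by rewrite horner_coef0 coef_deriv.
have D := is_derive_poly p 0.
have := @ex_derive _ _ _ _ _ _ _ D => /cvg_dnbhs_at_right H.
rewrite -(@derive_val _ _ _ _ _ _ _ D).
have -> : 'D_1 (horner p) 0 = lim (h^-1 *: ((p.[h *: 1 + 0]) - p.[0]) @[h --> (0:R)^'+]).
  by apply/esym/cvg_lim.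
apply: limr_ge; first by apply/cvg_ex; eexists; exact: H.
near=> h; have h0 : 0 < h by [].
rewrite scaler1 addr0 /GRing.scale/= mulr_ge0//; first by rewrite invr_ge0 ltW.
by rewrite subr_ge0; apply: pmin; exact: ltW.
Unshelve. all: by end_near. Qed.

End poly_min.

Lemma cvg_sum_ord {R : realType} (N : nat) (u : nat -> nat -> R) (l : nat -> R) :
  (forall j, u j n @[n --> \oo] --> l j) ->
  \sum_(j < N) u j n @[n --> \oo] --> \sum_(j < N) l j.
Proof.
move=> ul; elim: N => [|N IH].
  by under eq_fun do rewrite big_ord0; rewrite big_ord0; exact: cvg_cst.
under eq_fun do rewrite big_ord_recr/=.
by rewrite big_ord_recr/=; apply: cvgD.
Qed.

Section semigroup.
Context {R : realType}.
Variables (beta a b : R) (K : borel_measure R) (omega : R).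
Hypothesis beta_gt0 : 0 < beta.
Hypothesis a_ge0 : 0 <= a.
Hypothesis K_fin : (\int[K]_(y in `[(2^-1)%R, 1%R[) ((1 - y) ^+ 2)%:E < +oo)%E.
Hypothesis omega_ge0 : 0 <= omega.
Hypothesis dom_omega : dom K omega.
Hypothesis kap_omega : kap a b K omega = 0.
Hypothesis kap_gt0 : forall q, omega < q -> 0 < kap a b K q.
Implicit Types (p q : {poly R}) (h t z : R).

Local Notation polyG := (polyG beta a b K omega).
Local Notation coefG := (coefG beta a b K omega).

Lemma coefG_gt0 k : (0 < k)%N -> 0 < coefG k.
Proof. by move=> k0; apply: kap_gt0; rewrite ltrDl mulr_gt0// ltr0n. Qed.

(** At an interior minimum the minimal value, which [polyG] does not see, is subtracted to meet the
    zero level of [genL_min_ge0]. At the end point 0, [polyG p] is a positive multiple of the slope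
    of [p], which is nonnegative there. *)
Lemma polyG_min_ge0 p z : 0 <= z -> (forall u, 0 <= u -> p.[z] <= p.[u]) ->
  0 <= (polyG p).[z].
Proof.
rewrite le_eqVlt => /predU1P[<- pmin|z0 pmin].
  rewrite horner_coef0 coef_polyG mulr_ge0//; first by rewrite ltW// coefG_gt0.
  exact: poly_min0_coef1.
pose q := p - (p.[z])%:P.
have -> : polyG p = polyG q.
  by apply/polyP => i; rewrite !coef_polyG coefB coefC/= subr0.
rewrite -(genG_poly beta_gt0 K_fin omega_ge0 dom_omega kap_omega _ (ltW z0)) /genG (leNgt z) z0/=.
set x := z `^ beta^-1; have x0 : 0 < x by exact: powR_gt0.
have xz : x `^ beta = z by rewrite /x -powRrM mulVf ?gt_eqF// powRr1// ltW.
rewrite mulr_ge0 ?powR_ge0//; apply: genL_min_ge0 => //.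
- exact: C2_pos_tilt (C2_poly q).
- by move=> u u0; rewrite /tilt mulr_ge0 ?powR_ge0// !hornerE subr_ge0 pmin// powR_ge0.
- by rewrite /tilt xz !hornerE subrr mulr0.
Qed.

Lemma size_polyG p : (size (polyG p) <= (size p).-1)%N.
Proof. exact: size_poly. Qed.

(** At a minimum point of [q] the term h G q is nonnegative, so the minimum of [q] is at least the
    value of q - h G q there. The minimum is attained because G lowers degrees: [q] has the leading
    coefficient of q - h G q. *)
Lemma resolvent_ge0 q h : 0 <= h ->
  (forall z, 0 <= z -> 0 <= (q - h *: polyG q).[z]) -> forall z, 0 <= z -> 0 <= q.[z].
Proof.
move=> h0 pos.
have [sq|sq] := leqP (size q) 1.
  have Gq : polyG q = 0.
    by apply/eqP; rewrite -size_poly_eq0 -leqn0 (leq_trans (size_polyG q))// -subn1 leq_subLR addn0.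
  by move=> z z0; have := pos z z0; rewrite Gq scaler0 subr0.
have sG : (size (- (h *: polyG q)) < size q)%N.
  rewrite size_polyN (leq_ltn_trans (size_scale_leq _ _))//.
  by rewrite (leq_ltn_trans (size_polyG q))// ltn_predL (ltn_trans _ sq).
have lq : 0 < lead_coef q.
  by rewrite -(lead_coefDl sG) ge0_lead_coef_gt0// size_polyDl.
have [z0 z00 qmin] := poly_argmin sq lq.
move=> z zge0; apply: le_trans (qmin z zge0).
have := pos z0 z00; have := polyG_min_ge0 z00 qmin.
by rewrite hornerD hornerN hornerZ => g; have := mulr_ge0 h0 g; lra.
Qed.

Definition iterG j p := iter j polyG p.

Lemma size_iterG j p : (size (iterG j p) <= size p - j)%N.
Proof.
elim: j => [|j IH]; first by rewrite subn0.
rewrite /iterG iterS (leq_trans (size_polyG _))//.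
by rewrite subnS -!subn1 leq_sub2r.
Qed.

Lemma iterG_eq0 j p : (size p <= j)%N -> iterG j p = 0.
Proof.
move=> sp; apply/eqP; rewrite -size_poly_eq0 -leqn0 (leq_trans (size_iterG j p))//.
by rewrite leqn0 subn_eq0.
Qed.

Lemma polyGD p q : polyG (p + q) = polyG p + polyG q.
Proof. by have := polyG_lin beta a b K omega 1 1 p q; rewrite !scale1r. Qed.

Lemma polyGZ c p : polyG (c *: p) = c *: polyG p.
Proof.
by have := polyG_lin beta a b K omega c 0 p 0; rewrite !scale0r !addr0.
Qed.

Lemma iterG_lin j c d p q : iterG j (c *: p + d *: q) = c *: iterG j p + d *: iterG j q.
Proof. elim: j => [//|j IH].
by rewrite /iterG !iterS -!/(iterG j _) IH polyG_lin. Qed.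

(* [euler n h p] is [(1 - h G)^-(n + 1) p], the implicit Euler scheme. *)
Definition euler n h p := \sum_(j < (size p).+1) ('C(n + j, j)%:R * h ^+ j) *: iterG j p.

Lemma eulerS n h p :
  euler n h p - h *: polyG (euler n h p) = if n is m.+1 then euler m h p else p.
Proof.
(* The coefficients of the scheme with one step less. By Pascal's rule [cE] the partial sums
   telescope, up to a remainder in [iterG N.+1 p] that vanishes for reasons of degree. *)
pose c j := if n is m.+1 then 'C(m + j, j)%:R else (j == 0%N)%:R : R.
have cE j : 'C(n + j.+1, j.+1)%:R = c j.+1 + 'C(n + j, j)%:R.
  rewrite /c; case: (n) => [|m]; first by rewrite !add0n !binn add0r.
  by rewrite addnS binS addSn -addnS natrD.
have H N : \sum_(j < N.+1) ('C(n + j, j)%:R * h ^+ j) *: iterG j p -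
    h *: polyG (\sum_(j < N.+1) ('C(n + j, j)%:R * h ^+ j) *: iterG j p) =
  \sum_(j < N.+1) (c j * h ^+ j) *: iterG j p - ('C(n + N, N)%:R * h ^+ N.+1) *: iterG N.+1 p.
  elim: N => [|N IH].
    rewrite !big_ord1 polyGZ !bin0 expr0 mul1r expr1 -/(iterG 1 p) scalerA mulr1 mul1r.
    by rewrite /c; case: (n) => [|m]; rewrite ?bin0 mulr1.
  rewrite big_ord_recr/= polyGD polyGZ -/(iterG N.+2 p) scalerDr opprD addrACA IH.
  rewrite [in RHS]big_ord_recr/= cE scalerA mulrCA -exprS.
  rewrite [(c N.+1 + _) * h ^+ N.+1]mulrDl scalerDl.
  by rewrite -!addrA; congr (_ + _); rewrite addrCA; congr (_ + _); rewrite addKr.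
rewrite /euler H iterG_eq0// scaler0 subr0 /c.
case: (n) => [|m]//; rewrite big_ord_recl/= big1 ?addr0 ?mul1r ?scale1r// => j _.
by rewrite /= mul0r scale0r.
Qed.

Lemma euler_ge0 n h p : 0 <= h -> (forall z, 0 <= z -> 0 <= p.[z]) ->
  forall z, 0 <= z -> 0 <= (euler n h p).[z].
Proof.
move=> h0 p0; elim: n => [|n IH] z z0.
  by apply: (resolvent_ge0 h0) z0 => u u0; rewrite eulerS p0.
by apply: (resolvent_ge0 h0) z0 => u u0; rewrite eulerS IH.
Qed.

Definition expG t p := \sum_(j < (size p).+1) (t ^+ j / j`!%:R) *: iterG j p.

(** What is left of the j-th coefficient of the scheme with step t / (n + 1) once t^j is factored
    out; the limit is the coefficient of the exponential series. *)
Lemma cvg_bin_fact (j : nat) :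
  ('C(n + j, j)%:R / n.+1%:R ^+ j : R) @[n --> \oo] --> (j`!%:R^-1 : R).
Proof.
elim: j => [|j IH].
  have -> : (fun n => 'C(n + 0, 0)%:R / n.+1%:R ^+ 0 : R) = cst (0`!%:R^-1).
    by apply/funext => n; rewrite /= bin0 expr0 fact0 divr1 invr1.
  exact: cvg_cst.
have -> : (fun n => 'C(n + j.+1, j.+1)%:R / n.+1%:R ^+ j.+1 : R) =
  (fun n => ('C(n + j, j)%:R / n.+1%:R ^+ j) * (1 + j%:R * n.+1%:R^-1) / j.+1%:R).
  apply/funext => n.
  have : (j.+1%:R * 'C(n + j.+1, j.+1)%:R = (n + j.+1)%:R * 'C(n + j, j)%:R :> R).
    by rewrite -!natrM addnS mul_bin_diag.
  rewrite addnS -addSn natrD exprS => E.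
  have n0 : (n.+1%:R : R) != 0 by rewrite pnatr_eq0.
  have j0 : (j.+1%:R : R) != 0 by rewrite pnatr_eq0.
  apply: (mulfI j0); rewrite mulrA E; field.
  by rewrite !(addrC 1) !natr1 j0 n0 expf_neq0.
have -> : (j.+1)`!%:R^-1 = (j`!%:R^-1 * (1 + j%:R * 0)) / j.+1%:R :> R.
  by rewrite mulr0 addr0 mulr1 factS natrM invfM mulrC.
apply: cvgM; last exact: cvg_cst.
apply: cvgM => //; apply: cvgD; first exact: cvg_cst.
by apply: cvgM; [exact: cvg_cst|exact: cvg_harmonic].
Qed.

Lemma expG_ge0 t p : 0 <= t -> (forall z, 0 <= z -> 0 <= p.[z]) ->
  forall z, 0 <= z -> 0 <= (expG t p).[z].
Proof.
move=> t0 p0 z z0.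
have H : (euler n (t / n.+1%:R) p).[z] @[n --> \oo] --> (expG t p).[z].
  have -> : (fun n => (euler n (t / n.+1%:R) p).[z]) = (fun n => \sum_(j < (size p).+1)
      ('C(n + j, j)%:R * (t / n.+1%:R) ^+ j) * (iterG j p).[z]).
    by apply/funext => n; rewrite horner_sum; apply: eq_bigr => j _; rewrite hornerZ.
  have -> : (expG t p).[z] = \sum_(j < (size p).+1) (t ^+ j / j`!%:R) * (iterG j p).[z].
    by rewrite horner_sum; apply: eq_bigr => j _; rewrite hornerZ.
  apply: (@cvg_sum_ord _ _ (fun j n => ('C(n + j, j)%:R * (t / n.+1%:R) ^+ j) * (iterG j p).[z])
    (fun j => (t ^+ j / j`!%:R) * (iterG j p).[z])) => j.
  apply: cvgM; last exact: cvg_cst.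
  have -> : (fun n => 'C(n + j, j)%:R * (t / n.+1%:R) ^+ j) =
    (fun n => t ^+ j * ('C(n + j, j)%:R / n.+1%:R ^+ j)).
    by apply/funext => n; rewrite expr_div_n; ring.
  apply: cvgM; first exact: cvg_cst.
  exact: cvg_bin_fact.
rewrite -(cvg_lim _ H)//; apply: limr_ge; first by apply/cvg_ex; eexists; exact: H.
by apply: nearW => n; apply: euler_ge0 => //; rewrite divr_ge0.
Qed.

Lemma expG_widen N t p : (size p <= N)%N ->
  expG t p = \sum_(j < N) (t ^+ j / j`!%:R) *: iterG j p.
Proof.
have W M : (size p <= M)%N -> \sum_(j < M.+1) (t ^+ j / j`!%:R) *: iterG j p =
  \sum_(j < M) (t ^+ j / j`!%:R) *: iterG j p.
  by move=> sM; rewrite big_ord_recr/= iterG_eq0// scaler0 addr0.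
have {}W k : \sum_(j < size p + k) (t ^+ j / j`!%:R) *: iterG j p =
  \sum_(j < size p) (t ^+ j / j`!%:R) *: iterG j p.
  by elim: k => [|k IH]; rewrite ?addn0// addnS W ?leq_addr.
by move=> sN; rewrite /expG -(subnKC sN) W -(W 1%N) addn1.
Qed.

Lemma expG_lin t c d p q : expG t (c *: p + d *: q) = c *: expG t p + d *: expG t q.
Proof.
pose N := (size p + size q)%N.
rewrite !(@expG_widen N) ?leq_addr ?leq_addl//; last first.
  rewrite (leq_trans (size_polyD _ _))// geq_max.
  by rewrite !(leq_trans (size_scale_leq _ _))// ?leq_addr ?leq_addl.
rewrite !scaler_sumr -big_split; apply: eq_bigr => j _ /=.
by rewrite iterG_lin scalerDr !scalerA (mulrC c) (mulrC d).
Qed.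

Lemma expG0 p : expG 0 p = p.
Proof.
rewrite /expG big_ord_recl/= big1 ?addr0 ?expr0 ?divr1 ?scale1r// => j _.
by rewrite expr0n/= mul0r scale0r.
Qed.

Lemma expG1 t : expG t 1 = 1.
Proof.
rewrite /expG size_poly1 !big_ord_recl big_ord0 addr0/= fact0 expr0 divr1 scale1r.
have -> : polyG 1 = 0 by rewrite -[LHS]/(iterG 1 1) iterG_eq0// size_poly1.
by rewrite scaler0 addr0.
Qed.

Lemma is_derive_expG t p z : is_derive t 1 (fun s => (expG s p).[z]) (expG t (polyG p)).[z].
Proof.
pose N := size p.
rewrite (@expG_widen N) ?(leq_trans (size_polyG _)) ?leq_pred//.
have -> : (fun s => (expG s p).[z]) =
   \sum_(j < N.+1) (fun s => (s ^+ j / j`!%:R) * (iterG j p).[z]).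
  apply/funext => s; rewrite (@expG_widen N.+1) ?leqnSn// horner_sum.
  by rewrite fct_sumE; apply: eq_bigr => j _; rewrite hornerZ.
have D (j : 'I_N.+1) : is_derive t 1 (fun s => (s ^+ j / j`!%:R) * (iterG j p).[z])
   ((t ^+ j.-1 *+ j / j`!%:R) * (iterG j p).[z]).
  have Dj : is_derive t 1 (fun s => s ^+ j) (t ^+ j.-1 *+ j).
    have := is_derive_poly 'X^j t; rewrite derivXn hornerMn hornerXn.
    by have -> : horner 'X^j = (fun s : R => s ^+ j) by apply/funext => s; rewrite hornerXn.
  by apply: is_derive_eq; rewrite /GRing.scale/=; ring.
apply: is_derive_eq.
rewrite big_ord_recl/= mulr0n !mul0r add0r horner_sum; apply: eq_bigr => j _.
rewrite hornerZ /iterG -iterSr/= /bump/= add1n; congr (_ * _).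
by rewrite add0n factS natrM -mulr_natl -mulf_div divff ?mul1r// pnatr_eq0.
Qed.

Lemma iterG_Xn l k : (l <= k)%N ->
  iterG l 'X^k = (\prod_((k - l).+1 <= j < k.+1) coefG j) *: 'X^(k - l).
Proof.
elim: l => [|l IH] lk; first by rewrite subn0 big_geq// scale1r.
rewrite /iterG iterS -/(iterG l _) IH ?(ltnW lk)// polyGZ.
have -> : polyG 'X^(k - l) = coefG (k - l) *: 'X^(k - l.+1).
  apply/polyP => i; rewrite coef_polyG coefZ !coefXn -(subnSK lk) eqSS.
  by case: eqP => [->//|]; rewrite !mulr0.
rewrite scalerA mulrC; congr (_ *: _); rewrite subnSK//.
by rewrite [RHS]big_ltn// ltnS leq_subr.
Qed.

Lemma expG_Xn t k : expG t 'X^k = \sum_(l < k.+1)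
  ((t ^+ l / l`!%:R) * \prod_((k - l).+1 <= j < k.+1) coefG j) *: 'X^(k - l).
Proof.
rewrite (@expG_widen k.+1) ?size_polyXn//; apply: eq_bigr => l _.
by rewrite iterG_Xn ?scalerA// -ltnS.
Qed.

End semigroup.

(** * Haviland's theorem on the half-line *)

Section positive_extension.
Context {R : realType}.
Variable Lam : {poly R} -> R.
Hypothesis Lam_lin : forall (c d : R) (p q : {poly R}), Lam (c *: p + d *: q) = c * Lam p + d * Lam q.
Hypothesis Lam_ge0 : forall p, (forall z, 0 <= z -> 0 <= p.[z]) -> 0 <= Lam p.
Implicit Types (f g : R -> R) (p q : {poly R}) (s t : (R -> R) -> R).

Lemma Lam_add p q : Lam (p + q) = Lam p + Lam q.
Proof. by rewrite -[in LHS](scale1r p) -[in LHS](scale1r q) Lam_lin !mul1r. Qed.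

Lemma Lam_scale c p : Lam (c *: p) = c * Lam p.
Proof. by rewrite -[in LHS](addr0 (c *: p)) -(scale0r p) Lam_lin mul0r addr0. Qed.

Lemma Lam_le p q : (forall z, 0 <= z -> p.[z] <= q.[z]) -> Lam p <= Lam q.
Proof.
move=> pq; rewrite -subr_ge0.
have -> : Lam q - Lam p = Lam (q + (-1) *: p) by rewrite Lam_add Lam_scale mulN1r.
by apply: Lam_ge0 => z z0; rewrite hornerD hornerZ mulN1r subr_ge0 pq.
Qed.

Definition poly_bounded f := exists p : {poly R}, forall z, 0 <= z -> `|f z| <= p.[z].

Definition le_poly f p := forall z, 0 <= z -> f z <= p.[z].

Lemma poly_bounded_horner p : poly_bounded (horner p).
Proof.
exists (p ^+ 2 + 1) => z z0; rewrite hornerD horner_exp hornerC.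
by rewrite ler_norml; have := sqr_ge0 p.[z]; nra.
Qed.

Lemma poly_boundedD f g : poly_bounded f -> poly_bounded g -> poly_bounded (fun z => f z + g z).
Proof.
move=> [p fp] [q gq]; exists (p + q) => z z0.
by rewrite hornerD (le_trans (ler_normD _ _))// lerD ?fp ?gq.
Qed.

Lemma poly_boundedZ c f : poly_bounded f -> poly_bounded (fun z => c * f z).
Proof.
move=> [p fp]; exists (`|c| *: p) => z z0.
by rewrite hornerZ normrM ler_wpM2l ?fp.
Qed.

(** The sublinear functional of M. Riesz's extension theorem: every positive extension of [Lam] lies
    below it. *)
Definition upper f : R := inf [set Lam p | p in [set p | le_poly f p]].

Lemma upper_nonempty f : poly_bounded f -> [set Lam p | p in [set p | le_poly f p]] !=set0.
Proof.
by move=> [p fp]; exists (Lam p), p => // z z0; rewrite (le_trans _ (fp z z0)) ?ler_norm.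
Qed.

Lemma upper_lbound f : poly_bounded f ->
  has_lbound [set Lam p | p in [set p | le_poly f p]].
Proof.
move=> [p fp]; exists (Lam (-1 *: p)) => _ [q fq <-]; apply: Lam_le => z z0.
rewrite hornerZ mulN1r; apply: le_trans (fq z z0).
by rewrite lerNl (le_trans _ (fp z z0))// -normrN ler_norm.
Qed.

Lemma upper_le f p : poly_bounded f -> le_poly f p -> upper f <= Lam p.
Proof. by move=> fb fp; apply: ge_inf; [exact: upper_lbound|exists p]. Qed.

Lemma le_upper f x : poly_bounded f -> (forall p, le_poly f p -> x <= Lam p) -> x <= upper f.
Proof.
by move=> fb H; apply: lb_le_inf; [exact: upper_nonempty|move=> _ [p fp <-]; exact: H].
Qed.

Definition sublinear s := [/\
  forall f g, poly_bounded f -> poly_bounded g -> s (fun z => f z + g z) <= s f + s g,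
  forall c f, 0 < c -> poly_bounded f -> s (fun z => c * f z) <= c * s f &
  forall f, poly_bounded f -> s f <= upper f].

Lemma sublinear_upper : sublinear upper.
Proof.
split=> [f g fb gb|c f c0 fb|//].
- rewrite -lerBlDr; apply: le_upper => // p fp.
  rewrite lerBlDr -lerBlDl; apply: le_upper => // q gq.
  rewrite lerBlDl -Lam_add; apply: upper_le; first exact: poly_boundedD.
  by move=> z z0; rewrite hornerD lerD ?fp ?gq.
- rewrite -ler_pdivrMl//; apply: le_upper => // p fp.
  rewrite ler_pdivrMl// -Lam_scale; apply: upper_le; first exact: poly_boundedZ.
  by move=> z z0; rewrite hornerZ ler_wpM2l ?fp// ltW.
Qed.

Lemma sublinear_scale s c f : sublinear s -> 0 < c -> poly_bounded f ->
  s (fun z => c * f z) = c * s f.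
Proof.
move=> [_ sZ _] c0 fb; apply/eqP; rewrite eq_le sZ//=.
rewrite -ler_pdivlMl//; have := sZ c^-1 _ ltac:(rewrite invr_gt0//) (poly_boundedZ c fb).
by rewrite (_ : (fun z => c^-1 * (c * f z)) = f)//; apply/funext => z; rewrite mulKf// gt_eqF.
Qed.

Lemma poly_bounded0 : poly_bounded (fun=> 0).
Proof. by exists 0 => z _; rewrite normr0 horner0. Qed.

Lemma sublinear0 s : sublinear s -> s (fun=> 0) = 0.
Proof.
move=> ss; have := sublinear_scale ss (ltr0Sn R 1) poly_bounded0.
rewrite (_ : (fun _ : R => 2 * 0) = (fun=> 0)); last by apply/funext => z; rewrite mulr0.
lra.
Qed.

Lemma sublinear_ge s f : sublinear s -> poly_bounded f -> - upper (fun z => - f z) <= s f.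
Proof.
move=> ss fb; have nfb : poly_bounded (fun z => - f z).
  by have := poly_boundedZ (-1) fb; under eq_fun do rewrite mulN1r.
have [sD _ su] := ss.
have := sD _ _ fb nfb.
rewrite (_ : (fun z => f z + - f z) = (fun=> 0)); last by apply/funext => z; rewrite subrr.
by rewrite sublinear0//; have := su _ nfb; lra.
Qed.

(* Hahn-Banach: a sublinear functional that is minimal for the pointwise order is linear. *)
Lemma exists_minimal_sublinear : exists2 s, sublinear s &
  forall t, sublinear t -> (forall f, poly_bounded f -> t f <= s f) ->
    forall f, poly_bounded f -> s f <= t f.
Proof.
pose T := {s | sublinear s}.
(* The order is reversed, so that the maximal element given by Zorn's lemma is a minimal
   functional. *)
pose le (s t : T) := `[< forall f, poly_bounded f -> sval t f <= sval s f >].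
have [||A Atot|m mmin] := @ZL_preorder T (exist _ _ sublinear_upper) le.
- by move=> s; apply/asboolP.
- move=> r s t /asboolP rs /asboolP st; apply/asboolP => f fb.
  by rewrite (le_trans (st f fb))// rs.
- have [->|/set0P[s0 As0]] := eqVneq A set0; first by exists (exist _ _ sublinear_upper).
  pose V f := [set sval s f | s in A].
  pose m f := inf (V f).
  have Vlb f : poly_bounded f -> has_lbound (V f).
    by move=> fb; exists (- upper (fun z => - f z)) => _ [s As <-]; exact: sublinear_ge (svalP s) fb.
  have mle f (s : T) : poly_bounded f -> A s -> m f <= sval s f.
    by move=> fb As; apply: ge_inf; [exact: Vlb|exists s].
  have lem f x : (forall s : T, A s -> x <= sval s f) -> x <= m f.
    by move=> H; apply: lb_le_inf; [exists (sval s0 f), s0|move=> _ [s As <-]; exact: H].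
  have ms : sublinear m.
    split=> [f g fb gb|c f c0 fb|f fb].
    - rewrite -lerBlDr; apply: (lem _ _) => s As.
      rewrite lerBlDr -lerBlDl. apply: (lem g) => t At.
      have fgb := poly_boundedD fb gb.
      (* In a chain one of [s] and [t] lies below the other, and its subadditivity serves both
         infima. *)
      rewrite lerBlDl; have [/asboolP st|/asboolP ts] := Atot _ _ As At.
        have [sD _ _] := svalP t.
        by rewrite (le_trans (mle _ _ fgb At))// (le_trans (sD _ _ fb gb))// lerD2r st.
      have [sD _ _] := svalP s.
      by rewrite (le_trans (mle _ _ fgb As))// (le_trans (sD _ _ fb gb))// lerD2l ts.
    - rewrite -ler_pdivrMl//; apply: (lem _ _) => s As; rewrite ler_pdivrMl//.
      have [_ sZ _] := svalP s.
      by rewrite (le_trans (mle _ _ (poly_boundedZ c fb) As))// sZ.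
    - by have [_ _ su] := svalP s0; rewrite (le_trans (mle _ _ fb As0))// su.
  exists (exist _ m ms) => s As; apply/asboolP => f fb /=; exact: mle.
- exists (sval m); first exact: svalP.
  move=> t ts tm; have /asboolP := mmin (exist _ t ts) ltac:(apply/asboolP; exact: tm).
  by move=> H f fb; exact: H.
Qed.

Lemma exists_positive_extension : exists Lx : (R -> R) -> R, [/\
  forall f g, poly_bounded f -> poly_bounded g -> Lx (fun z => f z + g z) = Lx f + Lx g,
  forall c f, 0 <= c -> poly_bounded f -> Lx (fun z => c * f z) = c * Lx f,
  forall f g, poly_bounded f -> poly_bounded g ->
    (forall z, 0 <= z -> f z <= g z) -> Lx f <= Lx g &
  forall p, Lx (horner p) = Lam p].
Proof.
have [s ss smin] := exists_minimal_sublinear.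
have sD f g : poly_bounded f -> poly_bounded g -> s (fun z => f z + g z) = s f + s g.
  move=> fb gb; have [sD _ _] := ss; apply/eqP; rewrite eq_le sD//=.
  (* The infimum [t] of these values is a sublinear competitor below [s]. Minimality of [s] and the
     choice c = 1 give s f <= s (f + g) - s g, the missing half of additivity. *)
  pose V h := [set s (fun z => h z + c * g z) - c * s g | c in [set c : R | 0 < c]].
  pose t h := inf (V h).
  have Vlb h : poly_bounded h -> has_lbound (V h).
    move=> hb; have nhb : poly_bounded (fun z => - h z).
      by have := poly_boundedZ (-1) hb; under eq_fun do rewrite mulN1r.
    exists (- s (fun z => - h z)) => _ [c c0 <-].
    have cgb := poly_boundedZ c gb.
    have := sD _ _ (poly_boundedD hb cgb) nhb.
    rewrite (_ : (fun z => h z + c * g z + - h z) = (fun z => c * g z)); last first.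
      by apply/funext => z; rewrite addrAC subrr add0r.
    rewrite (sublinear_scale ss c0 gb); lra.
  have tle h c : poly_bounded h -> 0 < c -> t h <= s (fun z => h z + c * g z) - c * s g.
    by move=> hb c0; apply: ge_inf; [exact: Vlb|exists c].
  have tge h x : (forall c, 0 < c -> x <= s (fun z => h z + c * g z) - c * s g) -> x <= t h.
    by move=> H; apply: lb_le_inf; [exists (s (fun z => h z + 1 * g z) - 1 * s g); exists 1 => //; exact: ltr01|
      move=> _ [c c0 <-]; exact: H].
  have ts h : poly_bounded h -> t h <= s h.
    move=> hb; rewrite (le_trans (tle h 1 hb ltr01))// lerBlDr.
    rewrite mul1r (le_trans _ (sD _ _ hb gb))// le_eqVlt; apply/orP; left; apply/eqP.
    by congr s; apply/funext => z; rewrite mul1r.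
  have tsub : sublinear t.
    split=> [h k hb kb|c h c0 hb|h hb].
    - rewrite -lerBlDr; apply: (tge _ _) => c c0; rewrite lerBlDr -lerBlDl. apply: (tge k) => d d0.
      have cgb := poly_boundedZ c gb; have dgb := poly_boundedZ d gb.
      have := sD _ _ (poly_boundedD hb cgb) (poly_boundedD kb dgb).
      have := tle _ (c + d) (poly_boundedD hb kb) ltac:(lra).
      rewrite (_ : (fun z => h z + k z + (c + d) * g z) =
        (fun z => h z + c * g z + (k z + d * g z))); last by apply/funext => z; ring.
      lra.
    - rewrite -ler_pdivrMl//; apply: (tge _ _) => d d0; rewrite ler_pdivrMl//.
      have := tle _ (c * d) (poly_boundedZ c hb) ltac:(exact: mulr_gt0).
      rewrite (_ : (fun z => c * h z + c * d * g z) = (fun z => c * (h z + d * g z))); last first.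
        by apply/funext => z; ring.
      by rewrite sublinear_scale//; [lra|apply: poly_boundedD => //; exact: poly_boundedZ].
    - by have [_ _ su] := ss; rewrite (le_trans (ts h hb))// su.
  have := smin t tsub ts f fb => /le_trans -/(_ _ (tle f 1 fb ltr01)).
  rewrite (_ : (fun z => f z + 1 * g z) = (fun z => f z + g z)); last first.
    by apply/funext => z; rewrite mul1r.
  lra.
have sN f : poly_bounded f -> s (fun z => - f z) = - s f.
  move=> fb; have nfb : poly_bounded (fun z => - f z).
    by have := poly_boundedZ (-1) fb; under eq_fun do rewrite mulN1r.
  have := sD _ _ fb nfb; rewrite (_ : (fun z => f z + - f z) = (fun=> 0)); last first.
    by apply/funext => z; rewrite subrr.
  by rewrite sublinear0//; lra.
exists s; split => //.
- move=> c f; rewrite le_eqVlt => /predU1P[<- fb|c0 fb]; last exact: sublinear_scale.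
  by rewrite mul0r -[RHS](sublinear0 ss); congr s; apply/funext => z; rewrite mul0r.
- move=> f g fb gb fg.
  have ngb : poly_bounded (fun z => - g z).
    by have := poly_boundedZ (-1) gb; under eq_fun do rewrite mulN1r.
  have [_ _ su] := ss; have := su _ (poly_boundedD fb ngb); rewrite sD// sN//.
  have : upper (fun z => f z + - g z) <= Lam 0.
    apply: upper_le; first exact: poly_boundedD.
    by move=> z z0; rewrite horner0 subr_le0 fg.
  by rewrite -(scale0r 0) Lam_scale mul0r; lra.
- move=> p; have [_ _ su] := ss.
  have H q : s (horner q) <= Lam q.
    apply: (le_trans (su _ (poly_bounded_horner q))).
    by apply: upper_le => //; exact: poly_bounded_horner.
  apply/eqP; rewrite eq_le H/=.
  have := H (-1 *: p); rewrite Lam_scale mulN1r.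
  rewrite (_ : horner (-1 *: p) = (fun z => - p.[z])); last first.
    by apply/funext => z; rewrite hornerZ mulN1r.
  by rewrite (sN _ (poly_bounded_horner p)) lerN2.
Qed.

(** [Q] will be read off a functional without any continuity, hence need not be right-continuous.
    Right limits repair this, and the conclusion keeps the comparison at neighbouring points that
    survives. *)
Lemma exists_cumulative (Q : R -> R) (M : R) :
  {homo Q : x y / x <= y >-> y <= x} -> (forall x, Q x <= M) -> (forall x, 0 <= Q x) ->
  exists F : cumulative R R, forall x y, x < y -> - F x <= Q x /\ Q y <= - F x.
Proof.
move=> Qn QM Q0.
pose V x := [set Q y | y in [set y | x < y]].
pose Qr x := sup (V x).
have Vub x : has_ubound (V x) by exists M => _ [y _ <-].
have V0 x : V x !=set0 by exists (Q (x + 1)), (x + 1) => //; rewrite /= ltrDl.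
have Qle x y : x < y -> Q y <= Qr x by move=> xy; apply: ub_le_sup => //; exists y.
have leQ x c : (forall y, x < y -> Q y <= c) -> Qr x <= c.
  by move=> H; apply: ge_sup => // _ [y xy <-]; exact: H.
have Qrn x y : x <= y -> - Qr x <= - Qr y.
  by move=> xy; rewrite lerN2; apply: (leQ) => z yz; apply: Qle; exact: le_lt_trans yz.
have Qrc : right_continuous (fun x => - Qr x).
  move=> x; apply/cvgrPdist_le => /= e e0.
  have [_ [y xy <-] Qy] := sup_adherent e0 (conj (V0 x) (Vub x)).
  near=> z.
  have xz : x < z by near: z; exact: nbhs_right_gt.
  have zy : z < y by near: z; exact: nbhs_right_lt.
  have := Qrn _ _ (ltW xz); have := Qle _ _ zy; rewrite -/(Qr x) in Qy.
  by move=> h1 h2; rewrite ler_norml; apply/andP; split; lra.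
pose F : cumulative R R := HB.pack (fun x => - Qr x) (isCumulative.Build R _ R (fun x => - Qr x) Qrn Qrc).
exists F => x y xy; rewrite opprK; split; last exact: Qle.
by apply: (leQ) => z xz; apply: Qn; exact: ltW.
Unshelve. all: by end_near. Qed.

Lemma lebesgue_stieltjes_oc (F : cumulative R R) (x y : R) : x <= y ->
  lebesgue_stieltjes_measure F `]x, y] = (F y - F x)%:E.
Proof.
move=> xy; rewrite /lebesgue_stieltjes_measure /measure_extension/=.
by rewrite measurable_mu_extE/= ?wlength_itv_bnd//; exact: is_ocitv.
Qed.

Lemma lebesgue_stieltjes_oy (F : cumulative R R) (x : R) :
  F y @[y --> +oo] --> (0 : R) ->
  lebesgue_stieltjes_measure F `]x, +oo[ = (- F x)%:E.
Proof.
move=> F0; set nu := lebesgue_stieltjes_measure F.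
have -> : `]x, +oo[%classic = \bigcup_n (`]x, x + n%:R]%classic : set (measurableTypeR R)).
  apply/seteqP; split => y /=; rewrite in_itv/= ?andbT.
    move=> xy; exists (Num.truncn (y - x)).+1 => //=; rewrite in_itv/= xy/= -lerBlDl.
    by apply/ltW; rewrite truncnS_gt.
  by case=> n _ /=; rewrite in_itv/= => /andP[].
have mI n : measurable (`]x, x + n%:R]%classic : set (measurableTypeR R)) by exact: measurable_itv.
have C1 := @nondecreasing_cvg_mu _ _ _ nu (fun n => `]x, x + n%:R]%classic) mI.
have {}C1 := C1 (bigcupT_measurable _ mI).
have C2 : nu `]x, x + n%:R]%classic @[n --> \oo] --> (- F x)%:E.
  have -> : (fun n => nu `]x, x + n%:R]%classic) = (fun n => (F (x + n%:R) - F x)%:E).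
    by apply/funext => n; rewrite /nu lebesgue_stieltjes_oc// lerDl.
  apply: cvg_EFin; first exact: nearW.
  have C3 : F (x + n%:R) @[n --> \oo] --> (0 : R).
    apply: (cvg_comp (fun n : nat => x + n%:R) _ _ F0); apply/cvgryPge => A; near=> n.
    by rewrite -lerBlDl; near: n; exact: nbhs_infty_ger.
  suff : F (x + n%:R) - F x @[n --> \oo] --> - F x by [].
  by rewrite -[X in _ --> X]sub0r; exact: (cvgB C3 (cvg_cst _)).
apply: (cvg_unique _ _ C2) => //; apply: C1.
move=> n m nm; apply/subsetPset => y; rewrite /= !in_itv/= => /andP[-> h]/=.
by rewrite (le_trans h)// lerD2l ler_nat.
Unshelve. all: by end_near. Qed.

(* Summing the indicators of [{i e < w}] for [1 <= i <= N] rounds [w] down to the mesh [e],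
   up to the height [N e]. *)
Lemma staircaseP (e w : R) N : 0 < e -> 0 <= w ->
  let S := \sum_(i < N) e * (i.+1%:R * e < w)%R%:R in
  if N%:R * e < w then S = N%:R * e else S <= w <= S + e.
Proof.
move=> e0 w0; elim: N => [|N] /=.
  rewrite mul0r big_ord0; case: ltP => [//|w00].
  by rewrite w0 add0r (le_trans w00)// ltW.
rewrite big_ord_recr/=; set S := \sum_(_ < N) _ => IH.
have E : N.+1%:R * e = N%:R * e + e by rewrite -natr1 mulrDl mul1r.
case: (ltP (N.+1%:R * e) w) => h /=.
  rewrite mulr1; move: IH; rewrite (lt_trans _ h); last by rewrite E ltrDl.
  by rewrite E => ->.
rewrite mulr0 addr0; move: IH; case: ltP => // h' ->.
by rewrite ltW//= -E.
Qed.

(** The tails of [nu] come from the extended functional on indicators of half-lines. A positive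
    moment is then compared with staircases in z^(k+1): staircases from below give one inequality;
    for the other, the part above height n is at most z^(2k+2) / n, again a polynomial. *)
Lemma haviland : exists nu : borel_measure R,
  nu `]-oo, 0[%classic = 0%E /\
  forall k, (\int[nu]_(z in `[0%R, +oo[) (z ^+ k)%:E = (Lam 'X^k)%:E)%E.
Proof.
have [Lx [Ladd Lscale Lle Lpoly]] := exists_positive_extension.
pose ind x : R -> R := fun z => (x < z)%R%:R.
have indb x : poly_bounded (ind x).
  by exists 1 => z z0; rewrite hornerC /ind; case: (x < z); rewrite ?normr1 ?normr0.
pose M := Lam 1.
pose Q x := Lx (ind x).
have Pb1 := poly_bounded_horner 1.
have Qn : {homo Q : x y / x <= y >-> y <= x}.
  move=> x y xy; apply: Lle => // z z0; rewrite /ind ler_nat.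
  by case: (ltP y z) => // yz; rewrite (le_lt_trans xy yz).
have QM x : Q x <= M.
  by rewrite /M -Lpoly; apply: Lle => // z z0; rewrite hornerC /ind; case: (x < z).
have Q0 x : 0 <= Q x.
  have := Lle _ _ (poly_bounded_horner 0) (indb x); rewrite Lpoly.
  rewrite -[X in Lam X](scale0r 0) Lam_scale mul0r; apply => z z0.
  by rewrite horner0 /ind; case: (x < z).
(* Functions are compared on [0, +oo[ only, where this indicator is 1; hence [nu] will have no mass
   on the negative axis. *)
have QMx x : x < 0 -> Q x = M.
  move=> x0; apply/eqP; rewrite eq_le QM/= /M -Lpoly; apply: Lle => // z z0.
  by rewrite hornerC /ind (lt_le_trans x0 z0).
(* Chebyshev's inequality for the functional, which keeps mass from escaping to +oo. *)
have Qx x : 0 < x -> Q x <= Lam 'X / x.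
  move=> x0; rewrite mulrC -Lam_scale -Lpoly; apply: Lle => //.
    exact: poly_bounded_horner.
  move=> z z0; rewrite hornerZ hornerX /ind; case: ltP => [xz|_].
    by rewrite ler_pdivlMl// mulr1 ltW.
  by rewrite mulr_ge0// invr_ge0 ltW.
have [F HF] := exists_cumulative Qn QM Q0.
have FQ x : - F x <= Q x by have [] := HF x (x + 1) ltac:(rewrite ltrDl//).
have F0 : F y @[y --> +oo] --> (0 : R).
  have LX0 : 0 <= Lam 'X by apply: Lam_ge0 => z; rewrite hornerX.
  apply/cvgrPdist_le => /= e e0; near=> y.
  have y0 : 0 < y by near: y; exact: nbhs_pinfty_gt.
  have yL : Lam 'X / e <= y by near: y; apply: nbhs_pinfty_ge; exact: num_real.
  have := FQ y; have := Qx _ y0; have [_] := HF y (y + 1) ltac:(rewrite ltrDl//).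
  have := Q0 (y + 1); move=> h1 h2 h3 h4.
  have : Lam 'X / y <= e by rewrite ler_pdivrMr// mulrC -ler_pdivrMr.
  by move=> h5; rewrite sub0r ler_norml; apply/andP; split; lra.
pose nu : borel_measure R := lebesgue_stieltjes_measure F.
have nuE x : nu `]x, +oo[%classic = (- F x)%:E by exact: lebesgue_stieltjes_oy.
have Fneg x : x < 0 -> - F x = M.
  move=> x0; apply/eqP; rewrite eq_le (le_trans (FQ x))//=.
  have [_] := HF x (x / 2) ltac:(lra); rewrite QMx//; lra.
exists nu.
have nu0 : nu `]-oo, 0[%classic = 0%E.
  have mI n : measurable (`]- n%:R, - n.+1%:R^-1]%classic : set (measurableTypeR R)).
    exact: measurable_itv.
  have zero n : nu `]- n%:R, - n.+1%:R^-1]%classic = 0%E.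
    have n0 : - n.+1%:R^-1 < 0 :> R by rewrite oppr_lt0 invr_gt0 ltr0n.
    have [h|h] := leP (- n%:R : R) (- n.+1%:R^-1).
      have := Fneg _ n0; have := Fneg _ (le_lt_trans h n0).
      move=> h1 h2; have -> : nu `]- n%:R, - n.+1%:R^-1]%classic =
        (F (- n.+1%:R^-1) - F (- n%:R))%:E by exact: lebesgue_stieltjes_oc.
      by congr (_%:E); lra.
    by rewrite set_itv_ge ?measure0// bnd_simp -leNgt ltW.
  have -> : `]-oo, (0 : R)[%classic = \bigcup_n `]- n%:R, - n.+1%:R^-1]%classic.
    apply/seteqP; split => y /=; rewrite in_itv/=.
      move=> y0; near \oo => n; exists n => //=; rewrite in_itv/=; apply/andP; split.
        by rewrite ltrNl; near: n; exact: nbhs_infty_gtr.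
      rewrite lerNr invf_ple ?posrE ?oppr_gt0 ?ltr0n//.
      by rewrite -natr1 -lerBlDr; near: n; exact: nbhs_infty_ger.
    case=> n _ /=; rewrite in_itv/= => /andP[_] /le_lt_trans; apply.
    by rewrite oppr_lt0 invr_gt0 ltr0n.
  apply: measure_negligible; first exact: bigcupT_measurable.
  apply: negligible_bigcup => n; apply/negligibleP; first exact: mI.
  exact: zero.
split => // k.
have nuy : nu `[0, +oo[%classic = M%:E.
  have := nuE (- 1); rewrite Fneg ?oppr_lt0 ?ltr01// => <-.
  have -> : `](- 1 : R), +oo[%classic = `](- 1 : R), 0[%classic `|` `[0, +oo[%classic.
    by rewrite -itv_bndbnd_setU// bnd_simp.
  rewrite measureU//; last first.
    by apply/seteqP; split => // z [] /=; rewrite !in_itv/= => /andP[_ z0]; rewrite andbT leNgt z0.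
  rewrite -[LHS]add0e; congr (_ + _)%E; apply/esym.
  apply/eqP; rewrite eq_le measure_ge0 andbT -nu0 le_measure// ?inE//.
  by move=> z /=; rewrite !in_itv/= => /andP[].
case: k => [|k].
  have := @integral_cst _ _ _ nu _ (measurable_itv `[0, +oo[) 1; rewrite nuy mul1e => <-.
  by apply: eq_integral => z _; rewrite expr0.
have mX n : measurable_fun (`[0, +oo[%classic : set (measurableTypeR R)) (fun z : R => (z ^+ n)%:E).
  by apply/measurable_EFinP/measurable_funTS; exact: measurable_funX.
have Kpos : 0 < k.+1%:R^-1 :> R by rewrite invr_gt0 ltr0n.
(* The points where z^(k+1) crosses the levels (i + 1) e, so that the staircase is a combination of
   indicators of half-lines. *)
pose x (e : R) (i : nat) : R := (i.+1%:R * e) `^ k.+1%:R^-1.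
have xk e i : 0 < e -> 0 <= x e i /\ x e i ^+ k.+1 = i.+1%:R * e.
  move=> e0; rewrite powR_ge0; split => //.
  by rewrite -powR_mulrn ?powR_ge0// -powRrM mulVf ?pnatr_eq0// powRr1// mulr_ge0 ?ler0n ?ltW.
have xlt e i z : 0 < e -> 0 <= z -> (x e i < z) = (i.+1%:R * e < z ^+ k.+1).
  by move=> e0 z0; have [x0 xE] := xk e i e0; rewrite -xE ltr_pXn2r// ?nnegrE.
pose S e N z := \sum_(i < N) e * ind (x e i) z.
have SE e N z : 0 < e -> 0 <= z -> S e N z = \sum_(i < N) e * (i.+1%:R * e < z ^+ k.+1)%R%:R.
  by move=> e0 z0; apply: eq_bigr => i _; rewrite /ind xlt.
have Sb e N : poly_bounded (S e N).
  elim: N => [|N IH].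
    rewrite (_ : S e 0 = (fun=> 0)); first exact: poly_bounded0.
    by apply/funext => z; rewrite /S big_ord0.
  rewrite (_ : S e N.+1 = (fun z => S e N z + e * ind (x e N) z)).
    by apply: poly_boundedD => //; exact: poly_boundedZ.
  by apply/funext => z; rewrite /S big_ord_recr.
have LS e N : 0 <= e -> Lx (S e N) = \sum_(i < N) e * Q (x e i).
  move=> e0; elim: N => [|N IH].
    rewrite big_ord0 (_ : S e 0 = horner 0) ?Lpoly; last first.
      by apply/funext => z; rewrite /S big_ord0 horner0.
    by rewrite -[X in Lam X](scale0r 0) Lam_scale mul0r.
  rewrite big_ord_recr/= -IH -Lscale// -Ladd//; last exact: poly_boundedZ.
  by congr Lx; apply/funext => z; rewrite /S big_ord_recr.
have D0 : measurable (`[0, +oo[%classic : set (measurableTypeR R)) by exact: measurable_itv.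
have mi y : measurable_fun (`[0, +oo[%classic : set (measurableTypeR R)) (fun z => (ind y z)%:E).
  apply/measurable_EFinP/measurable_funTS.
  have -> : ind y = \1_(`]y, +oo[%classic).
    by apply/funext => z; rewrite indicE mem_setE in_itv/= andbT.
  by apply: measurable_indic; exact: measurable_itv.
have iS e N : 0 <= e -> (\int[nu]_(z in `[0%R, +oo[) (S e N z)%:E =
    (\sum_(i < N) e * - F (x e i))%:E)%E.
  move=> e0.
  under eq_integral do rewrite /S -sumEFin.
  rewrite ge0_integral_sum//; last 2 first.
  - move=> i; have -> : (fun z => (e * ind (x e i) z)%:E) = (fun z => e%:E * (ind (x e i) z)%:E)%E by [].
    exact: measurable_funeM.
  - by move=> i z _; rewrite lee_fin mulr_ge0// /ind.
  rewrite -sumEFin; apply: eq_bigr => i _.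
  under eq_integral do rewrite EFinM.
  rewrite ge0_integralZl_EFin//; last by move=> z _; rewrite lee_fin /ind.
  rewrite EFinM -nuE; congr (_ * _)%E.
  rewrite (_ : `]x e i, +oo[%classic = `]x e i, +oo[%classic `&` `[0, +oo[%classic); last first.
    apply/esym/setIidl => z /=; rewrite !in_itv/= !andbT => h.
    by rewrite ltW// (le_lt_trans _ h)// powR_ge0.
  by rewrite -integral_indic//; apply: eq_integral => z _; rewrite indicE mem_setE in_itv/= andbT.
have S_le e N z : 0 < e -> 0 <= z -> S e N z <= z ^+ k.+1.
  move=> e0 z0; have := @staircaseP e (z ^+ k.+1) N e0 ltac:(exact: exprn_ge0).
  by rewrite SE//=; case: ltP => [h ->|_ /andP[]//]; exact: ltW.
have up e N : 0 < e -> \sum_(i < N) e * - F (x e i) <= Lam 'X^(k.+1).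
  move=> e0; apply: (@le_trans _ _ (Lx (S e N))).
    by rewrite (LS _ _ (ltW e0)); apply: ler_sum => i _; rewrite ler_pM2l.
  rewrite -Lpoly; apply: Lle => //; first exact: poly_bounded_horner.
  by move=> z z0; rewrite hornerXn S_le.
have M0 : 0 <= M by rewrite (le_trans (Q0 0))// QM.
have mS e N : measurable_fun (`[0, +oo[%classic : set (measurableTypeR R)) (fun z => (S e N z)%:E).
  apply/measurable_EFinP; apply: measurable_sum => i; apply: measurable_funM => //.
  by apply/measurable_EFinP; exact: mi.
have S0 e N z : 0 <= e -> 0 <= S e N z.
  by move=> e0; apply: sumr_ge0 => i _; rewrite mulr_ge0// /ind.
(* Truncated at height c, the power exceeds a finite staircase by at most the mesh e, at a cost e M
   in the integral. Monotone convergence then removes the truncation. *)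
have cap c : 0 <= c -> (\int[nu]_(z in `[0%R, +oo[) (Num.min (z ^+ k.+1) c)%:E <= (Lam 'X^(k.+1))%:E)%E.
  move=> c0; have m0 z : 0 <= z -> 0 <= Num.min (z ^+ k.+1) c.
    by move=> z0; rewrite le_min c0 exprn_ge0.
  have mm : measurable_fun (`[0, +oo[%classic : set (measurableTypeR R)) (fun z : R => (Num.min (z ^+ k.+1) c)%:E).
    by apply/measurable_EFinP; apply: measurable_minr => //; exact/measurable_EFinP.
  have H e : 0 < e -> (\int[nu]_(z in `[0%R, +oo[) (Num.min (z ^+ k.+1) c)%:E <= (Lam 'X^(k.+1) + e * M)%:E)%E.
    move=> e0; pose N := (Num.truncn (c / e)).+1.
    have cN : c < N%:R * e by rewrite -ltr_pdivrMr// truncnS_gt.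
    apply: (@le_trans _ _ (\int[nu]_(z in `[0%R, +oo[) ((S e N z)%:E + e%:E))%E).
      apply: ge0_le_integral => //.
      - by move=> z; rewrite /= in_itv/= andbT lee_fin; exact: m0.
      - exact: emeasurable_funD.
      - move=> z; rewrite /= in_itv/= andbT => z0; rewrite -EFinD lee_fin SE//.
        have := @staircaseP e (z ^+ k.+1) N e0 ltac:(exact: exprn_ge0).
        rewrite /=; case: ltP => [h ->|h /andP[_ h']]; rewrite ge_min ?h'//.
        by rewrite (ltW (lt_le_trans cN _)) ?orbT// lerDl ltW.
    rewrite ge0_integralD//; last 2 first.
      by move=> z _; rewrite lee_fin S0// ltW.
      by move=> z _; rewrite lee_fin ltW.
    by rewrite (iS _ _ (ltW e0)) integral_cst// [in X in (_ + X)%E]nuy -EFinM -EFinD lee_fin lerD2r up.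
  apply/lee_addgt0Pr => e e0.
  have [M00|MN0] := eqVneq M 0.
    by rewrite (le_trans (H 1 ltr01))// M00 mulr0 addr0 leeDl// lee_fin ltW.
  have Mp : 0 < M by rewrite lt_neqAle eq_sym MN0.
  by have := H (e / M) ltac:(exact: divr_gt0); rewrite divfK.
have le1 : (\int[nu]_(z in `[0%R, +oo[) (z ^+ k.+1)%:E <= (Lam 'X^(k.+1))%:E)%E.
  pose g n (z : R) := (Num.min (z ^+ k.+1) n%:R)%:E.
  have gE (z : R) : limn (g^~ z) = (z ^+ k.+1)%:E.
    apply: lim_near_cst => //; near=> n; congr (_%:E); apply/min_idPl.
    by near: n; exact: nbhs_infty_ger.
  have : (\int[nu]_(z in `[0%R, +oo[) g n z)%E @[n --> \oo] --> (\int[nu]_(z in `[0%R, +oo[) (z ^+ k.+1)%:E)%E.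
    under eq_integral do rewrite -gE.
    apply: cvg_monotone_convergence => //.
    - move=> n; apply/measurable_EFinP; apply: measurable_minr => //; exact/measurable_EFinP.
    - by move=> n z; rewrite /= in_itv/= andbT => z0; rewrite lee_fin le_min exprn_ge0/=.
    - by move=> z _ n m nm; rewrite lee_fin le_min !ge_min lexx/= ler_nat nm orbT.
  move=> /cvg_lim <-//; apply: lime_le.
    apply: ereal_nondecreasing_is_cvgn => n m nm; apply: ge0_le_integral => //.
    - by move=> z; rewrite /= in_itv/= andbT => z0; rewrite lee_fin le_min exprn_ge0/=.
    - by apply/measurable_EFinP; apply: measurable_minr => //; exact/measurable_EFinP.
    - by apply/measurable_EFinP; apply: measurable_minr => //; exact/measurable_EFinP.
    - by move=> z _; rewrite lee_fin le_min !ge_min lexx/= ler_nat nm orbT.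
  by apply: nearW => n; exact: cap.
apply/eqP; rewrite eq_le le1/=.
have Ifin : (\int[nu]_(z in `[0%R, +oo[) (z ^+ k.+1)%:E)%E \is a fin_num.
  rewrite ge0_fin_numE; first exact: le_lt_trans le1 (ltry _).
  by apply: integral_ge0 => z; rewrite /= in_itv/= andbT lee_fin => z0; exact: exprn_ge0.
set J := (\int[nu]_(z in _) _)%E in Ifin *; rewrite -(fineK Ifin) lee_fin.
pose B := Lam 'X^(k.+1 + k.+1).
have B0 : 0 <= B.
  by apply: Lam_ge0 => z z0; rewrite hornerXn exprn_ge0.
have H n : (0 < n)%N -> Lam 'X^(k.+1) <= fine J + (2 * M + B) / n%:R.
  move=> n0; have n0' : 0 < n%:R :> R by rewrite ltr0n.
  pose e : R := n%:R^-1; have e0 : 0 < e by rewrite invr_gt0.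
  (* Mesh 1 / n up to height n. Beyond this height z^(k+1) <= z^(2k+2) / n, which is where the
     moment [B] enters. *)
  pose N := (n * n)%N.
  have Ne : N%:R * e = n%:R by rewrite /N natrM /e mulfK// gt_eqF.
  have h1 : Lam 'X^(k.+1) <= Lx (S e N) + (e * M + e * B).
    have -> : Lx (S e N) + (e * M + e * B) = Lx (fun z => S e N z + (e *: 1 + e *: 'X^(k.+1 + k.+1)).[z]).
      by rewrite Ladd ?Lpoly ?Lam_add ?Lam_scale//; exact: poly_bounded_horner.
    rewrite -Lpoly; apply: Lle; first exact: poly_bounded_horner.
      by apply: poly_boundedD => //; exact: poly_bounded_horner.
    move=> z z0; rewrite hornerD !hornerZ !hornerXn hornerC mulr1 SE// exprD.
    have := @staircaseP e (z ^+ k.+1) N e0 ltac:(exact: exprn_ge0).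
    rewrite /= Ne; case: ltP => [h ->|h /andP[_ h']].
      have : z ^+ k.+1 <= e * (z ^+ k.+1 * z ^+ k.+1).
        rewrite mulrA ler_peMl ?exprn_ge0// /e mulrC ler_pdivlMr// mul1r ltW//.
      by lra.
    have := mulr_ge0 (ltW e0) (mulr_ge0 (exprn_ge0 k.+1 z0) (exprn_ge0 k.+1 z0)); lra.
  (* The inequality Q y <= - F x holds for x < y only, so the terms are compared one level apart;
     the unmatched first term costs e M. *)
  have h2 : Lx (S e N) <= e * M + \sum_(i < N) e * - F (x e i).
    rewrite (LS _ _ (ltW e0)); have -> : N = N.-1.+1 by rewrite prednK// muln_gt0 n0.
    rewrite big_ord_recl/= lerD//; first by rewrite ler_pM2l.
    rewrite big_ord_recr/= -[leLHS]addr0 lerD//; last first.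
      apply: (mulr_ge0 (ltW e0)); have [_] := HF (x e N.-1) (x e N.-1 + 1) ltac:(rewrite ltrDl//).
      exact: (le_trans (Q0 _)).
    apply: ler_sum => i _; rewrite ler_pM2l//.
    have [] := HF (x e i) (x e (bump 0 i)) => //.
    have [y0 yE] := xk e (bump 0 i) e0.
    by rewrite xlt// yE /bump add1n ltr_pM2r// ltr_nat.
  have h3 : \sum_(i < N) e * - F (x e i) <= fine J.
    rewrite -lee_fin fineK// -(iS _ _ (ltW e0)); apply: ge0_le_integral => //.
    - by move=> z _; rewrite lee_fin S0// ltW.
    - by move=> z; rewrite /= in_itv/= andbT => z0; rewrite lee_fin S_le.
  have -> : (2 * M + B) / n%:R = e * M + (e * M + e * B) by rewrite /e; ring.
  lra.
apply/ler_addgt0Pr => e e0.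
pose n := (Num.truncn ((2 * M + B) / e)).+1.
apply: (le_trans (H n _)) => //; rewrite lerD2l ler_pdivrMr ?ltr0n// (mulrC e) -ler_pdivrMr//.
by apply: ltW; exact: truncnS_gt.
Unshelve. all: by end_near. Qed.

End positive_extension.

(** * Approximation of C^2 functions together with their derivatives *)

Section weierstrass.
Context {R : realType}.
Implicit Types (f g : R -> R) (u e : R) (p q : {poly R}).

Lemma uniform_continuity_itv f a b : continuous f -> forall e, 0 < e ->
  exists2 d, 0 < d & forall x y, a <= x <= b -> `|x - y| < d -> `|f x - f y| <= e.
Proof.
move=> fc e e0.
have /compact_near_coveringP K := @segment_compact R a b.
have := K _ (0^'+ : set_system R) (fun d x => forall y, `|x - y| < d -> `|f x - f y| <= e) _ _.
move=> H; have : \forall d \near 0^'+, `[a, b] `<=` (fun x => forall y, `|x - y| < d -> `|f x - f y| <= e).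
  apply: H => x _.
  have /cvgrPdist_lt/(_ (e / 2) ltac:(lra)) [d /= d0 Hd] := fc x.
  exists (ball x (d / 2), [set t | t < d / 2]) => /=.
    split; first by apply: nbhsx_ballx; lra.
    by apply: nbhs_right_lt; lra.
  move=> [x' d'] /= [] xx' d'd y x'y; rewrite /ball/= in xx'.
  have h1 := Hd x' ltac:(rewrite /ball_/=; lra).
  have xy : `|x - y| < d by move: xx' x'y d'd; rewrite !ltr_norml; lra.
  have h2 := Hd y xy.
  by move: h1 h2; rewrite !ltr_norml ler_norml; lra.
move=> {}H.
have [d [d0 Hd]] : exists d, 0 < d /\ (`[a, b] `<=` (fun x => forall y, `|x - y| < d -> `|f x - f y| <= e)).
  by near (0:R)^'+ => d; exists d; split; [by []|near: d; exact: H].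
by exists d => // x y xab xy; apply: Hd xy; rewrite /= in_itv.
Unshelve. all: by end_near. Qed.

(** Bernstein polynomials in de Casteljau's recursive form: the value at u is the mean of f at the
    number of successes in n trials of probability u. *)
Fixpoint bernstein (n : nat) (f : nat -> R) : {poly R} :=
  if n is m.+1 then (1 - 'X) * bernstein m f + 'X * bernstein m (fun k => f k.+1)
  else (f 0%N)%:P.

Lemma bernsteinS n (f : nat -> R) u : (bernstein n.+1 f).[u] =
  (1 - u) * (bernstein n f).[u] + u * (bernstein n (fun k => f k.+1)).[u].
Proof. by rewrite /= !hornerE. Qed.

Lemma bernstein_lin n c d (f g : nat -> R) u :
  (bernstein n (fun k => c * f k + d * g k)).[u] =
  c * (bernstein n f).[u] + d * (bernstein n g).[u].
Proof.
elim: n f g => [|n IH] f g; first by rewrite /= !hornerC.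
by rewrite !bernsteinS !IH; ring.
Qed.

Lemma bernstein_le n (f g : nat -> R) u : 0 <= u <= 1 ->
  (forall k, (k <= n)%N -> f k <= g k) -> (bernstein n f).[u] <= (bernstein n g).[u].
Proof.
move=> /andP[u0 u1]; elim: n f g => [|n IH] f g fg; first by rewrite /= !hornerC fg.
have u10 : 0 <= 1 - u by lra.
by rewrite !bernsteinS lerD// ler_wpM2l// IH// => k kn; apply: fg; rewrite // ltnW// ltnS.
Qed.

Lemma bernstein_cst n c u : (bernstein n (fun=> c)).[u] = c.
Proof. by elim: n => [|n IH]; [rewrite /= hornerC|rewrite bernsteinS IH; ring]. Qed.

Lemma bernstein_id n u : (bernstein n (fun k => k%:R)).[u] = n%:R * u.
Proof.
elim: n => [|n IH]; first by rewrite /= hornerC mul0r.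
rewrite bernsteinS (_ : (fun k => k.+1%:R) = (fun k => 1 * k%:R + 1 * (fun=> 1) k : R)).
  by rewrite bernstein_lin IH bernstein_cst -natr1; ring.
by apply/funext => k; rewrite -natr1 !mul1r.
Qed.

Lemma bernstein_sq n u : (bernstein n (fun k => k%:R ^+ 2)).[u] =
  n%:R * u * (1 - u) + (n%:R * u) ^+ 2.
Proof.
elim: n => [|n IH]; first by rewrite /= hornerC expr0n/= !mul0r; ring.
rewrite bernsteinS (_ : (fun k => k.+1%:R ^+ 2) =
  (fun k => 1 * (fun k => k%:R ^+ 2) k + 1 * (fun k => 2 * k%:R + 1 * (fun=> 1) k) k : R)).
  by rewrite 2!bernstein_lin IH bernstein_id bernstein_cst -natr1; ring.
by apply/funext => k; rewrite -natr1; ring.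
Qed.

Lemma bernstein_var n u : (bernstein n (fun k => (k%:R - n%:R * u) ^+ 2)).[u] =
  n%:R * u * (1 - u).
Proof.
rewrite (_ : (fun k => _) = (fun k => 1 * (fun k => k%:R ^+ 2) k +
  1 * (fun k => (- 2 * (n%:R * u)) * k%:R + 1 * (fun=> (n%:R * u) ^+ 2) k) k : R)).
  by rewrite 2!bernstein_lin bernstein_sq bernstein_id bernstein_cst; ring.
by apply/funext => k; ring.
Qed.

(** Bernstein's argument: uniform continuity when k / n is within d of u, and Chebyshev's inequality
    with the binomial variance n u (1 - u) otherwise. *)
Lemma weierstrass f e : continuous f -> 0 < e ->
  exists p : {poly R}, forall u, 0 <= u <= 1 -> `|p.[u] - f u| <= e.
Proof.
move=> fc e0.
have [d d0 Hd] := @uniform_continuity_itv f 0 1 fc (e / 2) ltac:(lra).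
have [M M0 HM] := continuous_bounded 1 fc.
(* With this n the variance term 2 M n u (1 - u) / (n d)^2 is at most e / 2. *)
pose n := (Num.truncn (4 * M / (e * d ^+ 2))).+1.
have n0 : 0 < n%:R :> R by rewrite ltr0n.
have nM : 4 * M <= n%:R * (e * d ^+ 2).
  by rewrite -ler_pdivrMr ?mulr_gt0 ?exprn_gt0//; apply: ltW; exact: truncnS_gt.
exists (bernstein n (fun k => f (k%:R / n%:R))) => u u01.
have u01' := u01; move: u01' => /andP[u0 u1].
have key k : (k <= n)%N -> `|f (k%:R / n%:R) - f u| <=
    e / 2 + 2 * M / (n%:R * d) ^+ 2 * (k%:R - n%:R * u) ^+ 2.
  move=> kn; have kn01 : 0 <= (k%:R / n%:R : R) <= 1.
    by rewrite divr_ge0//= ler_pdivrMr// mul1r ler_nat.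
  have c0 : 0 <= 2 * M / (n%:R * d) ^+ 2 by rewrite divr_ge0 ?sqr_ge0// mulr_ge0.
  have c1 : 0 <= 2 * M / (n%:R * d) ^+ 2 * (k%:R - n%:R * u) ^+ 2 by rewrite mulr_ge0// sqr_ge0.
  have [h|h] := ltP `|k%:R / n%:R - u| d.
    have := Hd _ u kn01 h; lra.
  apply: (@le_trans _ _ (2 * M)).
    apply: (le_trans (ler_normB _ _)); have := HM _ kn01; have := HM _ u01; lra.
  have : (n%:R * d) ^+ 2 <= (k%:R - n%:R * u) ^+ 2.
    rewrite -[leRHS]real_normK ?num_real// ler_pXn2r ?nnegrE ?mulr_ge0 ?(ltW d0)//.
    rewrite (_ : k%:R - n%:R * u = n%:R * (k%:R / n%:R - u)); last by field; rewrite gt_eqF.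
    by rewrite normrM ger0_norm// ler_pM2l.
  have nd0 : 0 < (n%:R * d) ^+ 2 by rewrite exprn_gt0// mulr_gt0.
  move=> h2; have := ler_wpM2l c0 h2; rewrite divfK ?gt_eqF//; lra.
pose E k := e / 2 * (fun=> 1) k + 2 * M / (n%:R * d) ^+ 2 * (fun k => (k%:R - n%:R * u) ^+ 2) k.
have EB : (bernstein n E).[u] <= e.
  rewrite /E bernstein_lin bernstein_cst bernstein_var mulr1.
  have : 2 * M / (n%:R * d) ^+ 2 * (n%:R * u * (1 - u)) <= e / 2.
    rewrite mulrAC ler_pdivrMr ?exprn_gt0 ?mulr_gt0//.
    have -> : 2 * M * (n%:R * u * (1 - u)) = n%:R * (2 * M * (u * (1 - u))) by ring.
    have -> : e / 2 * (n%:R * d) ^+ 2 = n%:R * (n%:R * (e * d ^+ 2) / 2) by field.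
    rewrite ler_pM2l//; have uu : u * (1 - u) <= 1 by nra.
    have uu0 : 0 <= u * (1 - u) by nra.
    by have := ler_wpM2l M0 uu; lra.
  lra.
have A : (bernstein n (fun k => f (k%:R / n%:R))).[u] - f u =
    (bernstein n (fun k => 1 * f (k%:R / n%:R) + -1 * (fun=> f u) k)).[u].
  by rewrite bernstein_lin bernstein_cst; ring.
rewrite A ler_norml; apply/andP; split; last first.
  apply: le_trans EB; apply: bernstein_le => // k kn; have := key k kn.
  by rewrite ler_norml /E; lra.
rewrite -[leRHS]opprK lerN2; apply: le_trans EB.
have -> : - (bernstein n (fun k => 1 * f (k%:R / n%:R) + -1 * (fun=> f u) k)).[u] =
  (bernstein n (fun k => -1 * f (k%:R / n%:R) + 1 * (fun=> f u) k)).[u].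
  by rewrite !bernstein_lin; ring.
apply: bernstein_le => // k kn; have := key k kn.
by rewrite ler_norml /E; lra.
Qed.

(* The primitive of [p] vanishing at 0; the junk value at index 0 is harmless as 0^-1 = 0. *)
Definition intpoly p : {poly R} := \poly_(i < (size p).+1) (p`_i.-1 / i%:R).

Lemma deriv_intpoly p : (intpoly p)^`() = p.
Proof.
apply/polyP => i; rewrite coef_deriv coef_poly ltnS.
case: ltnP => [_|h]; last by rewrite mul0rn nth_default.
by rewrite -[LHS]mulr_natr divfK// pnatr_eq0.
Qed.

Lemma intpoly0 p : (intpoly p).[0] = 0.
Proof. by rewrite horner_coef0 coef_poly/= invr0 mulr0. Qed.

(** The second derivative is approximated and the approximation integrated twice from 0; over [0, 1]
    integration does not enlarge the error. *)
Lemma weierstrass_C2 g g1 g2 e : C2 g g1 g2 -> g 0 = 0 -> g1 0 = 0 -> 0 < e ->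
  exists p : {poly R}, forall u, 0 <= u <= 1 ->
    [/\ `|p.[u] - g u| <= e, `|p^`().[u] - g1 u| <= e & `|p^`()^`().[u] - g2 u| <= e].
Proof.
move=> [gd gd1 gc] g0 g10 e0; have [q Hq] := weierstrass gc e0.
have step (p : {poly R}) (k k1 : R -> R) : (forall x : R, is_derive x 1 k (k1 x)) -> k 0 = 0 ->
    (forall u, 0 <= u <= 1 -> `|p.[u] - k1 u| <= e) ->
    forall u, 0 <= u <= 1 -> `|(intpoly p).[u] - k u| <= e.
  move=> kd k0 Hp u /andP[u0 u1].
  have D (x : R) : is_derive x 1 (fun u => (intpoly p).[u] - k u) (p.[x] - k1 x).
    have := kd x; have := is_derive_poly (intpoly p) x; rewrite deriv_intpoly => ? ?.
    exact: is_deriveB.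
  have [c /andP[c0 cu]] := MVT_is_derive u0 (fun x _ => D x).
  rewrite intpoly0 k0 !subr0 => ->; rewrite normrM (ger0_norm u0).
  by rewrite (le_trans _ (Hp c _)) ?ler_piMr// c0 (le_trans cu).
exists (intpoly (intpoly q)) => u u01; rewrite !deriv_intpoly; split; last exact: Hq.
  by apply: (step _ _ _ gd g0) => // v v01; apply: (step _ _ _ gd1 g10).
exact: (step _ _ _ gd1 g10).
Qed.

End weierstrass.

(** * Calculus of second-order jets, and smooth cutoffs *)

Section C2_calculus.
Context {R : realType}.
Implicit Types (f g : R -> R) (x y z v : R).

Lemma C2_unique f f1 f2 g1 g2 : C2 f f1 f2 -> C2 f g1 g2 -> f1 = g1 /\ f2 = g2.
Proof.
have U (k k1 k2 : R -> R) : (forall x : R, is_derive x 1 k (k1 x)) ->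
    (forall x : R, is_derive x 1 k (k2 x)) -> k1 = k2.
  move=> H1 H2; apply/funext => x; have D1 := H1 x; have D2 := H2 x.
  by rewrite -(@derive_val _ _ _ _ _ _ _ D1) (@derive_val _ _ _ _ _ _ _ D2).
move=> [fd fd1 _] [gd gd1 _]; have E1 := U _ _ _ fd gd; split=> //.
by rewrite -E1 in gd1; exact: U fd1 gd1.
Qed.

Definition mul1 f f1 g g1 : R -> R := fun z => f1 z * g z + f z * g1 z.
Definition mul2 f f1 f2 g g1 g2 : R -> R :=
  fun z => f2 z * g z + 2 * (f1 z * g1 z) + f z * g2 z.

Lemma is_derive_mul f g (f' g' x : R) : is_derive x 1 f f' -> is_derive x 1 g g' ->
  is_derive x 1 (fun z => f z * g z) (f' * g x + f x * g').
Proof.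
by move=> fd gd; apply: is_derive_eq; rewrite /GRing.scale/=; ring.
Qed.

Lemma is_derive_comp f g (f' g' x : R) : is_derive (g x) 1 f f' -> is_derive x 1 g g' ->
  is_derive x 1 (fun z => f (g z)) (f' * g').
Proof. exact: is_derive1_comp. Qed.

Lemma C2_mul f f1 f2 g g1 g2 : C2 f f1 f2 -> C2 g g1 g2 ->
  C2 (fun z => f z * g z) (mul1 f f1 g g1) (mul2 f f1 f2 g g1 g2).
Proof.
move=> Cf Cg; have [fc f1c _] := C2_continuous Cf; have [gc g1c _] := C2_continuous Cg.
move: Cf Cg => [fd fd1 f2c] [gd gd1 g2c]; split => x.
- exact: is_derive_mul.
- rewrite (_ : mul2 _ _ _ _ _ _ x = (f2 x * g x + f1 x * g1 x) + (f1 x * g1 x + f x * g2 x)).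
    by apply: is_deriveD; exact: is_derive_mul.
  by rewrite /mul2; ring.
- by rewrite /mul2; apply: cvgD; [apply: cvgD|]; apply: cvgM;
    [exact: f2c|exact: gc|exact: cvg_cst|apply: cvgM; [exact: f1c|exact: g1c]|exact: fc|exact: g2c].
Qed.

Lemma C2_comp f f1 f2 g g1 g2 : C2 f f1 f2 -> C2 g g1 g2 ->
  C2 (fun z => f (g z)) (fun z => f1 (g z) * g1 z)
     (fun z => f2 (g z) * g1 z ^+ 2 + f1 (g z) * g2 z).
Proof.
move=> Cf Cg; have [fc f1c _] := C2_continuous Cf; have [gc g1c _] := C2_continuous Cg.
move: Cf Cg => [fd fd1 f2c] [gd gd1 g2c]; split => x.
- exact: is_derive_comp.
- rewrite (_ : _ + _ = f2 (g x) * g1 x * g1 x + f1 (g x) * g2 x); last by ring.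
  by apply: is_derive_mul => //; exact: is_derive_comp.
- apply: cvgD; apply: cvgM; last exact: g2c.
  + by apply: (@continuous_comp _ _ _ g f2); [exact: gc|exact: f2c].
  + by apply: cvgM; exact: g1c.
  + by apply: (@continuous_comp _ _ _ g f1); [exact: gc|exact: f1c].
Qed.

Lemma C2_affine c d : C2 (fun z => c * z + d) (fun=> c) (fun=> 0).
Proof.
split=> x; [|exact: is_derive_cst|exact: cvg_cst].
by apply: is_derive_eq; rewrite /GRing.scale/=; ring.
Qed.

(** One remainder bound settles the derivative of the squared positive part, on both sides of its
    kink. *)
Lemma is_derive_quadratic f x (l C : R) :
  (forall h, `|f (h + x) - f x - l * h| <= C * h ^+ 2) -> is_derive x 1 f l.
Proof.
move=> H; have C0 : 0 <= C by have := le_trans (normr_ge0 _) (H 1); rewrite expr1n mulr1.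
have lim : h^-1 *: ((f \o shift x) (h *: 1) - f x) @[h --> (0:R)^'] --> l.
  apply/cvgrPdist_le => e e0; near=> h.
  have h0 : h != 0 by near: h; exact: nbhs_dnbhs_neq.
  have he : `|h| < e / (C + 1).
    near: h; apply: dnbhs0_lt; rewrite divr_gt0//; lra.
  have := H h; rewrite /= scaler1 /GRing.scale/= => Hh.
  rewrite (_ : l - _ = - (h^-1 * (f (h + x) - f x - l * h))); last by field.
  rewrite normrN normrM normfV ler_pdivrMl ?normr_gt0// (le_trans Hh)//.
  rewrite -[h ^+ 2]real_normK ?num_real// expr2 mulrA mulrC ler_wpM2l//.
  have : C * `|h| <= C * (e / (C + 1)) by rewrite ler_wpM2l// ltW.
  have -> : C * (e / (C + 1)) = e - e / (C + 1) by field; lra.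
  have : 0 < e / (C + 1) by rewrite divr_gt0//; lra.
  lra.
apply: DeriveDef; last exact: cvg_lim lim.
by apply/cvg_ex; exists l.
Unshelve. all: by end_near. Qed.

(** The cube of the positive part, a convex function of class C^2 vanishing on a half-line; cutoffs
    and concave caps are built from it. *)
Definition pos3 v := v * Num.max v 0 ^+ 2.

Lemma is_derive_pos2 v : is_derive v 1 (fun v => Num.max v 0 ^+ 2) (2 * Num.max v 0).
Proof.
apply: (@is_derive_quadratic _ _ _ 1) => h.
have := ger0_norm (sqr_ge0 h).
by case: (leP v 0) => v0; case: (leP (h + v) 0) => hv0; rewrite mul1r ler_norml; nra.
Qed.

Lemma pos3_le0 v : v <= 0 -> pos3 v = 0.
Proof. by move=> v0; rewrite /pos3 max_r// expr0n mulr0. Qed.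

Lemma pos3_ge0 v : 0 <= v -> pos3 v = v ^+ 3.
Proof. by move=> v0; rewrite /pos3 max_l// -exprS. Qed.

Lemma C2_pos3 : C2 pos3 (fun v => 3 * Num.max v 0 ^+ 2) (fun v => 6 * Num.max v 0).
Proof.
have E (v : R) : v * Num.max v 0 = Num.max v 0 ^+ 2.
  by case: leP => v0; rewrite ?expr0n ?mulr0 ?expr2.
split; [move=> x|move=> x|].
- rewrite (_ : 3 * _ = 1 * Num.max x 0 ^+ 2 + x * (2 * Num.max x 0)).
    exact: (is_derive_mul (is_derive_id x 1) (is_derive_pos2 x)).
  by have := E x; lra.
- by have D := is_derive_pos2 x; apply: is_derive_eq; rewrite /GRing.scale/=; ring.
- have -> : (fun v : R => 6 * Num.max v 0) = (fun v => 3 * (v + `|v|)).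
    by apply/funext => v; case: (leP v 0) => v0; [rewrite ler0_norm//|rewrite gtr0_norm//]; lra.
  move=> x; apply: cvgM; [exact: cvg_cst|apply: cvgD; first exact: cvg_id].
  by apply: cvg_norm; exact: cvg_id.
Qed.

Definition jet_le (v v1 v2 S : R) := [/\ `|v| <= S, `|v1| <= S & `|v2| <= S].

(** The 4 is 1 + 2 + 1, from the Leibniz rule for the second derivative. *)
Lemma jet_le_mul f f1 f2 g g1 g2 z A B :
  jet_le (f z) (f1 z) (f2 z) A -> jet_le (g z) (g1 z) (g2 z) B ->
  jet_le (f z * g z) (mul1 f f1 g g1 z) (mul2 f f1 f2 g g1 g2 z) (4 * (A * B)).
Proof.
move=> [fA f1A f2A] [gB g1B g2B].
have P u v : `|u| <= A -> `|v| <= B -> `|u * v| <= A * B.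
  by move=> uA vB; rewrite normrM ler_pM.
have := P _ _ fA gB; have := P _ _ fA g1B; have := P _ _ fA g2B.
have := P _ _ f1A gB; have := P _ _ f1A g1B; have := P _ _ f2A gB.
rewrite /jet_le /mul1 /mul2 !ler_norml; move: (f z * _) (f z * _) (f z * _) => ? ? ?.
by split; lra.
Qed.

Lemma jet_le_trans v v1 v2 A B : jet_le v v1 v2 A -> A <= B -> jet_le v v1 v2 B.
Proof. by move=> [? ? ?] AB; split; apply: le_trans AB. Qed.

(** Uniformity on each [0, Z] is the right notion since [genG_bound] at z involves the jet over
    [0, z] only. *)
Definition jet_cvg (gn gn1 gn2 : nat -> R -> R) g g1 g2 := forall Z e, 0 < e ->
  \forall n \near \oo, forall z, 0 <= z <= Z ->
    jet_le (gn n z - g z) (gn1 n z - g1 z) (gn2 n z - g2 z) e.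

Lemma jet_cvg_mul f f1 f2 gn gn1 gn2 g g1 g2 : C2 f f1 f2 -> jet_cvg gn gn1 gn2 g g1 g2 ->
  jet_cvg (fun n z => f z * gn n z) (fun n => mul1 f f1 (gn n) (gn1 n))
    (fun n => mul2 f f1 f2 (gn n) (gn1 n) (gn2 n))
    (fun z => f z * g z) (mul1 f f1 g g1) (mul2 f f1 f2 g g1 g2).
Proof.
move=> fC gc Z e e0; have [M M0 HM] := C2_bounded Z fC.
have e'0 : 0 < e / (4 * (M + 1)) by rewrite divr_gt0//; lra.
near=> n => z zZ; have : jet_le (gn n z - g z) (gn1 n z - g1 z) (gn2 n z - g2 z) (e / (4 * (M + 1))).
  by move: z zZ; near: n; exact: gc.
move=> H; have FM : jet_le (f z) (f1 z) (f2 z) (M + 1).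
  by have [? ? ?] := HM z zZ; split; lra.
have := @jet_le_mul f f1 f2 (fun z => gn n z - g z) (fun z => gn1 n z - g1 z)
  (fun z => gn2 n z - g2 z) z _ _ FM H.
rewrite (_ : 4 * _ = e); last by field; lra.
rewrite /mul1 /mul2; congr jet_le; ring.
Unshelve. all: by end_near. Qed.

(** The inner [pos3] flattens the step at v = 0 and the outer one at v = 1, so that class C^2 comes
    from composition, without gluing. *)
Definition smooth_step v := pos3 (1 - pos3 v).

Lemma C2_smooth_step : exists s1 s2 : R -> R, exists M : R,
  [/\ C2 smooth_step s1 s2, forall v, v <= 0 -> [/\ smooth_step v = 1, s1 v = 0 & s2 v = 0],
      forall v, 1 <= v -> smooth_step v = 0 & forall v, jet_le (smooth_step v) (s1 v) (s2 v) M].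
Proof.
have C := C2_comp C2_pos3 (C2_lin (-1) 1 C2_pos3 (C2_cst (1 : R))).
set S := (X in C2 X) in C; have SE : S = smooth_step.
  by apply/funext => v; rewrite /S /smooth_step; congr pos3; ring.
rewrite SE in C; move: C; set s1 := (X in C2 _ X _); set s2 := (X in C2 _ _ X) => C.
have H0 v : v <= 0 -> [/\ smooth_step v = 1, s1 v = 0 & s2 v = 0].
  move=> v0; rewrite /smooth_step /s1 /s2 (pos3_le0 v0) subr0 pos3_ge0// expr1n.
  by rewrite (max_r v0); split; ring.
have H1 v : 1 <= v -> [/\ smooth_step v = 0, s1 v = 0 & s2 v = 0].
  move=> v1; have le0 : -1 * pos3 v + 1 * 1 <= 0.
    rewrite pos3_ge0; last lra.
    by have := exprn_ege1 3 v1; lra.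
  rewrite -SE /S /s1 /s2 pos3_le0// (max_r le0) !expr0n/= !(mulr0, addr0, mul0r).
  by [].
have [M M0 HM] := C2_bounded 1 C.
exists s1, s2, (M + 1); split => //; first by move=> v /H1[].
move=> v; have [v0|v0] := leP v 0.
  by have [-> -> ->] := H0 v v0; rewrite /jet_le normr0 normr1; split; lra.
have [v1|v1] := leP 1 v.
  by have [-> -> ->] := H1 v v1; rewrite /jet_le normr0; split; lra.
by have [|? ? ?] := HM v; [rewrite (ltW v0) (ltW v1)|split; lra].
Qed.

End C2_calculus.

(* Taylor polynomials bring [p.[z] * exp (- n * delta * z)] into [Cl]; Weierstrass approximation in the
   variable [exp (- delta * z)] then gives the eventually constant functions, and cutoffs the bounded ones. *)
Section density.
Context {R : realType}.
Variables (delta : R) (Cl : (R -> R) -> Prop).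
Hypothesis delta_gt0 : 0 < delta.
Hypothesis Cl_poly : forall p : {poly R}, Cl (horner p).
Hypothesis Cl_lin : forall (c d : R) f f1 f2 g g1 g2, C2 f f1 f2 -> C2 g g1 g2 ->
  Cl f -> Cl g -> Cl (fun z => c * f z + d * g z).
Hypothesis Cl_lim : forall gn gn1 gn2 g g1 g2 C,
  (forall n, C2 (gn n) (gn1 n) (gn2 n)) -> C2 g g1 g2 -> (forall n, Cl (gn n)) ->
  (forall n z, 0 <= z -> jet_le (gn n z) (gn1 n z) (gn2 n z) (C * expR (2 * delta * z))) ->
  jet_cvg gn gn1 gn2 g g1 g2 -> Cl g.
Implicit Types (f g : R -> R) (x y z v A B : R) (p q : {poly R}).

(** The reason for the rate 2 delta in [Cl_lim]: each factor of the product spends one delta. *)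
Lemma Cl_mul_lim f f1 f2 gn gn1 gn2 g g1 g2 A B :
  C2 f f1 f2 -> (forall n, C2 (gn n) (gn1 n) (gn2 n)) -> C2 g g1 g2 ->
  (forall n, Cl (fun z => f z * gn n z)) ->
  (forall z, 0 <= z -> jet_le (f z) (f1 z) (f2 z) (A * expR (delta * z))) ->
  (forall n z, 0 <= z -> jet_le (gn n z) (gn1 n z) (gn2 n z) (B * expR (delta * z))) ->
  jet_cvg gn gn1 gn2 g g1 g2 -> Cl (fun z => f z * g z).
Proof.
move=> fC gnC gC fgn fA gB gng.
apply: (Cl_lim (C := 4 * (A * B)) _ (C2_mul fC gC) fgn _ (jet_cvg_mul fC gng)).
  by move=> n; exact: C2_mul.
move=> n z z0; have := jet_le_mul (fA z z0) (gB n z z0).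
congr jet_le; rewrite (_ : 2 * delta * z = delta * z + delta * z) ?expRD; ring.
Qed.

Lemma Xn_le_expR n z : 0 <= z -> (delta * z) ^+ n / n`!%:R <= expR (delta * z).
Proof.
move=> z0; have dz : 0 <= delta * z by rewrite mulr_ge0// ltW.
case: n => [|n]; first by rewrite expr0 divr1 -[leLHS]expR0 ler_expR.
have := expR_ge1Dxn n dz; lra.
Qed.

Lemma poly_le_expR p : exists2 A, 0 <= A & forall z, 0 <= z -> `|p.[z]| <= A * expR (delta * z).
Proof.
exists (\sum_(i < size p) `|p`_i| * (i`!%:R / delta ^+ i)).
  by apply: sumr_ge0 => i _; rewrite mulr_ge0// divr_ge0// exprn_ge0// ltW.
move=> z z0; rewrite horner_coef mulr_suml (le_trans (ler_norm_sum _ _ _))//.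
apply: ler_sum => i _; rewrite normrM -mulrA ler_wpM2l//.
rewrite ger0_norm ?exprn_ge0//.
have di : 0 < delta ^+ i by exact: exprn_gt0.
have fi : 0 < i`!%:R :> R by rewrite ltr0n fact_gt0.
have := Xn_le_expR i z0; rewrite exprMn => H.
rewrite (_ : z ^+ i = i`!%:R / delta ^+ i * (delta ^+ i * z ^+ i / i`!%:R)).
  by rewrite ler_wpM2l// divr_ge0// ltW.
by field; rewrite !gt_eqF.
Qed.

Lemma poly_jet_le p : exists2 A, 0 <= A & forall z, 0 <= z ->
  jet_le p.[z] p^`().[z] p^`()^`().[z] (A * expR (delta * z)).
Proof.
have [A A0 HA] := poly_le_expR p; have [B B0 HB] := poly_le_expR p^`().
have [C C0 HC] := poly_le_expR p^`()^`().
exists (A + B + C); first by rewrite !addr_ge0.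
move=> z z0; have := HA z z0; have := HB z z0; have := HC z z0.
have e0 := expR_gt0 (delta * z).
have := mulr_ge0 A0 (ltW e0); have := mulr_ge0 B0 (ltW e0); have := mulr_ge0 C0 (ltW e0).
by rewrite /jet_le !mulrDl; split; lra.
Qed.

Definition expm (n : nat) z := expR (- (n%:R * delta * z)).

Lemma C2_expm n : C2 (expm n) (fun z => - (n%:R * delta) * expm n z)
  (fun z => (n%:R * delta) ^+ 2 * expm n z).
Proof.
have D (x : R) : is_derive x 1 (expm n) (- (n%:R * delta) * expm n x).
  rewrite mulrC; apply: (is_derive_comp (is_derive_expR _)).
  by apply: is_derive_eq; rewrite /GRing.scale/=; ring.
split; first exact: D.
- by move=> x; have Dx := D x; apply: is_derive_eq; rewrite /GRing.scale/=; ring.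
- by move=> x; apply: cvgM; [exact: cvg_cst|exact: is_derive_continuous (D x)].
Qed.

Lemma expm_gt0 n z : 0 < expm n z. Proof. exact: expR_gt0. Qed.

Lemma expm_le1 n z : 0 <= z -> expm n z <= 1.
Proof. by move=> z0; rewrite -expR0 ler_expR oppr_le0 !mulr_ge0// ltW. Qed.

Lemma expm_jet_le n z : 0 <= z -> jet_le (expm n z) (- (n%:R * delta) * expm n z)
  ((n%:R * delta) ^+ 2 * expm n z) ((1 + n%:R * delta) ^+ 2).
Proof.
move=> z0; have e0 := expm_gt0 n z; have e1 := expm_le1 n z0.
have nd : 0 <= n%:R * delta by rewrite mulr_ge0// ltW.
move: (n%:R * delta) (expm n z) nd e0 e1 => c e c0 e0 e1.
have ce : 0 <= c * e <= c by apply/andP; split; nra.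
have ce2 : 0 <= c ^+ 2 * e <= c ^+ 2 by have := sqr_ge0 c; move=> ?; apply/andP; split; nra.
rewrite /jet_le !ler_norml sqrrD expr1n; split; apply/andP; split; lra.
Qed.

(** The Taylor polynomials of exp (- delta z) at 0. *)
Definition tpoly m : {poly R} := \poly_(k < m) ((- delta) ^+ k / k`!%:R).

Lemma deriv_tpoly m : (tpoly m.+1)^`() = - delta *: tpoly m.
Proof.
apply/polyP => i; rewrite coef_deriv coefZ !coef_poly ltnS.
case: ltnP => _; last by rewrite mul0rn mulr0.
rewrite -[LHS]mulr_natr factS natrM exprS; field.
by rewrite pnatr_eq0 -lt0n fact_gt0 nat1r pnatr_eq0.
Qed.

Lemma tpoly_error m z : 0 <= z -> `|(tpoly m).[z] - expm 1 z| <= (delta * z) ^+ m / m`!%:R.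
Proof.
elim: m z => [|m IH] z z0.
  rewrite /tpoly poly_def big_ord0 hornerC sub0r normrN expr0 divr1 (gtr0_norm (expm_gt0 1 z)).
  exact: expm_le1.
pose q : {poly R} := (delta ^+ m.+1 / m.+1`!%:R) *: 'X^(m.+1).
have qE u : q.[u] = (delta * u) ^+ m.+1 / m.+1`!%:R.
  by rewrite !hornerE exprMn; ring.
have q'E u : q^`().[u] = delta * ((delta * u) ^+ m / m`!%:R).
  rewrite derivZ derivXn !hornerE hornerMn hornerXn -[_ *+ _]mulr_natr factS natrM exprS exprMn /=.
  by field; rewrite pnatr_eq0 -lt0n fact_gt0 nat1r pnatr_eq0.
(* A sign [s] treats both inequalities at once. The derivative of the error is - delta times the
   previous error, so [q] minus s times the error has nonnegative derivative by induction, and it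
   vanishes at 0. *)
clearbody q; have key (s : R) : `|s| = 1 -> s * ((tpoly m.+1).[z] - expm 1 z) <= (delta * z) ^+ m.+1 / m.+1`!%:R.
  move=> s1; rewrite -qE.
  have D (u : R) : is_derive u 1 (fun u => q.[u] - s * ((tpoly m.+1).[u] - expm 1 u))
      (q^`().[u] - s * ((tpoly m.+1)^`().[u] - - (1%:R * delta) * expm 1 u)).
    have [Ed _ _] := C2_expm 1; have D1 := Ed u.
    by apply: is_derive_eq; rewrite /GRing.scale/=; ring.
  have [c /andP[c0 cz]] := MVT_is_derive z0 (fun u _ => D u).
  rewrite q'E (qE 0) mulr0 expr0n/= mul0r [expm 1 0]/expm mulr0 oppr0 expR0.
  have -> : (tpoly m.+1).[0] = 1 by rewrite horner_coef0 coef_poly/= expr0 divr1.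
  rewrite subrr mulr0 subr0 subr0 deriv_tpoly hornerZ => E.
  rewrite -subr_ge0 E mulr_ge0 ?addr0//.
  have := IH c c0; have -> : delta * ((delta * c) ^+ m / m`!%:R) - s * (- delta * (tpoly m).[c] -
     - (1%:R * delta) * expm 1 c) =
     delta * ((delta * c) ^+ m / m`!%:R + s * ((tpoly m).[c] - expm 1 c)) by ring.
  move=> H; apply: mulr_ge0; first exact: ltW.
  have : `|s * ((tpoly m).[c] - expm 1 c)| <= (delta * c) ^+ m / m`!%:R.
    by rewrite normrM s1 mul1r.
  by rewrite ler_norml; lra.
have := key 1 (normr1 _); have := key (-1) (normrN1 _).
by rewrite ler_norml; lra.
Qed.

(** The shift by two leaves a genuine Taylor polynomial after two derivatives. *)
Definition dt m := tpoly m.+2.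

Lemma dt_jets m z : [/\ (dt m)^`().[z] = - delta * (tpoly m.+1).[z] &
  (dt m)^`()^`().[z] = delta ^+ 2 * (tpoly m).[z]].
Proof. by rewrite /dt deriv_tpoly derivZ deriv_tpoly !hornerZ; split; ring. Qed.

Lemma dt_le m z : 0 <= z -> jet_le (dt m).[z] (dt m)^`().[z] (dt m)^`()^`().[z]
  (2 * (1 + delta) ^+ 2 * expR (delta * z)).
Proof.
have B k : 0 <= z -> `|(tpoly k).[z]| <= 2 * expR (delta * z).
  move=> z0; have := tpoly_error k z0; have := Xn_le_expR k z0.
  have := expm_le1 1 z0; have := expm_gt0 1 z.
  have : 1 <= expR (delta * z) by rewrite -expR0 ler_expR mulr_ge0// ltW.
  by rewrite !ler_norml; lra.
move=> z0; have [-> ->] := dt_jets m z.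
have := B m.+2 z0; have := B m.+1 z0; have := B m z0.
have e0 := expR_gt0 (delta * z); rewrite /jet_le !normrM normrN !(gtr0_norm delta_gt0) -expr2 => h0 h1 h2.
have d0 := delta_gt0; have h1' := ler_wpM2l (ltW d0) h1.
have h0' := ler_wpM2l (sqr_ge0 delta) h0.
have p1 := mulr_gt0 d0 e0; have p2 := mulr_gt0 (exprn_gt0 2 d0) e0.
by rewrite sqrrD expr1n mul1r /dt; split; lra.
Qed.

Lemma dt_cvg : jet_cvg (fun m z => (dt m).[z]) (fun m z => (dt m)^`().[z])
  (fun m z => (dt m)^`()^`().[z]) (expm 1) (fun z => - (1%:R * delta) * expm 1 z)
  (fun z => (1%:R * delta) ^+ 2 * expm 1 z).
Proof.
move=> Z e e0; have d0 := delta_gt0.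
pose eta := e / (1 + delta) ^+ 2.
have eta0 : 0 < eta by rewrite divr_gt0// exprn_gt0//; lra.
have small : \forall m \near \oo, (delta * Z) ^+ m / m`!%:R <= eta.
  have /cvgrPdist_le/(_ _ eta0) := cvg_exp_coeff (delta * Z).
  apply: filterS => m; rewrite sub0r normrN; apply: le_trans; exact: ler_norm.
have small1 : \forall m \near \oo, (delta * Z) ^+ m.+1 / m.+1`!%:R <= eta.
  by have [N _ HN] := small; exists N => // m /= Nm; apply: HN; exact: leqW.
have small2 : \forall m \near \oo, (delta * Z) ^+ m.+2 / m.+2`!%:R <= eta.
  by have [N _ HN] := small; exists N => // m /= Nm; apply: HN; exact/leqW/leqW.
near=> m => z /andP[z0 zZ]; have [-> ->] := dt_jets m z.
have B k : (delta * Z) ^+ k / k`!%:R <= eta -> `|(tpoly k).[z] - expm 1 z| <= eta.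
  apply: le_trans; apply: (le_trans (tpoly_error k z0)).
  rewrite ler_wpM2r// lerXn2r ?nnegrE ?mulr_ge0 ?ler_wpM2l ?(ltW d0)//.
  exact: le_trans zZ.
have h0 : `|(tpoly m).[z] - expm 1 z| <= eta by apply: B; near: m.
have h1 : `|(tpoly m.+1).[z] - expm 1 z| <= eta by apply: B; near: m.
have h2 : `|(tpoly m.+2).[z] - expm 1 z| <= eta by apply: B; near: m.
have h1' := ler_wpM2l (ltW d0) h1; have h0' := ler_wpM2l (sqr_ge0 delta) h0.
have E : e = eta + 2 * (delta * eta) + delta ^+ 2 * eta by rewrite /eta; field; lra.
have p1 := mulr_gt0 d0 eta0; have p2 := mulr_gt0 (exprn_gt0 2 d0) eta0.
rewrite /jet_le (_ : - delta * _ - _ = - (delta * ((tpoly m.+1).[z] - expm 1 z))); last by ring.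
rewrite (_ : delta ^+ 2 * _ - _ = delta ^+ 2 * ((tpoly m).[z] - expm 1 z)); last by ring.
rewrite normrN !normrM !(gtr0_norm delta_gt0) -expr2 E /dt.
by split; lra.
Unshelve. all: by end_near. Qed.

(** One factor exp (- delta z) is introduced at a time: the Taylor polynomials of exp (- n delta z)
    itself would only be bounded by exp (n delta z), beyond the growth allowed in [Cl_lim]. *)
Lemma Cl_poly_expm n p : Cl (fun z => p.[z] * expm n z).
Proof.
elim: n p => [|n IH] p.
  rewrite (_ : (fun _ => _) = horner p) //; apply/funext => z.
  by rewrite /expm !mul0r oppr0 expR0 mulr1.
rewrite (_ : (fun _ => _) = (fun z => (p.[z] * expm n z) * expm 1 z)); last first.
  apply/funext => z; rewrite -mulrA -expRD -natr1; congr (_ * expR _); ring.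
have [A A0 HA] := poly_jet_le p.
apply: (Cl_mul_lim (A := 4 * (A * (1 + n%:R * delta) ^+ 2)) (C2_mul (C2_poly p) (C2_expm n))
  (fun m => C2_poly (dt m)) (C2_expm 1) _ _ dt_le dt_cvg).
- move=> m; rewrite (_ : (fun _ => _) = (fun z => (p * dt m).[z] * expm n z)) //.
  by apply/funext => z; rewrite hornerM; ring.
- move=> z z0; have := @jet_le_mul R (horner p) _ _ (expm n) (fun z => - (n%:R * delta) * expm n z)
    (fun z => (n%:R * delta) ^+ 2 * expm n z) z _ _ (HA z z0) (expm_jet_le n z0).
  by congr jet_le; ring.
Qed.

Lemma Cl_horner_expm p : Cl (fun z => p.[expm 1 z]).
Proof.
(* The extra factor [expm n] absorbs the multiplication by the variable in the Horner induction. *)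
suff H n : Cl (fun z => p.[expm 1 z] * expm n z).
  have := H 0%N; congr Cl; apply/funext => z; by rewrite [expm 0 z]/expm !mul0r oppr0 expR0 mulr1.
elim/poly_ind: p n => [|p c IH] n.
  have := Cl_poly_expm n 0; congr Cl; apply/funext => z; by rewrite !horner0.
rewrite (_ : (fun _ => _) = (fun z => 1 * (p.[expm 1 z] * expm n.+1 z) + c * (1%:P.[z] * expm n z))).
  apply: (@Cl_lin _ _ _ _ _ _ _ _ _ _ (IH n.+1) (Cl_poly_expm n 1%:P)).
  - exact: (C2_mul (C2_comp (C2_poly p) (C2_expm 1)) (C2_expm n.+1)).
  - exact: (C2_mul (C2_poly _) (C2_expm n)).
apply/funext => z; rewrite hornerMXaddC hornerC; have -> : expm n.+1 z = expm 1 z * expm n z.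
  by rewrite /expm -expRD -natr1; congr expR; ring.
by ring.
Qed.

(** In the variable u = exp (- delta z) infinity becomes the point 0, and eventual constancy makes
    the function constant near it, hence of class C^2 across it. Approximating its jet on [0, 1] is
    then approximating on the whole half-line. *)
Lemma Cl_eventually_cst f f1 f2 Z : C2 f f1 f2 -> (forall z, Z <= z -> f z = f Z) -> Cl f.
Proof.
move=> fC fZ; have d0 := delta_gt0.
pose g z := f z - f Z.
have [gC gZ] : C2 g f1 f2 /\ forall z, Z <= z -> g z = 0.
  split; last by move=> z Zz; rewrite /g fZ// subrr.
  have := C2_lin 1 (- f Z) fC (C2_cst 1).
  by congr C2; apply/funext => z; rewrite /g; ring.
suff gCl : Cl g.
  have := @Cl_lin 1 (f Z) _ _ _ _ _ _ gC (C2_poly 1%:P) gCl (Cl_poly 1%:P).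
  by congr Cl; apply/funext => z; rewrite /g hornerC; ring.
have der0 (k : R -> R) (l z : R) : (forall u, Z < u -> k u = 0) -> Z < z -> is_derive z 1 k l -> l = 0.
  move=> kZ Zz D; have D0 : is_derive z 1 k 0.
    apply: near_eq_is_derive (is_derive_cst (0 : R) z 1).
    by near=> u; rewrite kZ//; near: u; exact: lt_nbhsr.
  by rewrite -(@derive_val _ _ _ _ _ _ _ D) (@derive_val _ _ _ _ _ _ _ D0).
have gZ1 z : Z < z -> f1 z = 0.
  by move=> Zz; have [gd _ _] := gC; apply: der0 Zz (gd z) => u /ltW; exact: gZ.
have gZ2 z : Z < z -> f2 z = 0.
  by move=> Zz; have [_ gd _] := gC; exact: der0 Zz (gd z).
(* The inverse change of variable, followed by the jet of g in terms of u. The value 0 for u <= 0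
   agrees with g = 0 beyond Z. *)
pose lg (u : R) := - (delta^-1 * ln u).
pose G (u : R) := if 0 < u then g (lg u) else 0.
pose G1 (u : R) := if 0 < u then - (f1 (lg u) * (delta^-1 * u^-1)) else 0.
pose G2 (u : R) := if 0 < u then
  (f2 (lg u) * delta^-1 ^+ 2 + f1 (lg u) * delta^-1) * u^-1 ^+ 2 else 0.
have lgd (u : R) : 0 < u -> is_derive u 1 lg (- (delta^-1 * u^-1)).
  by move=> u0; have D := is_derive1_ln u0; apply: is_derive_eq; rewrite /GRing.scale/=; ring.
have lgZ (u : R) : 0 < u -> u < expm 1 Z -> Z < lg u.
  move=> u0 h; have : ln u < - (delta * Z).
    by rewrite -[ltRHS]expRK ltr_ln ?posrE ?expR_gt0//; move: h; rewrite /expm mul1r.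
  have -> : lg u = (- ln u) / delta by rewrite /lg; ring.
  by rewrite ltr_pdivlMr// => ?; lra.
have G0 (u : R) : u < expm 1 Z -> [/\ G u = 0, G1 u = 0 & G2 u = 0].
  move=> uZ; rewrite /G /G1 /G2; case: ltP => // u0; have := lgZ _ u0 uZ => h.
  by rewrite gZ ?gZ1 ?gZ2 ?ltW//; split; ring.
have GC : C2 G G1 G2.
  have inv_d (u : R) : 0 < u -> is_derive u 1 (fun u : R => u^-1) (- u ^- 2).
    move=> u0; have un0 : u != 0 by rewrite gt_eqF.
    by apply: (is_derive_eq (is_deriveV (f := id) un0 (is_derive_id u 1))); rewrite /GRing.scale/= mulr1.
  have pos_near (u : R) (k k' : R -> R) : 0 < u ->
      \near u, k u = (fun u => if 0 < u then k u else k' u) u.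
    by move=> u0; near=> v; rewrite ifT//; near: v; exact: lt_nbhsr.
  have [gd gd1 gd2] := gC.
  have e0 := expm_gt0 1 Z.
  have near_lt (u : R) : u <= 0 -> \near u, u < expm 1 Z.
    by move=> u0; apply: lt_nbhsl; exact: le_lt_trans e0.
  split.
  - move=> u; have [u0|u0] := ltP 0 u.
      apply: near_eq_is_derive (pos_near _ _ _ u0) _.
      rewrite /G1 u0 -mulrN; exact: (is_derive_comp (gd _) (lgd _ u0)).
    have [_ -> _] := G0 u (le_lt_trans u0 e0).
    apply: near_eq_is_derive (is_derive_cst 0 _ _).
    by apply: filterS (near_lt u u0) => v /G0[].
  - move=> u; have [u0|u0] := ltP 0 u.
      apply: near_eq_is_derive (pos_near _ _ _ u0) _.
      have D := is_derive_mul (is_derive_comp (gd1 _) (lgd _ u0))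
        (is_derive_mul (is_derive_cst delta^-1 u 1) (inv_d _ u0)).
      apply: is_derive_eq; rewrite /G2 u0 /GRing.scale/=.
      by field; rewrite !gt_eqF.
    have [_ _ ->] := G0 u (le_lt_trans u0 e0).
    apply: near_eq_is_derive (is_derive_cst 0 _ _).
    by apply: filterS (near_lt u u0) => v /G0[].
  - have f1c : continuous f1 by have [] := C2_continuous gC.
    move=> u; rewrite /continuous_at; have [u0|u0] := ltP 0 u; last first.
      have [_ _ E] := G0 u (le_lt_trans u0 e0); rewrite E.
      by apply: cvg_near_cst; apply: filterS (near_lt u u0) => v /G0[].
    apply: (cvg_trans (near_eq_cvg (pos_near u _ _ u0))).
    rewrite /G2 u0; have lc := is_derive_continuous (lgd _ u0).
    apply: cvgM; last by have := is_derive_continuous (inv_d _ u0) => ?; apply: cvgM.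
    apply: cvgD; (apply: cvgM; last exact: cvg_cst).
      by apply: (@continuous_comp _ _ _ lg f2); [exact: lc|exact: gd2].
    by apply: (@continuous_comp _ _ _ lg f1); [exact: lc|exact: f1c].
have GE z : G (expm 1 z) = g z.
  by rewrite /G expm_gt0 /lg /expm expRK mul1r mulrN opprK mulrA mulVf ?gt_eqF// mul1r.
have e0 := expm_gt0 1 Z; have [G00 G10 _] := G0 0 e0.
have eps0 n : 0 < (n.+1%:R)^-1 :> R by rewrite invr_gt0.
have /choice[pn Hpn] : forall n : nat, exists p : {poly R}, forall u, 0 <= u <= 1 ->
    jet_le (p.[u] - G u) (p^`().[u] - G1 u) (p^`()^`().[u] - G2 u) (n.+1%:R)^-1.
  by move=> n; exact: (weierstrass_C2 GC G00 G10 (eps0 n)).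
have gC' := C2_comp GC (C2_expm 1).
set g1' := (X in C2 _ X _) in gC'; set g2' := (X in C2 _ _ X) in gC'.
rewrite (_ : (fun z => G (expm 1 z)) = g) in gC'; last by apply/funext.
have [E1 E2] := C2_unique gC gC'.
pose B : R := 2 * (1 + delta) ^+ 2.
have B0 : 0 <= B by apply: mulr_ge0 => //; exact: sqr_ge0.
have diff n z : 0 <= z -> jet_le ((pn n).[expm 1 z] - g z)
   ((pn n)^`().[expm 1 z] * (- (1%:R * delta) * expm 1 z) - f1 z)
   ((pn n)^`()^`().[expm 1 z] * (- (1%:R * delta) * expm 1 z) ^+ 2 +
    (pn n)^`().[expm 1 z] * ((1%:R * delta) ^+ 2 * expm 1 z) - f2 z) (B * (n.+1%:R)^-1).
  move=> z0; have u0 := expm_gt0 1 z; have u1 := expm_le1 1 z0.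
  have := Hpn n (expm 1 z) ltac:(by rewrite (ltW u0) u1).
  rewrite GE E1 E2 /g1' /g2'; move: (eps0 n); move: (n.+1%:R)^-1 => e en.
  move: (expm 1 z) u0 u1 => u u0 u1 [h0 h1 h2].
  rewrite !mul1r.
  rewrite (_ : _ * (- delta * u) - _ = - (delta * (u * ((pn n)^`().[u] - G1 u)))); last by ring.
  rewrite (_ : _ + _ - _ = delta ^+ 2 * (u * (u * ((pn n)^`()^`().[u] - G2 u)))
     + delta ^+ 2 * (u * ((pn n)^`().[u] - G1 u))); last by ring.
  have m (c : R) : `|c| <= e -> `|u * c| <= e.
    by move=> ce; rewrite normrM (gtr0_norm u0) (le_trans _ ce)// ler_piMl.
  have k1 := m _ h1; have k2 := m _ (m _ h2).
  have d1 := ler_wpM2l (ltW d0) k1.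
  have d21 := ler_wpM2l (sqr_ge0 delta) k1; have d22 := ler_wpM2l (sqr_ge0 delta) k2.
  have p1 := mulr_gt0 d0 en; have p2 := mulr_gt0 (exprn_gt0 2 d0) en.
  have BE : B * e = 2 * e + 4 * (delta * e) + 2 * (delta ^+ 2 * e) by rewrite /B; ring.
  rewrite /jet_le normrN normrM (gtr0_norm d0) BE; split; [lra|lra|].
  apply: (le_trans (ler_normD _ _)); rewrite !(normrM (delta ^+ 2)).
  rewrite (ger0_norm (sqr_ge0 delta)); lra.
clearbody B; have [M M0 HM] := C2_bounded Z gC.
have gM z : 0 <= z -> jet_le (g z) (f1 z) (f2 z) M.
  move=> z0; have [zZ|Zz] := leP z Z; first by apply: HM; rewrite z0.
  by rewrite gZ ?gZ1 ?gZ2 ?ltW// /jet_le normr0.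
apply: (Cl_lim (C := B + M) (fun n => C2_comp (C2_poly (pn n)) (C2_expm 1)) gC).
- by move=> n; exact: Cl_horner_expm.
- move=> n z z0.
  have Bn : B * (n.+1%:R)^-1 <= B.
    by rewrite ler_piMr// invf_le1// ler1n.
  have [a0 a1 a2] := diff n z z0; have [b0 b1 b2] := gM z z0.
  have E : B + M <= (B + M) * expR (2 * delta * z).
    rewrite ler_peMr ?addr_ge0// -expR0 ler_expR !mulr_ge0//; exact: ltW.
  apply: jet_le_trans E; move: a0 a1 a2 b0 b1 b2 Bn; rewrite /jet_le !ler_norml.
  move: (B / _) => q.
  by move=> *; split; lra.
- move=> Y e epos.
  have Be : 0 < e / (B + 1) by rewrite divr_gt0// ltr_wpDl.
  have := near_infty_natSinv_lt (PosNum Be); apply: filterS => n /= hn z /andP[z0 _].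
  apply: jet_le_trans (diff n z z0) _.
  have := ler_wpM2l B0 (ltW hn).
  have -> : B * (e / (B + 1)) = e - e / (B + 1) by field; lra.
  by move=> /le_trans; apply; rewrite gerBl ltW.
Unshelve. all: by end_near. Qed.

(* Multiply by the smooth cutoffs [smooth_step (z / n - 1)]. *)
Theorem Cl_bounded f f1 f2 S : C2 f f1 f2 ->
  (forall z, 0 <= z -> jet_le (f z) (f1 z) (f2 z) S) -> Cl f.
Proof.
move=> fC fS; have [s1 [s2 [M [sC s0 s1' sM]]]] := @C2_smooth_step R.
pose r n : R := (n.+1%:R)^-1.
have r0 n : 0 < r n by rewrite invr_gt0.
have r1 n : r n <= 1 by rewrite invf_le1// ler1n.
have gC n := C2_comp sC (C2_affine (r n) (-1)).
have M1 : 1 <= M by have [] := sM 0; have [-> _ _] := s0 0 (lexx _); rewrite normr1.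
have expS (c z : R) : 0 <= c -> 0 <= z -> c <= c * expR (delta * z).
  by move=> c0 z0; rewrite ler_peMr// -expR0 ler_expR mulr_ge0// ltW.
have S0 : 0 <= S by have [h _ _] := fS 0 (lexx _); exact: le_trans h.
rewrite (_ : f = (fun z => f z * (fun=> 1) z)); last by apply/funext => z; rewrite mulr1.
apply: (Cl_mul_lim (A := S) (B := M) fC gC (C2_cst 1)).
- move=> n; apply: (Cl_eventually_cst (Z := 2 * n.+1%:R) (C2_mul fC (gC n))).
  have E z : 2 * n.+1%:R <= z -> smooth_step (r n * z + -1) = 0.
    move=> h; apply: s1'; rewrite /r; have : 2 <= (n.+1%:R)^-1 * z by rewrite ler_pdivlMl// mulrC.
    by move: (_ * z) => q; lra.
  by move=> z h; rewrite !E// !mulr0.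
- by move=> z z0; apply: jet_le_trans (fS z z0) _; exact: expS.
- move=> n z z0; apply: jet_le_trans (expS M z ltac:(lra) z0).
  have [a0 a1 a2] := sM (r n * z + -1); have rn0 := r0 n; have rn1 := r1 n.
  split => //; first by rewrite normrM (gtr0_norm rn0) (le_trans _ a1)// ler_piMr.
  rewrite mulr0 addr0 normrM (le_trans _ a2)// ler_piMr// ger0_norm ?sqr_ge0// expr2.
  by rewrite mulr_ile1// ltW.
- move=> Z e e0; near=> n => z /andP[z0 zZ].
  have rz : r n * z + -1 <= 0.
    rewrite subr_le0 ler_pdivrMl// mulr1 (le_trans zZ)// -natr1 ltW// ltr_wpDr//.
    near: n; exact: nbhs_infty_gtr.
  have [-> -> ->] := s0 _ rz; rewrite /jet_le !(mul0r, subrr, addr0) normr0.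
  by split; exact: ltW.
Unshelve. all: by end_near. Qed.

End density.

(** * The measures nu_t *)

Section weighted_image.
Context {R : realType}.
Local Notation T := (measurableTypeR R).
Local Open Scope ereal_scope.
Import HBNNSimple.

(** The push-forward under [phi] of the measure with density [w] on [D]. It serves for tilting, for
    undoing the tilt and for the dilation z -> t z. *)
Lemma exists_weighted_image (m : borel_measure R) (D : set T) (w : T -> R) (phi : T -> T) :
  measurable D -> measurable_fun setT w -> (forall x, (0 <= w x)%R) ->
  measurable_fun setT phi ->
  exists M : borel_measure R, forall f : T -> \bar R, measurable_fun setT f ->
    (forall y, 0 <= f y) -> \int[M]_y f y = \int[m]_(x in D) ((w x)%:E * f (phi x)).
Proof.
move=> mD mw w0 mphi.
have mpre A : measurable A -> measurable (phi @^-1` A : set T).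
  by move=> mA; rewrite -[_ @^-1` _]setTI; exact: mphi.
pose M (A : set T) := \int[m]_(x in D `&` phi @^-1` A) (w x)%:E.
have mwE (E : set T) : measurable_fun E (EFin \o w).
  by apply/measurable_EFinP; exact: measurable_funTS.
have M0 : M set0 = 0 by rewrite /M preimage_set0 setI0 integral_set0.
have Mge0 A : 0 <= M A by apply: integral_ge0 => x _; rewrite lee_fin.
have Madd : semi_sigma_additive M.
  move=> F mF tF mUF; rewrite /M preimage_bigcup setI_bigcupr.
  rewrite (@ge0_integral_bigcup _ T R m (fun k => D `&` phi @^-1` F k) (EFin \o w)).
  - by apply: is_cvg_ereal_nneg_natsum => n _; exact: Mge0.
  - by move=> k; apply: measurableI => //; exact: mpre.
  - exact: mwE.
  - by move=> x _; rewrite /= lee_fin.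
  - by move=> i j _ _ [x [[_ Fi] [_ Fj]]]; apply: tF => //; exists (phi x).
pose MM : borel_measure R := HB.pack M (isMeasure.Build _ _ _ M M0 Mge0 Madd).
exists MM => f mf f0.
pose f_ := nnsfun_approx measurableT mf.
have fpos y n : 0 <= (f_ n y)%:E by rewrite lee_fin.
transitivity (limn (fun n => \int[MM]_y (f_ n y)%:E)).
  rewrite -monotone_convergence//.
  - apply: eq_integral => y _; apply/esym/cvg_lim => //.
    by apply: cvg_nnsfun_approx.
  - by move=> n; exact/measurable_EFinP/measurable_funP.
  - by move=> y _ m' n mn; rewrite lee_fin; exact/lefP/nd_nnsfun_approx.
transitivity (limn (fun n => \int[m]_(x in D) ((w x)%:E * (f_ n (phi x))%:E))).
  apply: congr_lim; apply/funext => n.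
  have mfn (r : R) : measurable (f_ n @^-1` [set r] : set T) by exact: measurable_funPTI.
  have mfnphi (r : R) : measurable (phi @^-1` (f_ n @^-1` [set r]) : set T) by exact: mpre.
  transitivity (\sum_(k \in range (f_ n)) (k%:E * M (f_ n @^-1` [set k]))).
    under eq_integral do rewrite fimfunE -fsumEFin//.
    rewrite ge0_integral_fsum//; last 2 first.
    - by move=> y; apply/measurable_EFinP/measurable_funM.
    - by move=> y x _; rewrite nnfun_muleindic_ge0.
    by apply: eq_fsbigr => r _; rewrite integralZl_indic_nnsfun// integral_indic// setIT.
  transitivity (\int[m]_(x in D) \sum_(k \in range (f_ n))
      ((w x)%:E * (k * \1_(f_ n @^-1` [set k]) (phi x))%:E)); last first.
    apply: eq_integral => x _; rewrite (fimfunE (f_ n)) -fsumEFin// ge0_mule_fsumr//.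
    by move=> k; rewrite EFinM; exact: nnfun_muleindic_ge0.
  have mind (r : R) : measurable_fun D (fun x => \1_(f_ n @^-1` [set r]) (phi x) : R).
    apply: measurable_funTS; apply: (measurableT_comp _ mphi).
    exact: measurable_indic.
  rewrite ge0_integral_fsum//; last 2 first.
  - move=> r; apply: emeasurable_funM; first exact: mwE.
    by apply/measurable_EFinP; apply: measurable_funM => //.
  - move=> r x _; rewrite mule_ge0 ?lee_fin// -lee_fin EFinM; exact: nnfun_muleindic_ge0.
  apply: eq_fsbigr => r _; have [r0|r0] := ltP r 0%R.
    rewrite preimage_nnfun0// M0 mule0 integral0_eq// => x _.
    by rewrite indicE in_set0 mulr0 mule0.
  rewrite /M integral_mkcondr -ge0_integralZl_EFin//; last 2 first.
  - by move=> x _; rewrite patchE; case: ifP => // _; rewrite lee_fin.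
  - by apply/(measurable_restrict _ _ _) => //; exact: mwE.
  apply: eq_integral => x _; rewrite patchE indicE.
  have -> : (x \in phi @^-1` (f_ n @^-1` [set r])) = (phi x \in f_ n @^-1` [set r]) by [].
  by case: ifP => _; rewrite ?mulr1 ?mulr0 ?mule0// muleC.
rewrite -monotone_convergence//.
- apply: eq_integral => x _; apply/cvg_lim => //.
  by apply: cvgeZl => //; apply: cvg_nnsfun_approx.
- move=> n; apply: emeasurable_funM; first exact: mwE.
  apply/measurable_EFinP; apply: measurable_funTS.
  by apply: measurableT_comp => //; exact: measurable_funP.
- by move=> n x _; rewrite mule_ge0// lee_fin.
- by move=> x _ m' n mn; rewrite lee_wpmul2l ?lee_fin//; exact/lefP/nd_nnsfun_approx.
Qed.

(** The extension to signed functions goes through positive and negative parts; the equation with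
    absolute values is the one that transfers integrability. *)
Lemma weighted_image_funcs (m M : borel_measure R) (D E : set T) (w : T -> R) (phi : T -> T) (f : T -> R) :
  (forall f : T -> \bar R, measurable_fun setT f ->
    (forall y, 0 <= f y) -> \int[M]_y f y = \int[m]_(x in D) ((w x)%:E * f (phi x))) ->
  (forall x, (0 <= w x)%R) -> measurable E -> (forall x, D x -> E (phi x)) ->
  measurable_fun E f ->
  \int[M]_(y in E) (f y)%:E = \int[m]_(x in D) (w x * f (phi x))%:E /\
  \int[M]_(y in E) `|(f y)%:E| = \int[m]_(x in D) `|(w x * f (phi x))%:E|.
Proof.
move=> HM w0 mE DE mf.
have tr (k : T -> \bar R) : measurable_fun E k -> (forall y, 0 <= k y) ->
    \int[M]_(y in E) k y = \int[m]_(x in D) ((w x)%:E * k (phi x)).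
  move=> mk k0; rewrite integral_mkcond HM.
  - by apply: eq_integral => x /set_mem Dx; rewrite patchE mem_set//; exact: DE.
  - by apply/(measurable_restrictT _ _).1.
  - by move=> y; rewrite patchE; case: ifP.
have mfE : measurable_fun E (EFin \o f) by exact/measurable_EFinP.
split; last first.
  rewrite tr//; last by exact: measurableT_comp.
  by apply: eq_integral => x _; rewrite EFinM abseM (gee0_abs (w0 x : 0 <= (w x)%:E)).
rewrite [LHS]integralE [RHS]integralE !tr//; last 2 first.
- exact: measurable_funeneg.
- exact: measurable_funepos.
congr (_ - _); apply: eq_integral => x _.
- by rewrite !funeposE /= -!EFin_max -EFinM maxr_pMr// mulr0.
- by rewrite !funenegE /= -!EFin_max -EFinM maxr_pMr// mulr0 mulrN.
Qed.

End weighted_image.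

Section moments.
Context {R : realType}.
Variables (beta a b : R) (K : borel_measure R) (omega : R).
Hypothesis beta_gt0 : 0 < beta.
Hypothesis a_ge0 : 0 <= a.
Hypothesis K_fin : (\int[K]_(y in `[(2^-1)%R, 1%R[) ((1 - y) ^+ 2)%:E < +oo)%E.
Hypothesis omega_ge0 : 0 <= omega.
Hypothesis dom_omega : dom K omega.
Hypothesis kap_omega : kap a b K omega = 0.
Hypothesis kap_gt0 : forall q, omega < q -> 0 < kap a b K q.
Variable z0 : R.
Hypothesis z01 : 0 <= z0 <= 1.
Implicit Types (p q : {poly R}) (s t z theta : R) (nu : borel_measure R).

Local Notation polyG := (polyG beta a b K omega).
Local Notation coefG := (coefG beta a b K omega).
Local Notation expG := (expG beta a b K omega).
Local Notation P := (`[0, +oo[%classic : set (measurableTypeR R)).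

Definition flow t p := (expG t p).[z0].

Definition has_flow_moments t nu :=
  nu `]-oo, 0[%classic = 0%E /\ forall k, (\int[nu]_(z in P) (z ^+ k)%:E = (flow t 'X^k)%:E)%E.

Lemma flow_lin t c d p q : flow t (c *: p + d *: q) = c * flow t p + d * flow t q.
Proof. by rewrite /flow expG_lin hornerD !hornerZ. Qed.

Lemma exists_flow_measure t : 0 <= t -> exists nu, has_flow_moments t nu.
Proof.
move=> t0; apply: (haviland (Lam := flow t)); first by move=> *; exact: flow_lin.
by move=> p p0; apply: expG_ge0 => //; have /andP[] := z01.
Qed.

Lemma coefG_growth : exists2 C, 0 <= C & forall j, (0 < j)%N -> coefG j <= C * j%:R ^+ 2.
Proof.
have [C C0 HC] := kap_growth b a_ge0 K_fin omega_ge0 dom_omega.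
exists (C * (1 + omega + beta) ^+ 2); first by apply: mulr_ge0 => //; exact: sqr_ge0.
move=> j j0; have j1 : 1 <= j%:R :> R by rewrite ler1n.
have bj : 0 <= beta * j%:R by rewrite mulr_ge0// ltW.
have := HC (omega + beta * j%:R) ltac:(lra) => /(le_trans (ler_norm _)) H.
have := omega_ge0; have := beta_gt0 => b0 o0.
apply: (le_trans H); rewrite -mulrA ler_wpM2l// -exprMn.
have h1 : 0 <= 1 + (omega + beta * j%:R) by lra.
have h2 : 1 + (omega + beta * j%:R) <= (1 + omega + beta) * j%:R by nra.
by rewrite lerXn2r ?nnegrE// (le_trans h1).
Qed.

Lemma prod_ffact k l : (l <= k)%N -> (\prod_((k - l).+1 <= j < k.+1) j = k ^_ l)%N.
Proof.
move=> lk; apply/eqP; rewrite -(eqn_pmul2r (fact_gt0 (k - l))) ffact_fact// fact_prod mulnC.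
by rewrite -big_cat_nat// ?fact_prod// ltnS leq_subr.
Qed.

(** The product of the l top coefficients is at most C^l times the square of the falling factorial
    [k ^_ l]. One of the two factors is bounded by k!, the other is l! times a binomial coefficient,
    and the binomial theorem sums the result. *)
Lemma flow_Xn_le : exists2 C, 0 <= C & forall t k, 0 <= t ->
  flow t 'X^k <= k`!%:R * (1 + C * t) ^+ k.
Proof.
have [C C0 HC] := coefG_growth; exists C => // t k t0.
rewrite /flow expG_Xn horner_sum exprDn mulr_sumr.
have /andP[z00 z1] := z01.
apply: ler_sum => -[l /= lk] _; rewrite ltnS in lk.
rewrite hornerZ hornerXn expr1n mul1r.
have l0 : 0 < l`!%:R :> R by rewrite ltr0n fact_gt0.
have P1 : \prod_((k - l).+1 <= j < k.+1) coefG j <= C ^+ l * (k ^_ l)%:R ^+ 2.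
  rewrite -prod_ffact// natr_prod -prodrXl.
  have -> : C ^+ l = \prod_((k - l).+1 <= j < k.+1) C.
    by rewrite prodr_const_nat subSS subKn.
  rewrite -big_split/=; rewrite big_nat [leRHS]big_nat; apply: ler_prod => j /andP[j1 _].
  have j0 : (0 < j)%N by exact: leq_ltn_trans j1.
  by rewrite HC// andbT ltW// coefG_gt0.
have F1 : (k ^_ l)%:R <= k`!%:R :> R.
  by rewrite ler_nat -(ffact_fact lk) leq_pmulr// fact_gt0.
have zk : 0 <= z0 ^+ (k - l) <= 1 by rewrite exprn_ge0// exprn_ile1.
have E : (k ^_ l)%:R = 'C(k, l)%:R * l`!%:R :> R by rewrite -bin_ffact natrM.
have tl : 0 <= t ^+ l / l`!%:R by rewrite divr_ge0 ?exprn_ge0// ltW.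
have Cl : 0 <= C ^+ l * (k ^_ l)%:R ^+ 2 by apply: mulr_ge0; [exact: exprn_ge0|exact: sqr_ge0].
have /andP[zk0 zk1] := zk.
apply: (@le_trans _ _ (t ^+ l / l`!%:R * (C ^+ l * (k ^_ l)%:R ^+ 2))).
  rewrite -[leRHS]mulr1; apply: ler_pM => //.
    rewrite mulr_ge0//; rewrite big_seq_cond; apply: prodr_ge0 => j /andP[+ _].
    by rewrite mem_index_iota => /andP[j1 _]; rewrite ltW// coefG_gt0// (leq_ltn_trans _ j1).
  exact: ler_wpM2l.
rewrite (_ : t ^+ l / l`!%:R * _ = (k ^_ l)%:R * ((C * t) ^+ l * 'C(k, l)%:R)).
  rewrite [leRHS](_ : _ = k`!%:R * ((C * t) ^+ l * 'C(k, l)%:R)); last by rewrite mulr_natr.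
  by rewrite ler_wpM2r// mulr_ge0// exprn_ge0// mulr_ge0.
by rewrite expr2 {2}E exprMn; field; rewrite gt_eqF.
Qed.

Lemma flow_poly t nu p : has_flow_moments t nu -> 0 <= t ->
  nu.-integrable P (fun z => (p.[z])%:E) /\ (\int[nu]_(z in P) (p.[z])%:E = (flow t p)%:E)%E.
Proof.
move=> [_ nuX] t0; have mP : measurable P by exact: measurable_itv.
pose Q p := nu.-integrable P (fun z => (p.[z])%:E) /\ (\int[nu]_(z in P) (p.[z])%:E = (flow t p)%:E)%E.
have Qlin c d q r : Q q -> Q r -> Q (c *: q + d *: r).
  move=> [qi qE] [ri rE]; have E z : (c *: q + d *: r).[z] = c * q.[z] + d * r.[z].
    by rewrite hornerD !hornerZ.
  split.
    rewrite (_ : (fun z => _) = (fun z => (c * q.[z] + d * r.[z])%:E)).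
      by apply: integrableD_EFin => //; apply: integrableZl_EFin.
    by apply/funext => z; rewrite E.
  rewrite flow_lin EFinD !EFinM -qE -rE.
  under eq_integral do rewrite E EFinD !EFinM.
  rewrite integralD//; first by rewrite !integralZl.
  - by have := integrableZl_EFin mP c qi.
  - by have := integrableZl_EFin mP d ri.
have QX k : Q 'X^k.
  split; last by rewrite -nuX; apply: eq_integral => z _; rewrite hornerXn.
  have [cX _ _] := C2_continuous (C2_poly ('X^k : {poly R})).
  apply/integrableP; split.
    by apply/measurable_EFinP; exact: measurable_funTS (continuous_measurable_fun cX).
  have -> : (\int[nu]_(z in P) `|('X^k.[z])%:E| = \int[nu]_(z in P) (z ^+ k)%:E)%E.
    apply: eq_integral => z; rewrite inE/= in_itv/= andbT => z0'.
    by rewrite hornerXn ger0_norm// exprn_ge0.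
  by rewrite nuX ltry.
rewrite -/(Q p) -[p]coefK poly_def.
elim/big_ind : _ => [|q r Qq Qr|i _].
- by have := Qlin 0 0 _ _ (QX 0%N) (QX 0%N); rewrite !scale0r addr0.
- by rewrite -[q]scale1r -[r]scale1r; exact: Qlin.
- by have := Qlin p`_i 0 _ _ (QX i) (QX 0%N); rewrite scale0r addr0.
Qed.

(** The k! of [flow_Xn_le] cancels that of the exponential series, leaving a geometric series of
    ratio at most 1/2, of sum at most 2. *)
Lemma flow_exp_moment : exists2 C, 0 <= C & forall t nu theta,
  0 <= t -> has_flow_moments t nu -> 0 <= theta -> theta * (1 + C * t) <= 2^-1 ->
  (\int[nu]_(z in P) (expR (theta * z))%:E <= 2%:E)%E.
Proof.
have [C C0 HC] := flow_Xn_le; exists C => // t nu theta t0 nuM th0 th.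
pose p n : {poly R} := \poly_(k < n) (theta ^+ k / k`!%:R).
have pS n : p n.+1 = 1 *: p n + (theta ^+ n / n`!%:R) *: 'X^n.
  by rewrite /p !poly_def big_ord_recr/= scale1r.
have pE n z : (p n).[z] = series (exp_coeff (theta * z)) n.
  elim: n => [|n IH]; first by rewrite /p poly_def big_ord0 horner0 /series/= big_geq.
  rewrite pS hornerD !hornerZ mul1r IH /series /= big_nat_recr//= hornerXn.
  by rewrite /exp_coeff /= exprMn; congr (_ + _); ring.
have flow_p n : flow t (p n) <= 2 - 2 * 2^-1 ^+ n.
  elim: n => [|n IH].
    have -> : p 0%N = 0 *: 'X^0 + 0 *: 'X^0 by rewrite !scale0r addr0 /p poly_def big_ord0.
    by rewrite flow_lin; lra.
  rewrite pS flow_lin mul1r; have := HC t n t0 => H.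
  have n0 : 0 < n`!%:R :> R by rewrite ltr0n fact_gt0.
  have tn : 0 <= theta ^+ n / n`!%:R by rewrite divr_ge0 ?exprn_ge0// ltW.
  have := ler_wpM2l tn H.
  rewrite (_ : _ * (n`!%:R * _) = (theta * (1 + C * t)) ^+ n); last first.
    by rewrite exprMn; field; rewrite gt_eqF.
  have Ct : 0 <= C * t by rewrite mulr_ge0.
  have : (theta * (1 + C * t)) ^+ n <= 2^-1 ^+ n.
    by rewrite lerXn2r ?nnegrE ?mulr_ge0 ?addr_ge0.
  by rewrite exprS; lra.
have mp n : measurable_fun P (fun z => ((p n).[z])%:E).
  by have [/measurable_int] := flow_poly (p n) nuM t0.
have p0 n z : P z -> (0 <= ((p n).[z])%:E)%E.
  rewrite /= in_itv/= andbT => z0'; rewrite lee_fin pE; apply: sumr_ge0 => i _.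
  by rewrite divr_ge0// exprn_ge0// mulr_ge0.
have pnd z : P z -> {homo (fun n => ((p n).[z])%:E) : n m / (n <= m)%N >-> (n <= m)%E}.
  rewrite /= in_itv/= andbT => z0' n m nm; rewrite lee_fin !pE.
  by apply: nondecreasing_series nm => i _ _; rewrite divr_ge0// exprn_ge0// mulr_ge0.
have L : (\int[nu]_(z in P) (expR (theta * z))%:E =
    \int[nu]_(z in P) limn (fun n => ((p n).[z])%:E))%E.
  apply: eq_integral => z _; apply/esym/cvg_lim => //.
  under eq_fun do rewrite pE.
  apply: cvg_EFin; first exact: nearW.
  exact: is_cvg_series_exp_coeff.
have mP : measurable P by exact: measurable_itv.
have cv := @cvg_monotone_convergence _ _ _ nu _ mP _ mp p0 pnd.
rewrite L -(cvg_lim _ cv)//; apply: lime_le; first by apply/cvg_ex; eexists; exact: cv.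
apply: nearW => n; have [_ ->] := flow_poly (p n) nuM t0.
by rewrite lee_fin (le_trans (flow_p n))// gerBl mulr_ge0// exprn_ge0.
Qed.

End moments.

Lemma Rintegral_dominated_cvg d (T : measurableType d) (R : realType) (mu : {measure set T -> \bar R})
    (D : set T) (fn : nat -> T -> R) (f g : T -> R) : measurable D ->
  (forall n, measurable_fun D (fn n)) -> mu.-integrable D (fun x => (g x)%:E) ->
  (forall x, D x -> fn n x @[n --> \oo] --> f x) -> (forall n x, D x -> `|fn n x| <= g x) ->
  [/\ measurable_fun D f, mu.-integrable D (fun x => (f x)%:E) &
      \int[mu]_(x in D) fn n x @[n --> \oo] --> \int[mu]_(x in D) f x].
Proof.
move=> mD mfn gi fnf fng; have mf := measurable_fun_cvg mfn fnf.
have [] := @dominated_convergence _ _ _ mu D mD (fun n x => (fn n x)%:E) (fun x => (f x)%:E) (fun x => (g x)%:E).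
- by move=> n; apply/measurable_EFinP.
- exact/measurable_EFinP.
- by apply: aeW => x Dx; apply: cvg_EFin; [exact: nearW|exact: fnf].
- exact: gi.
- by apply: aeW => x n Dx; rewrite lee_fin; exact: fng.
move=> fi _ /= H; split=> //; rewrite /Rintegral.
by apply: fine_cvg; rewrite fineK//; exact: integrable_fin_num.
Qed.

Section exp_domination.
Context {R : realType}.
Variables (nu : borel_measure R) (theta : R).
Local Notation P := (`[0, +oo[%classic : set (measurableTypeR R)).
Hypothesis exp_moment : (\int[nu]_(z in P) (expR (theta * z))%:E <= 2%:E)%E.
Implicit Types (f : measurableTypeR R -> R).

Lemma integrable_expR : nu.-integrable P (fun z => (expR (theta * z))%:E).
Proof.
apply/integrableP; split.
  apply/measurable_EFinP; apply: measurable_funTS; apply: continuous_measurable_fun.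
  have [ec _ _] := C2_continuous (C2_expm (- theta) 1).
  rewrite (_ : (fun z => _) = expm (- theta) 1)//.
  by apply/funext => z; rewrite /expm; congr expR; ring.
have -> : (\int[nu]_(z in P) `|(expR (theta * z))%:E| = \int[nu]_(z in P) (expR (theta * z))%:E)%E.
  by apply: eq_integral => z _; rewrite gee0_abs// lee_fin expR_ge0.
by rewrite (le_lt_trans exp_moment)// ltry.
Qed.

Lemma exp_dominated f C : measurable_fun P f -> 0 <= C -> (forall z, 0 <= z -> `|f z| <= C * expR (theta * z)) ->
  nu.-integrable P (fun z => (f z)%:E) /\ `|\int[nu]_(z in P) f z| <= C * 2.
Proof.
move=> mf C0 fC; have mP : measurable P by exact: measurable_itv.
have ei := integrableZl_EFin mP C integrable_expR.
have fi : nu.-integrable P (fun z => (f z)%:E).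
  by apply: (le_integrable_EFin mP mf ei) => z; rewrite /= in_itv/= andbT; exact: fC.
split=> //; apply: (le_trans (le_normr_Rintegral _ _)) => //.
apply: (@le_trans _ _ (\int[nu]_(z in P) (C * expR (theta * z)))).
  apply: le_Rintegral => //; last by move=> z; rewrite /= in_itv/= andbT; exact: fC.
  exact: (integrable_norm fi).
rewrite RintegralZl//; last exact: integrable_expR.
rewrite ler_wpM2l// -lee_fin /Rintegral fineK//; exact: integrable_fin_num integrable_expR.
Qed.

Lemma exp_dominated_cvg (fn : nat -> measurableTypeR R -> R) f C : (forall n, measurable_fun P (fn n)) ->
  (forall n z, 0 <= z -> `|fn n z| <= C * expR (theta * z)) ->
  (forall z, 0 <= z -> fn n z @[n --> \oo] --> f z) ->
  [/\ measurable_fun P f, nu.-integrable P (fun z => (f z)%:E) &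
      \int[nu]_(z in P) fn n z @[n --> \oo] --> \int[nu]_(z in P) f z].
Proof.
move=> mfn fnC fnf; have mP : measurable P by exact: measurable_itv.
apply: (Rintegral_dominated_cvg mP mfn (integrableZl_EFin mP C integrable_expR)).
  by move=> z; rewrite /= in_itv/= andbT; exact: fnf.
by move=> n z; rewrite /= in_itv/= andbT; exact: fnC.
Qed.

End exp_domination.

Lemma jet_cvg_pointwise {R : realType} (gn gn1 gn2 : nat -> R -> R) g g1 g2 z :
  jet_cvg gn gn1 gn2 g g1 g2 -> 0 <= z -> gn n z @[n --> \oo] --> g z.
Proof.
move=> H z0; apply/cvgrPdist_le => e e0; have := H z e e0.
by apply: filterS => n /(_ z); rewrite z0 lexx => /(_ isT)[+ _ _]; rewrite distrC.
Qed.

(** * Determinacy of the moment problem *)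

Section uniqueness.
Context {R : realType}.
Variables (beta a b : R) (K : borel_measure R) (omega : R).
Hypothesis beta_gt0 : 0 < beta.
Hypothesis a_ge0 : 0 <= a.
Hypothesis K_fin : (\int[K]_(y in `[(2^-1)%R, 1%R[) ((1 - y) ^+ 2)%:E < +oo)%E.
Hypothesis omega_ge0 : 0 <= omega.
Hypothesis dom_omega : dom K omega.
Hypothesis kap_omega : kap a b K omega = 0.
Hypothesis kap_gt0 : forall q, omega < q -> 0 < kap a b K q.
Variable z0 : R.
Hypothesis z01 : 0 <= z0 <= 1.

Local Notation P := (`[0, +oo[%classic : set (measurableTypeR R)).
Local Notation flow := (flow beta a b K omega z0).
Local Notation has_flow_moments := (has_flow_moments beta a b K omega z0).
Local Notation T := (measurableTypeR R).

Lemma flow_mass t nu : has_flow_moments t nu -> nu P = 1%E.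
Proof.
move=> [_ /(_ 0%N)]; rewrite /(flow _ _) expr0 expG1 hornerC => <-.
under eq_integral do rewrite expr0.
by rewrite integral_cst ?mul1e//; exact: measurable_itv.
Qed.

Lemma carried_measureE (nu : borel_measure R) (A : set T) : nu `]-oo, 0[%classic = 0%E -> measurable A ->
  nu A = nu (A `&` P).
Proof.
move=> n0 mA; rewrite -[in LHS](setIT A) (_ : [set: T] = P `|` `]-oo, 0[%classic); last first.
  by apply/seteqP; split => // z _ /=; rewrite !in_itv/= andbT; case: (leP 0 z); [left|right].
have mP : measurable P by exact: measurable_itv.
have mN : measurable (`]-oo, 0[%classic : set T) by exact: measurable_itv.
rewrite setIUr measureU; last 3 first.
- exact: measurableI.
- exact: measurableI.
- rewrite setIACA setIid; apply/seteqP; split => // z [_] /=; rewrite !in_itv/= andbT => -[].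
  by move=> /le_lt_trans h /h; rewrite ltxx.
rewrite [X in (_ + X)%E](_ : _ = 0%E) ?adde0//.
by apply: (subset_measure0 _ mN _ n0); [exact: measurableI|exact: subIsetr].
Qed.

(** The functions with equal integrals form a class to which [Cl_bounded] applies with delta = theta
    / 2, [theta] being an exponential rate integrable for both measures. Smoothed indicators of
    half-lines then identify the measures. *)
Lemma flow_measure_unique t nu nu' : 0 <= t -> has_flow_moments t nu -> has_flow_moments t nu' ->
  forall A : set T, measurable A -> nu A = nu' A.
Proof.
move=> t0 nuM nuM'.
have [C C0 HC] := flow_exp_moment beta_gt0 a_ge0 K_fin omega_ge0 dom_omega kap_gt0 z01.
pose theta := 2^-1 / (1 + C * t).
have Ct : 0 < 1 + C * t by rewrite ltr_pwDl// mulr_ge0.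
have th0 : 0 < theta by rewrite divr_gt0.
have th : theta * (1 + C * t) <= 2^-1 by rewrite divfK ?gt_eqF.
have E := HC _ _ _ t0 nuM (ltW th0) th; have E' := HC _ _ _ t0 nuM' (ltW th0) th.
have mP : measurable P by exact: measurable_itv.
pose Cl (g : R -> R) := [/\ nu.-integrable P (fun z => (g z)%:E),
  nu'.-integrable P (fun z => (g z)%:E) &
  \int[nu]_(z in P) g z = \int[nu']_(z in P) g z].
have cont_meas (g : R -> R) : continuous g -> measurable_fun P (g : T -> R).
  by move=> gc; exact: measurable_funTS (continuous_measurable_fun gc).
have ClB f f1 f2 S : C2 f f1 f2 -> (forall z, 0 <= z -> jet_le (f z) (f1 z) (f2 z) S) -> Cl f.
  apply: (@Cl_bounded R (theta / 2) Cl); first by rewrite divr_gt0.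
  - move=> p; have [i1 e1] := flow_poly p nuM t0.
    have [i2 e2] := flow_poly p nuM' t0.
    by split=> //; rewrite /Rintegral e1 e2.
  - move=> c d f' f1' f2' g g1 g2 _ _ [fi fi' fE] [gi gi' gE]; split.
    + by apply: integrableD_EFin => //; exact: integrableZl_EFin.
    + by apply: integrableD_EFin => //; exact: integrableZl_EFin.
    + rewrite !RintegralD//; try exact: (integrableZl_EFin mP).
      by rewrite !RintegralZl// fE gE.
  - move=> gn gn1 gn2 g g1 g2 B gnC gC gnCl gnB gng.
    have dom n z : 0 <= z -> `|gn n z| <= B * expR (theta * z).
      by move=> zz; have [+ _ _] := gnB n z zz; rewrite mulrCA divff// mulr1.
    have mgn n : measurable_fun P (gn n : T -> R).
      by apply: cont_meas; have [] := C2_continuous (gnC n).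
    have pw z := @jet_cvg_pointwise R _ _ _ _ _ _ z gng.
    have [_ gi gc] := exp_dominated_cvg E mgn dom pw.
    have [_ gi' gc'] := exp_dominated_cvg E' mgn dom pw.
    have EE : (fun n => \int[nu]_(z in P) gn n z) = (fun n => \int[nu']_(z in P) gn n z).
      by apply/funext => n; have [] := gnCl n.
    by rewrite EE in gc; split=> //; exact: (cvg_unique _ gc gc').
have [s1 [s2 [M [sC s0 s1' sM]]]] := @C2_smooth_step R.
have ray x : nu `]-oo, x[%classic = nu' `]-oo, x[%classic.
  (* Equal to 1 up to x - 1 / (n + 1) and to 0 from x on, so that the limit is the indicator of the
     open half-line at every point, x included. *)
  pose g (n : nat) (z : R) : R := smooth_step (n.+1%:R * z + (1 - n.+1%:R * x)).
  have gC n := C2_comp sC (C2_affine n.+1%:R (1 - n.+1%:R * x)).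
  have gCl n : Cl (g n).
    apply: (ClB _ _ _ (M * n.+1%:R ^+ 2) (gC n)) => z _.
    have [b0 b1 b2] := sM (n.+1%:R * z + (1 - n.+1%:R * x)).
    have n1 : 1 <= n.+1%:R :> R by rewrite ler1n.
    have M0 : 0 <= M by exact: le_trans b0.
    have n2 : n.+1%:R <= n.+1%:R ^+ 2 :> R by rewrite ler_eXnr.
    have n3 : 1 <= n.+1%:R ^+ 2 :> R by exact: le_trans n2.
    split; first by rewrite (le_trans b0)// ler_peMr.
      by rewrite normrM (ger0_norm (le_trans ler01 n1)); exact: ler_pM.
    by rewrite mulr0 addr0 normrM (ger0_norm (le_trans ler01 n3)); exact: ler_pM.
  have mg n : measurable_fun P (g n : T -> R).
    by apply: cont_meas; have [] := C2_continuous (gC n).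
  have M0 : 0 <= M by have [b0 _ _] := sM 0; exact: le_trans b0.
  have dom n z : 0 <= z -> `|g n z| <= M * expR (theta * z).
    move=> zz; have [b0 _ _] := sM (n.+1%:R * z + (1 - n.+1%:R * x)).
    by rewrite (le_trans b0)// ler_peMr// -expR0 ler_expR mulr_ge0// ltW.
  have pw z : 0 <= z -> g n z @[n --> \oo] --> (\1_(`]-oo, x[%classic) z : R).
    move=> _; apply: cvg_near_cst; have [zx|xz] := ltP z x; last first.
      apply: nearW => n; rewrite indicE memNset /=; last by rewrite in_itv/= ltNge xz.
      apply: s1'; have : 0 <= n.+1%:R * (z - x) by rewrite mulr_ge0// subr_ge0.
      lra.
    near=> n; rewrite indicE mem_set/=; last by rewrite in_itv.
    suff : n.+1%:R * z + (1 - n.+1%:R * x) <= 0 by move=> /s0[].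
    have xz0 : 0 < x - z by rewrite subr_gt0.
    have : (x - z)^-1 <= n.+1%:R.
      by rewrite -natr1 ltW// ltr_wpDr//; near: n; exact: nbhs_infty_gtr.
    move=> /(ler_wpM2r (ltW xz0)); rewrite mulVf ?gt_eqF//; lra.
  have [_ _ c1] := exp_dominated_cvg E mg dom pw.
  have [_ _ c2] := exp_dominated_cvg E' mg dom pw.
  have EI : \int[nu]_(z in P) (\1_(`]-oo, x[%classic) z : R) = \int[nu']_(z in P) (\1_(`]-oo, x[%classic) z : R).
    have EE : (fun n => \int[nu]_(z in P) g n z) = (fun n => \int[nu']_(z in P) g n z).
      by apply/funext => n; have [] := gCl n.
    by rewrite EE in c1; exact: (cvg_unique _ c1 c2).
  have mx : measurable (`]-oo, x[%classic : set T) by exact: measurable_itv.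
  rewrite (carried_measureE nuM.1 mx) (carried_measureE nuM'.1 mx).
  have fin n : has_flow_moments t n -> n (`]-oo, x[%classic `&` P) \is a fin_num.
    move=> nM; rewrite ge0_fin_numE ?measure_ge0//.
    apply: (@le_lt_trans _ _ (n P)); last by rewrite (flow_mass nM) ltry.
    by apply: le_measure; rewrite ?inE; [exact: measurableI|exact: mP|exact: subIsetr].
  move: EI; rewrite /Rintegral !integral_indic//.
  by move=> EI; rewrite -(fineK (fin _ nuM)) -(fineK (fin _ nuM')) EI.
move=> A mA; apply: (@measure_unique _ R T (@RGenInftyO.G R : set (set T)) (fun k => `]-oo, k%:R[%classic : set T) _ _ _ _ nu nu' _ _ A mA).
- exact: RGenInftyO.measurableE.
- move=> _ _ [x ->] [y ->]; exists (Num.min x y).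
  by apply/seteqP; split => z /=; rewrite !in_itv/= lt_min => /andP.
- by move=> k; exists k%:R.
- apply/seteqP; split => // z _; exists (Num.truncn `|z|).+1 => //=.
  by rewrite in_itv/= (le_lt_trans (ler_norm z))// truncnS_gt.
- by move=> _ [x ->]; exact: ray.
- move=> k; have mk : measurable (`]-oo, k%:R[%classic : set T) by exact: measurable_itv.
  rewrite (carried_measureE nuM.1 mk) (@le_lt_trans _ _ (nu P))//; last by rewrite (flow_mass nuM) ltry.
  by apply: le_measure; rewrite ?inE; [exact: measurableI|exact: mP|exact: subIsetr].
Unshelve. all: by end_near. Qed.

End uniqueness.

Lemma Rintegral_lin d (T : measurableType d) (R : realType) (mu : {measure set T -> \bar R})
    (D : set T) (f g k : T -> R) (x y : R) : measurable D ->
  mu.-integrable D (fun z => (f z)%:E) -> mu.-integrable D (fun z => (g z)%:E) ->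
  (forall z, D z -> k z = x * f z + y * g z) ->
  \int[mu]_(z in D) k z = x * \int[mu]_(z in D) f z + y * \int[mu]_(z in D) g z.
Proof.
move=> mD fi gi kE.
rewrite -!RintegralZl// -RintegralD//; try exact: (integrableZl_EFin mD).
by apply: eq_Rintegral => z /set_mem; exact: kE.
Qed.

(** * The evolution equation *)

Section evolution.
Context {R : realType}.
Variables (beta a b : R) (K : borel_measure R) (omega : R).
Hypothesis beta_gt0 : 0 < beta.
Hypothesis a_ge0 : 0 <= a.
Hypothesis K_fin : (\int[K]_(y in `[(2^-1)%R, 1%R[) ((1 - y) ^+ 2)%:E < +oo)%E.
Hypothesis omega_ge0 : 0 <= omega.
Hypothesis dom_omega : dom K omega.
Hypothesis kap_omega : kap a b K omega = 0.
Hypothesis kap_gt0 : forall q, omega < q -> 0 < kap a b K q.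
Variable z0 : R.
Hypothesis z01 : 0 <= z0 <= 1.
Variable nu : R -> borel_measure R.
Hypothesis nuM : forall t, 0 <= t -> has_flow_moments beta a b K omega z0 t (nu t).

Local Notation T := (measurableTypeR R).
Local Notation P := (`[0, +oo[%classic : set T).
Local Notation flow := (flow beta a b K omega z0).
Local Notation polyG := (polyG beta a b K omega).
Local Notation genG := (genG beta a b K omega).
Local Notation leb := (@lebesgue_measure R).
Implicit Types (g : R -> R) (t s z : R).

Definition mean t (f : T -> R) : R := \int[nu t]_(z in P) f z.

(** The class fed to [Cl_bounded]. Besides the equation it records what passing to the limit
    requires: integrability in z, and measurability and boundedness in t for dominated convergence
    in the time integral. The jet is quantified inside as the class bears on [g] alone, which
    determines it by [C2_unique]. *)
Definition evolves (Tm : R) g := forall g1 g2, C2 g g1 g2 -> [/\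
  forall t, 0 <= t <= Tm -> (nu t).-integrable P (fun z => (g z)%:E) /\
    (nu t).-integrable P (fun z => (genG g g1 g2 z)%:E),
  measurable_fun (`[0, Tm]%classic : set T) (fun t => mean t (genG g g1 g2)),
  exists B, forall t, 0 <= t <= Tm -> `|mean t (genG g g1 g2)| <= B &
  forall t, 0 <= t <= Tm -> mean t g = g z0 + \int[leb]_(s in `[0, t]) mean s (genG g g1 g2)].

(** On polynomials the equation is the fundamental theorem of calculus for t -> (exp (t G)
    p)(z0). *)
Lemma evolves_poly Tm (p : {poly R}) : evolves Tm (horner p).
Proof.
move=> g1 g2 gC; have [-> ->] := C2_unique gC (C2_poly p).
have mE t (q : {poly R}) : 0 <= t -> mean t (horner q) = flow t q.
  by move=> t0; rewrite /mean /Rintegral; have [_ ->] := flow_poly q (nuM t0) t0.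
pose G := genG (horner p) (horner p^`()) (horner p^`()^`()).
have GE z : P z -> G z = (polyG p).[z].
  by rewrite /= in_itv/= andbT => zz; rewrite /G genG_poly.
have mG t : 0 <= t -> mean t G = flow t (polyG p).
  by move=> t0; rewrite -mE//; apply: eq_Rintegral => z /set_mem; exact: GE.
have D (t : R) q := is_derive_expG beta a b K omega t q z0.
have fc q : continuous (fun t => flow t q).
  by move=> t; exact: is_derive_continuous (D t q).
have mGon t (I : set T) : measurable I -> (forall s, I s -> 0 <= s) ->
    measurable_fun I (fun t => mean t G).
  move=> mI I0; apply: (@eq_measurable_fun _ _ _ _ _ (fun t => flow t (polyG p))).
    by move=> s /set_mem /I0 s0; rewrite mG.
  exact: measurable_funTS (continuous_measurable_fun (fc _)).
split.
- move=> t /andP[t0 _]; split; first by have [] := flow_poly p (nuM t0) t0.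
  have [pi _] := flow_poly (polyG p) (nuM t0) t0.
  by apply: eq_integrable pi => [|z /set_mem /GE <-//]; exact: measurable_itv.
- by apply: (mGon 0); [exact: measurable_itv|move=> s; rewrite /= in_itv/= => /andP[]].
- have [M M0 HM] := continuous_bounded Tm (fc (polyG p)).
  by exists M => t tT; rewrite mG; [exact: HM|case/andP: tT].
- move=> t /andP[t0 _]; rewrite mE//.
  have -> : \int[leb]_(s in `[0, t]) mean s G = \int[leb]_(s in `[0, t]) flow s (polyG p).
    by apply: eq_Rintegral => s; rewrite inE/= in_itv/= => /andP[s0 _]; rewrite mG.
  have p0 : p.[z0] = flow 0 p by rewrite /(flow _ _) expG0.
  move: t0; rewrite le_eqVlt => /predU1P[<-|t0].
    by rewrite set_itv1 Rintegral_set1 addr0.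
  rewrite /Rintegral (@continuous_FTC2 _ (fun s => flow s (polyG p)) (fun s => flow s p))//.
  + by rewrite p0 -EFinB -[fine _]/(flow t p - flow 0 p) addrC subrK.
  + exact: continuous_subspaceT.
  + split => [s _||].
    * by have Ds := D s p; exact: ex_derive.
    * exact: cvg_at_right_filter (fc p 0).
    * exact: cvg_at_left_filter (fc p t).
  + by move=> s _; rewrite derive1E; have Ds := D s p; rewrite derive_val.
Qed.

Lemma bounded_integrable Tm (f : T -> R) B t : measurable_fun (`[0, Tm]%classic : set T) f ->
  (forall s, 0 <= s <= Tm -> `|f s| <= B) -> 0 <= t <= Tm ->
  leb.-integrable `[0, t] (fun s => (f s)%:E).
Proof.
move=> mf fB /andP[t0 tT]; have mt : measurable (`[0, t]%classic : set T) by exact: measurable_itv.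
have sub : (`[0, t]%classic : set T) `<=` `[0, Tm]%classic.
  by move=> s /=; rewrite !in_itv/= => /andP[-> st]; exact: le_trans tT.
apply: (le_integrable_EFin mt _ (g := fun=> B)).
- by apply: measurable_funS mf => //; exact: measurable_itv.
- apply: continuous_compact_integrable; first exact: segment_compact.
  by apply: continuous_subspaceT => s; exact: cvg_cst.
- by move=> s /sub; rewrite /= in_itv/=; exact: fB.
Qed.

Lemma evolves_lin Tm c d f f1 f2 g g1 g2 : C2 f f1 f2 -> C2 g g1 g2 ->
  evolves Tm f -> evolves Tm g -> evolves Tm (fun z => c * f z + d * g z).
Proof.
move=> fC gC /(_ _ _ fC)[fi fm [Bf fB] fE] /(_ _ _ gC)[gi gm [Bg gB] gE] k1 k2 kC.
have [-> ->] := C2_unique kC (C2_lin c d fC gC).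
have mP : measurable P by exact: measurable_itv.
have aux (m m1 m2 k k3 k4 x y : R) : m1 = x + k3 -> m2 = y + k4 -> m = c * m1 + d * m2 ->
    k = c * k3 + d * k4 -> m = c * x + d * y + k by move=> -> -> -> ->; ring.
set G := genG (fun z => c * f z + d * g z) _ _.
have GE : G = (fun z => c * genG f f1 f2 z + d * genG g g1 g2 z).
  by apply/funext => z; rewrite /G genG_lin.
have lin t (u v : T -> R) : (nu t).-integrable P (fun z => (u z)%:E) ->
    (nu t).-integrable P (fun z => (v z)%:E) ->
    mean t (fun z => c * u z + d * v z) = c * mean t u + d * mean t v.
  by move=> ui vi; rewrite /mean (Rintegral_lin mP ui vi (fun=> fun=> erefl)).
have mG t : 0 <= t <= Tm -> mean t G = c * mean t (genG f f1 f2) + d * mean t (genG g g1 g2).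
  by move=> tT; rewrite GE lin//; [have [] := fi t tT|have [] := gi t tT].
split.
- move=> t tT; have [i1 i2] := fi t tT; have [j1 j2] := gi t tT; rewrite GE.
  by split; apply: integrableD_EFin => //; exact: integrableZl_EFin.
- apply: (@eq_measurable_fun _ _ _ _ _
    (fun t => c * mean t (genG f f1 f2) + d * mean t (genG g g1 g2))).
    by move=> t; rewrite inE/= in_itv/= => tT; rewrite mG.
  apply: measurable_funD; apply: measurable_funM;
    [exact: measurable_cst|exact: fm|exact: measurable_cst|exact: gm].
- exists (`|c| * Bf + `|d| * Bg) => t tT; rewrite mG//.
  have := ler_wpM2l (normr_ge0 c) (fB t tT); have := ler_wpM2l (normr_ge0 d) (gB t tT).
  rewrite -(normrM c) -(normrM d) => h1 h2.
  exact: le_trans (ler_normD _ _) (lerD h2 h1).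
- move=> t tT; have [i1 _] := fi t tT; have [j1 _] := gi t tT.
  have mt : measurable (`[0, t]%classic : set T) by exact: measurable_itv.
  have If := bounded_integrable fm fB tT; have Ig := bounded_integrable gm gB tT.
  have E : \int[leb]_(s in `[0, t]) mean s G = c * (\int[leb]_(s in `[0, t]) mean s (genG f f1 f2)) +
      d * (\int[leb]_(s in `[0, t]) mean s (genG g g1 g2)).
    apply: (Rintegral_lin mt If Ig) => s; rewrite /= in_itv/= => /andP[s0 st].
    by apply: mG; rewrite s0; case/andP: tT => _; exact: le_trans.
  exact: aux (fE t tT) (gE t tT) (lin _ _ _ i1 j1) E.
Qed.

(** The bound on [genG] involves u * g2 u, hence a factor z on top of the growth exp (2 delta z);
    the third delta in the moment hypothesis pays for it. *)
Lemma evolves_lim Tm delta gn gn1 gn2 g g1 g2 C : 0 < delta ->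
  (forall t, 0 <= t <= Tm -> (\int[nu t]_(z in P) (expR (3 * delta * z))%:E <= 2%:E)%E) ->
  (forall n, C2 (gn n) (gn1 n) (gn2 n)) -> C2 g g1 g2 -> (forall n, evolves Tm (gn n)) ->
  (forall n z, 0 <= z -> jet_le (gn n z) (gn1 n z) (gn2 n z) (C * expR (2 * delta * z))) ->
  jet_cvg gn gn1 gn2 g g1 g2 -> evolves Tm g.
Proof.
move=> d0 Em gnC gC gnE gnB gng k1 k2 kC; have [-> ->] := C2_unique kC gC.
have mP : measurable P by exact: measurable_itv.
have C0 : 0 <= C.
  by have [h _ _] := gnB 0%N 0 (lexx _); have := le_trans (normr_ge0 _) h; rewrite mulr0 expR0 mulr1.
pose Gn n := genG (gn n) (gn1 n) (gn2 n); pose G := genG g g1 g2.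
have exp23 z : 0 <= z -> expR (2 * delta * z) <= expR (3 * delta * z).
  by move=> zz; rewrite ler_expR ler_wpM2r// ler_wpM2r ?(ltW d0)// ler_nat.
have gn_dom n z : 0 <= z -> `|gn n z| <= C * expR (3 * delta * z).
  by move=> zz; have [h _ _] := gnB n z zz; rewrite (le_trans h)// ler_wpM2l// exp23.
have mgn n : measurable_fun P (gn n : T -> R).
  by have [gc _ _] := C2_continuous (gnC n); exact: measurable_funTS (continuous_measurable_fun gc).
have [D D0 HD] := genG_bound beta_gt0 a_ge0 K_fin omega_ge0 dom_omega kap_omega.
have Gn_dom n z : 0 <= z -> `|Gn n z| <= D * (C * (1 + delta^-1)) * expR (3 * delta * z).
  move=> zz; have E1 : z * expR (2 * delta * z) <= delta^-1 * expR (3 * delta * z).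
    rewrite (_ : 3 * delta * z = delta * z + 2 * delta * z); last by ring.
    rewrite expRD mulrA ler_wpM2r ?expR_ge0// ler_pdivlMl//.
    by have := expR_ge1Dx (delta * z); lra.
  have E2 := exp23 z zz; have E0 := expR_gt0 (2 * delta * z).
  have := HD _ _ _ (C * (expR (2 * delta * z) + z * expR (2 * delta * z))) z (gnC n) zz.
  move=> H; apply: (@le_trans _ _ (D * (C * (expR (2 * delta * z) + z * expR (2 * delta * z))))); last first.
    rewrite (_ : D * (C * _) * _ = D * (C * (expR (3 * delta * z) + delta^-1 * expR (3 * delta * z)))).
      by rewrite ler_wpM2l// ler_wpM2l// lerD.
    by ring.
  apply: H => u /andP[u0 uz]; have [_ b1 b2] := gnB n u u0.
  have E3 : expR (2 * delta * u) <= expR (2 * delta * z).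
    by rewrite ler_expR ler_wpM2l// mulr_ge0// ltW.
  have CE := ler_wpM2l C0 E3; have zE : 0 <= z * expR (2 * delta * z) by rewrite mulr_ge0// ltW.
  have CzE := mulr_ge0 C0 zE; split.
    by rewrite mulrDr; lra.
  rewrite normrM (ger0_norm u0) mulrDr.
  have : u * `|gn2 n u| <= z * (C * expR (2 * delta * z)) by apply: ler_pM => //; exact: le_trans CE.
  by have := mulr_ge0 C0 (ltW E0); lra.
have Gn_pw z : 0 <= z -> Gn n z @[n --> \oo] --> G z.
  move=> zz; apply/cvgrPdist_le => e e0.
  pose e' := e / ((D + 1) * (1 + z)).
  have Dz : 0 < (D + 1) * (1 + z) by rewrite mulr_gt0//; lra.
  have e'0 : 0 < e' by rewrite divr_gt0.
  have := gng z e' e'0; apply: filterS => n H.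
  have -> : G z - Gn n z = genG (fun z => 1 * g z + -1 * gn n z)
      (fun z => 1 * g1 z + -1 * gn1 n z) (fun z => 1 * g2 z + -1 * gn2 n z) z.
    by rewrite genG_lin// /G /Gn; ring.
  have := HD _ _ _ (e' * (1 + z)) z (C2_lin 1 (-1) gC (gnC n)) zz => HH.
  apply: (@le_trans _ _ (D * (e' * (1 + z)))); last first.
    rewrite (_ : D * _ = e * (D / (D + 1))); last by rewrite /e'; field; lra.
    by rewrite ler_piMr ?(ltW e0)// ler_pdivrMr; lra.
  apply: HH => u /andP[u0 uz]; have [_ b1 b2] := H u ltac:(by rewrite u0).
  have n1 : `|1 * g1 u + -1 * gn1 n u| <= e' by rewrite -normrN; congr (`|_| <= _): b1; ring.
  have n2 : `|1 * g2 u + -1 * gn2 n u| <= e' by rewrite -normrN; congr (`|_| <= _): b2; ring.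
  have e'z : 0 <= e' * z by rewrite mulr_ge0// ltW.
  split; first by lra.
  rewrite normrM (ger0_norm u0); have : u * `|1 * g2 u + -1 * gn2 n u| <= z * e' by exact: ler_pM.
  lra.
have gn_pw z : 0 <= z -> gn n z @[n --> \oo] --> g z by exact: jet_cvg_pointwise gng.
have gn_C n := gnE n _ _ (gnC n).
pose C' := D * (C * (1 + delta^-1)).
have C'0 : 0 <= C' by rewrite !mulr_ge0// addr_ge0// invr_ge0 ltW.
have mGn n t : 0 <= t <= Tm -> measurable_fun P (Gn n : T -> R).
  by move=> tT; have [/(_ t tT)[_ /measurable_fun_EFin_integrable]] := gn_C n.
have Gcv t : 0 <= t <= Tm -> [/\ (nu t).-integrable P (fun z => (G z)%:E),
    mean t (Gn n) @[n --> \oo] --> mean t G & forall n, `|mean t (Gn n)| <= C' * 2].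
  move=> tT; have [mG iG cG] := exp_dominated_cvg (Em t tT) (fun n => mGn n t tT) Gn_dom Gn_pw.
  split=> // n; have [] := exp_dominated (Em t tT) (mGn n t tT) C'0 (Gn_dom n); by [].
have gcv t : 0 <= t <= Tm -> (nu t).-integrable P (fun z => (g z)%:E) /\
    mean t (gn n) @[n --> \oo] --> mean t g.
  by move=> tT; have [_ ? ?] := exp_dominated_cvg (Em t tT) mgn gn_dom gn_pw.
have mmean : measurable_fun (`[0, Tm]%classic : set T) (fun t => mean t G).
  apply: (measurable_fun_cvg (h := fun n t => mean t (Gn n))).
    by move=> n; have [_ + _ _] := gn_C n.
  by move=> t; rewrite /= in_itv/= => tT; have [] := Gcv t tT.
have bmean t : 0 <= t <= Tm -> `|mean t G| <= C' * 2.
  move=> tT; have [_ c bd] := Gcv t tT.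
  have c' : `|mean t (Gn n)| @[n --> \oo] --> `|mean t G| by exact: cvg_norm.
  rewrite -(cvg_lim _ c')//; apply: limr_le; first by apply/cvg_ex; eexists; exact: c'.
  exact: nearW.
split=> //.
- by move=> t tT; have [? _] := gcv t tT; have [? _ _] := Gcv t tT.
- by exists (C' * 2).
- move=> t tT; have [_ c1] := gcv t tT.
  have mt : measurable (`[0, t]%classic : set T) by exact: measurable_itv.
  have sub s : (`[0, t]%classic : set T) s -> 0 <= s <= Tm.
    rewrite /= in_itv/= => /andP[-> st]; case/andP: tT => _; exact: le_trans.
  have [||||_ _ c2] := @Rintegral_dominated_cvg _ T R leb `[0, t]%classic (fun n s => mean s (Gn n))
      (fun s => mean s G) (fun=> C' * 2) mt.
  + move=> n; have [_ m1 _ _] := gn_C n; apply: measurable_funS m1; first exact: measurable_itv.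
    by move=> s /sub; rewrite /= in_itv.
  + by apply: (@bounded_integrable t _ (C' * 2)) => [|s _|];
      [exact: measurable_cst|rewrite ger0_norm// mulr_ge0|rewrite lexx andbT; case/andP: tT].
  + by move=> s /sub /Gcv[].
  + by move=> n s /sub /Gcv[].
  have c3 : gn n z0 + \int[leb]_(s in `[0, t]) mean s (Gn n) @[n --> \oo] -->
      g z0 + \int[leb]_(s in `[0, t]) mean s G.
    by apply: cvgD c2; apply: gn_pw; case/andP: z01.
  have EE : (fun n => mean t (gn n)) = (fun n => gn n z0 + \int[leb]_(s in `[0, t]) mean s (Gn n)).
    by apply/funext => n; have [_ _ _ ->] := gn_C n.
  by rewrite EE in c1; exact: (cvg_unique _ c1 c3).
Qed.

Theorem evolution Tm g g1 g2 S : C2 g g1 g2 -> (forall z, 0 <= z -> jet_le (g z) (g1 z) (g2 z) S) ->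
  0 <= Tm -> evolves Tm g.
Proof.
move=> gC gS T0.
have [C C0 HC] := flow_exp_moment beta_gt0 a_ge0 K_fin omega_ge0 dom_omega kap_gt0 z01.
(* The rate admissible at the final time is admissible at all earlier ones. *)
pose theta := 2^-1 / (1 + C * Tm).
have CT : 0 < 1 + C * Tm by rewrite ltr_pwDl// mulr_ge0.
have th0 : 0 < theta by rewrite divr_gt0.
pose delta := theta / 3; have d0 : 0 < delta by rewrite divr_gt0.
have Em t : 0 <= t <= Tm -> (\int[nu t]_(z in P) (expR (3 * delta * z))%:E <= 2%:E)%E.
  move=> /andP[t0 tT]; rewrite (_ : 3 * delta = theta); last by rewrite /delta; field.
  apply: (HC t) => //; [exact: nuM|exact: ltW|].
  apply: (@le_trans _ _ (theta * (1 + C * Tm))); last by rewrite divfK ?gt_eqF.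
  by rewrite ler_wpM2l ?(ltW th0)// lerD2l ler_wpM2l.
apply: (Cl_bounded d0 (evolves_poly Tm) _ _ gC gS).
  by move=> c d f f1 f2 k k1 k2; exact: evolves_lin.
by move=> gn gn1 gn2 k k1 k2 B; exact: evolves_lim.
Qed.

End evolution.

(** * Absence of an atom at the origin *)

Section glue.
Context {R : realType}.
Implicit Types (f g : R -> R) (x y z : R).

Definition extend f (c z : R) := if 0 < z then f z else c.

(** Real powers are smooth on the open half-line only; constancy near 0 lets expressions in them
    enter the C^2 calculus on the line. *)
Lemma C2_extend f f1 f2 (c e : R) : 0 < e -> C2_pos f f1 f2 ->
  (forall x, 0 < x -> {for x, continuous f2}) -> (forall x, 0 < x < e -> f x = c) ->
  C2 (extend f c) (extend f1 0) (extend f2 0).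
Proof.
move=> e0 fC f2c fc.
have der0 (k : R -> R) (l x cc : R) : (forall u, 0 < u < e -> k u = cc) -> 0 < x < e ->
    is_derive x 1 k l -> l = 0.
  move=> kc /andP[x0 xe] D; have D0 : is_derive x 1 k 0.
    apply: near_eq_is_derive (is_derive_cst (cc : R) x 1).
    by near=> u; rewrite kc//; apply/andP; split; near: u; [exact: lt_nbhsr|exact: lt_nbhsl].
  by rewrite -(@derive_val _ _ _ _ _ _ _ D) (@derive_val _ _ _ _ _ _ _ D0).
have f1c x : 0 < x < e -> f1 x = 0.
  by move=> xe; have /andP[x0 _] := xe; apply: der0 fc xe (fC x x0).1.
have f2c0 x : 0 < x < e -> f2 x = 0.
  by move=> xe; have /andP[x0 _] := xe; apply: der0 f1c xe (fC x x0).2.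
have E (k : R -> R) cc u : (forall u, 0 < u < e -> k u = cc) -> u < e -> extend k cc u = cc.
  by move=> kc ue; rewrite /extend; case: ltP => // u0; rewrite kc// u0.
have near_e (u : R) : u <= 0 -> \near u, u < e.
  by move=> u0; apply: lt_nbhsl; exact: le_lt_trans e0.
have pos_near (u : R) (k : R -> R) cc : 0 < u -> \near u, k u = extend k cc u.
  by move=> u0; near=> v; rewrite /extend ifT//; near: v; exact: lt_nbhsr.
split.
- move=> x; have [x0|x0] := ltP 0 x.
    by rewrite /extend x0; apply: near_eq_is_derive (pos_near _ _ _ x0) (fC x x0).1.
  rewrite (E _ _ _ f1c (le_lt_trans x0 e0)).
  apply: near_eq_is_derive (is_derive_cst c _ _).
  by apply: filterS (near_e x x0) => v /(E _ _ _ fc).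
- move=> x; have [x0|x0] := ltP 0 x.
    by rewrite {2}/extend x0; apply: near_eq_is_derive (pos_near _ _ _ x0) (fC x x0).2.
  rewrite (E _ _ _ f2c0 (le_lt_trans x0 e0)).
  apply: near_eq_is_derive (is_derive_cst 0 _ _).
  by apply: filterS (near_e x x0) => v /(E _ _ _ f1c).
- move=> x; rewrite /continuous_at; have [x0|x0] := ltP 0 x.
    apply: (cvg_trans (near_eq_cvg (pos_near x f2 0 x0))).
    by rewrite /extend x0; exact: f2c.
  rewrite (E _ _ _ f2c0 (le_lt_trans x0 e0)).
  by apply: cvg_near_cst; apply: filterS (near_e x x0) => v /(E _ _ _ f2c0).
Unshelve. all: by end_near. Qed.

Lemma pos3_convex x y : pos3 y + 3 * Num.max y 0 ^+ 2 * (x - y) <= pos3 x.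
Proof.
have [y0|y0] := leP y 0; have [x0|x0] := leP x 0.
- by rewrite !pos3_le0//; lra.
- by rewrite (pos3_le0 y0) (pos3_ge0 (ltW x0)); have := exprn_ge0 3 (ltW x0); lra.
- by rewrite (pos3_le0 x0) (pos3_ge0 (ltW y0)); nra.
(* x^3 - y^3 - 3 y^2 (x - y) = (x - y)^2 (x + 2 y). *)
- rewrite (pos3_ge0 (ltW y0)) (pos3_ge0 (ltW x0)); have : 0 <= (x - y) ^+ 2 * (x + 2 * y).
    by apply: mulr_ge0; [exact: sqr_ge0|lra].
  by rewrite !expr2 !exprS expr0; lra.
Qed.

End glue.

Lemma Rintegral_le0 d (T : measurableType d) (R : realType) (mu : {measure set T -> \bar R})
    (D : set T) (f : T -> R) : measurable D -> mu.-integrable D (fun x => (f x)%:E) ->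
  (forall x, D x -> f x <= 0) -> \int[mu]_(x in D) f x <= 0.
Proof.
move=> mD fi f0; apply: (@le_trans _ _ (\int[mu]_(x in D) 0)).
  by apply: le_Rintegral => //; exact: integrable0.
by rewrite Rintegral_cst// mul0r.
Qed.

Section no_atom_one.
Context {R : realType}.
Variables (beta a b : R) (K : borel_measure R) (omega : R).
Hypothesis beta_gt0 : 0 < beta.
Hypothesis a_ge0 : 0 <= a.
Hypothesis K_fin : (\int[K]_(y in `[(2^-1)%R, 1%R[) ((1 - y) ^+ 2)%:E < +oo)%E.
Hypothesis omega_ge0 : 0 <= omega.
Hypothesis dom_omega : dom K omega.
Hypothesis kap_omega : kap a b K omega = 0.
Hypothesis kap_gt0 : forall q, omega < q -> 0 < kap a b K q.
Variable r : R.
Hypothesis r_omega : 0 <= r < omega.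
Hypothesis dom_r : dom K r.
Hypothesis kap_r : kap a b K r < 0.
Implicit Types (g : R -> R) (A B t x z : R).

Local Notation genG := (genG beta a b K omega).
Let s := (omega - r) / beta.

Let s_gt0 : 0 < s.
Proof. by rewrite divr_gt0// subr_gt0; case/andP: r_omega. Qed.

(** The exponent [s] is chosen so that tilting A + B z^(- s) gives A x^omega + B x^r, on which
    [genL] is nonpositive as [kap omega] is 0 and [kap r] negative. Its difference with the tilt of
    [g] is nonnegative and vanishes at the point considered, so [genL_min_ge0] compares the two. *)
Lemma genG_tangent_le0 g g1 g2 z A B : C2 g g1 g2 -> 0 < z -> 0 <= B ->
  (forall u, 0 < u -> g u <= A + B * u `^ (- s)) -> g z = A + B * z `^ (- s) ->
  genG g g1 g2 z <= 0.
Proof.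
move=> gC z0 B0 gle gz; have /andP[r0 rw] := r_omega.
pose x := z `^ beta^-1; have x0 : 0 < x by exact: powR_gt0.
have xz : x `^ beta = z by rewrite /x -powRrM mulVf ?gt_eqF// powRr1// ltW.
have E u : 0 < u -> u `^ omega * (u `^ beta) `^ (- s) = u `^ r.
  move=> u0; rewrite -powRrM -powRD_gt0//; congr (_ `^ _).
  by rewrite /s; field; rewrite gt_eqF.
have [So jo] := jet_bound_powR omega x; have [Sr jr] := jet_bound_powR r x.
have io := integrable_jump K_fin omega_ge0 dom_omega (C2_pos_powR omega) x0 jo.
have ir := integrable_jump K_fin r0 dom_r (C2_pos_powR r) x0 jr.
have ig := integrable_jump_tilt beta_gt0 K_fin omega_ge0 dom_omega gC x0.
set f1 := (fun u => omega * _) in io; set k1 := (fun u => r * _) in ir.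
pose f2 u := omega * (omega - 1) * u `^ (omega - 2).
pose k2 u := r * (r - 1) * u `^ (r - 2).
have ifk : K.-integrable (`[2^-1, 1[%classic : set (measurableTypeR R)) (fun y =>
    (jump (fun u => A * u `^ omega + B * u `^ r) (fun u => A * f1 u + B * k1 u) x y)%:E).
  have mI := @measurable_I R.
  rewrite (_ : (fun y => _) = (fun y => (A * jump (fun u => u `^ omega) f1 x y +
      B * jump (fun u => u `^ r) k1 x y)%:E)).
    by apply: integrableD_EFin => //; exact: integrableZl_EFin.
  by apply/funext => y; rewrite /jump /split_eval; congr EFin; ring.
have Cpos := C2_pos_lin 1 (-1) (C2_pos_lin A B (C2_pos_powR omega) (C2_pos_powR r))
  (C2_pos_tilt beta omega gC).
have := genL_min_ge0 (- beta) b K a_ge0 Cpos x0.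
rewrite (@genL_lin R (- beta) a b K 1 (-1) _ _ (fun u => A * f2 u + B * k2 u) _ _ (tilt2 beta omega g g1 g2) x ifk ig).
rewrite (@genL_lin R (- beta) a b K A B _ _ f2 _ _ k2 x io ir).
rewrite !genL_powR// kap_omega genL_tilt// xz => H.
have xp := powR_gt0 omega x0; have xr := powR_gt0 (r + - beta) x0.
suff : x `^ omega * genG g g1 g2 z <= 0 by rewrite pmulr_rle0.
have : B * (kap a b K r * x `^ (r + - beta)) <= 0.
  by rewrite mulr_ge0_le0// mulr_le0_ge0 ?(ltW xr)// ltW.
suff : 0 <= 1 * (A * (0 * x `^ (omega - beta)) + B * (kap a b K r * x `^ (r - beta))) +
    -1 * (x `^ omega * genG g g1 g2 z) by lra.
apply: H => [u u0|].
  have ub := powR_gt0 beta u0; have uo := powR_gt0 omega u0.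
  have := ler_wpM2l (ltW uo) (gle _ ub).
  by rewrite mulrDr (mulrCA _ B) E// /tilt; lra.
by have Ex := E x x0; rewrite xz in Ex; rewrite /tilt xz gz -Ex; ring.
Qed.

(* [cap_fun N v] is concave and nondecreasing, equal to [N / 3] for [N <= v] and at
   most [1] at [v = 1]; composed with [z `^ (- s)] it is constant near [0]. *)
Let cap_fun (N v : R) := (N ^+ 3 - pos3 (N - v)) / (3 * N ^+ 2).
Let cap_fun1 (N v : R) := Num.max (N - v) 0 ^+ 2 / N ^+ 2.
Let cap_fun2 (N v : R) := - (2 * Num.max (N - v) 0 / N ^+ 2).

Let C2_cap_fun N : 0 < N -> C2 (cap_fun N) (cap_fun1 N) (cap_fun2 N).
Proof.
move=> N0; have C := C2_comp (@C2_pos3 R) (C2_affine (-1) N).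
have := C2_lin (- (3 * N ^+ 2)^-1) 1 C (C2_cst (N ^+ 3 / (3 * N ^+ 2))).
have N1 : N != 0 by rewrite gt_eqF.
have E (v : R) : -1 * v + N = N - v by ring.
congr C2; apply/funext => v; rewrite E.
- by rewrite /cap_fun; field.
- by rewrite /cap_fun1; field.
- by rewrite /cap_fun2; field.
Qed.

Let cap_fun_tangent N v w : 0 < N -> cap_fun N v <= cap_fun N w + cap_fun1 N w * (v - w).
Proof.
move=> N0; have := pos3_convex (N - v) (N - w).
have N1 : N != 0 by rewrite gt_eqF.
have N2 : 0 < 3 * N ^+ 2 by rewrite mulr_gt0// exprn_gt0.
move=> H; rewrite -(ler_pM2r N2).
have -> : cap_fun N v * (3 * N ^+ 2) = N ^+ 3 - pos3 (N - v) by rewrite /cap_fun; field.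
have -> : (cap_fun N w + cap_fun1 N w * (v - w)) * (3 * N ^+ 2) =
    N ^+ 3 - pos3 (N - w) + 3 * Num.max (N - w) 0 ^+ 2 * (v - w).
  by rewrite /cap_fun /cap_fun1; field.
by move: H; nra.
Qed.

Let cap_jet N : 1 <= N -> exists g1 g2 S, let g := extend (fun z => cap_fun N (z `^ (- s))) (N / 3) in
  [/\ C2 g g1 g2, forall z, 0 <= z -> jet_le (g z) (g1 z) (g2 z) S & g1 0 = 0].
Proof.
move=> N1; have N0 : 0 < N by lra.
have s0 := s_gt0.
pose f z := cap_fun N (z `^ (- s)).
pose p1 (z : R) := - s * z `^ (- s - 1); pose p2 (z : R) := - s * (- s - 1) * z `^ (- s - 2).
pose f1 z := cap_fun1 N (z `^ (- s)) * p1 z.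
pose f2 z := cap_fun2 N (z `^ (- s)) * p1 z ^+ 2 + cap_fun1 N (z `^ (- s)) * p2 z.
have C := C2_cap_fun N0; have [c0c c1c c2c] := C2_continuous C.
have fC : C2_pos f f1 f2.
  move=> z z0; have [Dp Dp1] := C2_pos_powR (- s) z0; have [cd cd1 _] := C; split.
    exact: (is_derive_comp (cd _) Dp).
  rewrite /f2 (_ : _ + _ = cap_fun2 N (z `^ (- s)) * p1 z * p1 z + cap_fun1 N (z `^ (- s)) * p2 z).
    by apply: is_derive_mul => //; exact: (is_derive_comp (cd1 _) Dp).
  by ring.
have powc q (z : R) : 0 < z -> {for z, continuous (fun u => u `^ q)}.
  by move=> z0; have D := is_derive1_powR q z0; exact: is_derive_continuous D.
have f2c z : 0 < z -> {for z, continuous f2}.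
  move=> z0; have cs := powc (- s) z z0.
  have c2 : {for z, continuous (fun u => cap_fun2 N (u `^ (- s)))}.
    by apply: (@continuous_comp _ _ _ (fun u => u `^ (- s)) (cap_fun2 N)); [exact: cs|exact: c2c].
  have c1 : {for z, continuous (fun u => cap_fun1 N (u `^ (- s)))}.
    by apply: (@continuous_comp _ _ _ (fun u => u `^ (- s)) (cap_fun1 N)); [exact: cs|exact: c1c].
  have cp1 : {for z, continuous p1} by apply: cvgM; [exact: cvg_cst|exact: powc].
  have cp2 : {for z, continuous p2} by apply: cvgM; [exact: cvg_cst|exact: powc].
  by apply: cvgD; apply: cvgM => //; apply: cvgM.
(* For z < e one has z^(- s) >= N, where [cap_fun N] is constant. *)
pose e := N `^ (- s^-1).
have e0 : 0 < e by exact: powR_gt0.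
have fe z : 0 < z < e -> f z = N / 3.
  move=> /andP[z0 ze].
  have NE : N = e `^ (- s) by rewrite /e -powRrM mulrNN mulVf ?gt_eqF// powRr1// ltW.
  have : N <= z `^ (- s).
    rewrite [leLHS]NE !powRN lef_pV2 ?posrE ?powR_gt0//.
    by apply: ge0_ler_powR; rewrite ?nnegrE ?(ltW z0) ?(ltW e0) ?(ltW s0)// ltW.
  move=> Nz; rewrite /f /cap_fun pos3_le0 ?subr_le0// subr0; field; lra.
have gC := C2_extend e0 fC f2c fe.
exists (extend f1 0), (extend f2 0).
have [M M0 HM] := C2_bounded 1 gC.
(* M bounds the jet on [0, 1]; the other term bounds it for z > 1, where the powers of z involved
   are at most 1. *)
exists (M + (N + s + 2 * s ^+ 2 + s * (s + 1))) => g; split => //; last by rewrite /extend ltxx.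
have S0 : 0 <= N + s + 2 * s ^+ 2 + s * (s + 1).
  by have := mulr_ge0 (ltW s0) (ltW s0); rewrite expr2; nra.
move=> z z0; have [z1|z1] := leP z 1.
  by apply: jet_le_trans (HM z _) _; rewrite ?z0 ?lerDl.
have zp : 0 < z by lra.
suff : jet_le (f z) (f1 z) (f2 z) (N + s + 2 * s ^+ 2 + s * (s + 1)).
  by rewrite /g /extend zp => /jet_le_trans; apply; rewrite lerDr.
have pw q : q <= 0 -> 0 <= z `^ q <= 1.
  by move=> q0; rewrite powR_ge0 -(powRr0 z); apply: ler_powR => //; exact: ltW.
have v01 := pw (- s) ltac:(lra).
have w01 := pw (- s - 1) ltac:(lra); have x01 := pw (- s - 2) ltac:(lra).
rewrite /f1 /f2 /p1 /p2 /f; move: (z `^ (- s)) (z `^ (- s - 1)) (z `^ (- s - 2)) v01 w01 x01.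
move=> v w x /andP[v0 v1] /andP[w0 w1] /andP[x0 x1].
have Nv : 0 <= N - v by lra.
have N2 : 0 < N ^+ 2 by exact: exprn_gt0.
have Nv1 : 0 <= (N - v) ^+ 2 / N ^+ 2 <= 1.
  apply/andP; split; first by rewrite divr_ge0 ?sqr_ge0// ltW.
  by rewrite ler_pdivrMr// mul1r lerXn2r ?nnegrE//; lra.
have Nv2 : 0 <= 2 * (N - v) / N ^+ 2 <= 2.
  apply/andP; split; first by rewrite divr_ge0 ?mulr_ge0// ltW.
  by rewrite ler_pdivrMr// ler_pM2l// expr2; nra.
have Nv3 : 0 <= (N ^+ 3 - (N - v) ^+ 3) / (3 * N ^+ 2) <= N.
  have N3 : 0 < 3 * N ^+ 2 by rewrite mulr_gt0.
  have le3 : (N - v) ^+ 3 <= N ^+ 3 by rewrite lerXn2r ?nnegrE//; lra.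
  have ge3 := exprn_ge0 3 Nv.
  apply/andP; split; first by rewrite divr_ge0 ?subr_ge0// ltW.
  by rewrite ler_pdivrMr// !exprS expr0 in ge3 le3 *; nra.
rewrite /cap_fun /cap_fun1 /cap_fun2 (pos3_ge0 Nv) (max_l Nv).
move: Nv1 Nv2 Nv3; move: (_ / N ^+ 2) (_ / N ^+ 2) (_ / (3 * N ^+ 2)) => B A D.
move=> /andP[A0 A1] /andP[B0 B1] /andP[D0 D1].
have ss : 0 <= s ^+ 2 by exact: sqr_ge0.
have s1 : 0 <= s * (s + 1) by apply: mulr_ge0; lra.
have sw : 0 <= s * w <= s by apply/andP; split; nra.
rewrite /jet_le; split.
- by rewrite ger0_norm//; lra.
- rewrite normrM (ger0_norm A0) normrM normrN (gtr0_norm s0) (ger0_norm w0).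
  case/andP: sw => sw0 sw1; have : A * (s * w) <= 1 * s by exact: ler_pM.
  have := N0; lra.
- rewrite (_ : - s * (- s - 1) * x = s * (s + 1) * x); last by ring.
  rewrite (_ : - B * (- s * w) ^+ 2 = - (B * (s * w) ^+ 2)); last by ring.
  case/andP: sw => sw0 sw1.
  have sw2 : (s * w) ^+ 2 <= s ^+ 2 by rewrite lerXn2r ?nnegrE// ltW.
  have h1 : B * (s * w) ^+ 2 <= 2 * s ^+ 2 by apply: ler_pM => //; exact: sqr_ge0.
  have sx : s * (s + 1) * x <= s * (s + 1) by rewrite ler_piMr.
  have sx0 : 0 <= s * (s + 1) * x by exact: mulr_ge0.
  have h2 : A * (s * (s + 1) * x) <= 1 * (s * (s + 1)) by exact: ler_pM.
  have h3 : 0 <= B * (s * w) ^+ 2 by apply: mulr_ge0 => //; exact: sqr_ge0.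
  have h4 := mulr_ge0 A0 sx0.
  by rewrite ler_norml; apply/andP; split; lra.
Qed.

Variable nu : R -> borel_measure R.
Hypothesis nuM : forall t, 0 <= t -> has_flow_moments beta a b K omega 1 t (nu t).

(** The mean of the cap never exceeds its initial value, which is at most 1, while the cap equals N
    / 3 at the origin: an atom of mass m satisfies m N / 3 <= 1 for every N >= 1. *)
Lemma no_atom_one t : 0 <= t -> nu t [set 0] = 0%E.
Proof.
move=> t0; have s0 := s_gt0.
have nuP := flow_mass (nuM t0).
have mP : measurable (`[0, +oo[%classic : set (measurableTypeR R)) by exact: measurable_itv.
have m0 : measurable ([set 0] : set (measurableTypeR R)) by exact: measurable_set1.
have sub : [set 0 : measurableTypeR R] `<=` `[0, +oo[%classic.
  by move=> z ->; rewrite /= in_itv/= lexx.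
have fin : nu t [set 0] \is a fin_num.
  rewrite ge0_fin_numE ?measure_ge0// (@le_lt_trans _ _ (nu t `[0, +oo[%classic))//; last by rewrite nuP ltry.
  by apply: le_measure; rewrite ?inE.
suff key N : 1 <= N -> fine (nu t [set 0]) * (N / 3) <= 1.
  rewrite -(fineK fin); congr EFin; apply/eqP; rewrite eq_le fine_ge0 ?measure_ge0// andbT.
  rewrite leNgt; apply/negP => m_gt0; set m := fine _ in key m_gt0.
  (* For this N the left-hand side is 2 + m / 3, which exceeds 1. *)
  have := key (1 + 6 / m); rewrite lerDl divr_ge0 ?(ltW m_gt0)// => /(_ isT).
  rewrite (_ : m * _ = 2 + m / 3); first by lra.
  by field; rewrite gt_eqF.
move=> N1; have N0 : 0 < N by lra.
have [g1 [g2 [S]]] := cap_jet N1; set g := extend _ _ => -[gC gS g10].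
have z01 : 0 <= (1 : R) <= 1 by rewrite ler01 lexx.
have [evi evm [B evB] evE] := evolution beta_gt0 a_ge0 K_fin omega_ge0 dom_omega kap_omega kap_gt0 z01 nuM gC gS t0 gC.
have tt : 0 <= t <= t by rewrite t0 lexx.
have [gi _] := evi t tt.
have vz z : 0 < z -> g z = cap_fun N (z `^ (- s)) by rewrite /g /extend => ->.
have G_le0 z : 0 <= z -> genG g g1 g2 z <= 0.
  rewrite le_eqVlt => /predU1P[<-|z0]; first by rewrite /(genG _ _) lexx g10 mulr0.
  pose w := z `^ (- s).
  apply: (@genG_tangent_le0 _ _ _ _ (cap_fun N w - cap_fun1 N w * w) (cap_fun1 N w)) => //.
  - by rewrite divr_ge0 ?sqr_ge0// exprn_ge0// ltW.
  - by move=> u u0; rewrite vz//; have := cap_fun_tangent (u `^ (- s)) w N0; lra.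
  - by rewrite vz// -/w subrK.
have cap0 v : 0 <= v -> 0 <= cap_fun N v.
  move=> v0; rewrite /cap_fun divr_ge0//; last by rewrite mulr_ge0// exprn_ge0// ltW.
  have [Nv|Nv] := leP (N - v) 0; first by rewrite pos3_le0// subr0 exprn_ge0// ltW.
  rewrite (pos3_ge0 (ltW Nv)) subr_ge0 lerXn2r ?nnegrE ?(ltW Nv) ?(ltW N0)//; lra.
have mean_le : mean nu t g <= 1.
  rewrite (evE t tt) vz// powR1.
  have -> : 1 = 1 + 0 :> R by rewrite addr0.
  apply: lerD.
    rewrite /cap_fun pos3_ge0; last lra.
    rewrite ler_pdivrMr ?mulr_gt0 ?exprn_gt0//.
    by have := sqr_ge0 (N - 1); rewrite !exprS expr0; nra.
  apply: Rintegral_le0.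
  - exact: measurable_itv.
  - exact: bounded_integrable evm evB tt.
  move=> q; rewrite /= in_itv/= => /andP[q0 qt].
  have [_ Gi] := evi q ltac:(by rewrite q0 qt).
  by apply: (Rintegral_le0 mP Gi) => z; rewrite /= in_itv/= andbT; exact: G_le0.
have ind_le z : 0 <= z -> N / 3 * (\1_[set 0] z : R) <= g z.
  rewrite indicE le_eqVlt => /predU1P[<-|z0].
    by rewrite mem_set// mulr1 /g /extend ltxx.
  by rewrite memNset ?mulr0 ?vz ?cap0 ?powR_ge0//= => zE; rewrite zE ltxx in z0.
have N3 : 0 < N / 3 by rewrite divr_gt0.
have ii : (nu t).-integrable (`[0, +oo[%classic : set (measurableTypeR R)) (fun z => (\1_[set 0] z : R)%:E).
  apply: (le_integrable_EFin mP _ (integrableZl_EFin mP (N / 3)^-1 gi)).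
    exact: measurable_indic.
  move=> z; rewrite /= in_itv/= andbT => z0.
  by rewrite ger0_norm ?indicE// -indicE ler_pdivlMl// ind_le.
have -> : fine (nu t [set 0]) * (N / 3) = \int[nu t]_(z in `[0, +oo[) (N / 3 * (\1_[set 0] z : R)).
  by rewrite RintegralZl// /Rintegral integral_indic// setIidl// mulrC.
apply: le_trans mean_le; apply: le_Rintegral => //; first exact: integrableZl_EFin.
by move=> z; rewrite /= in_itv/= andbT; exact: ind_le.
Qed.

End no_atom_one.

Section no_atom_zero.
Context {R : realType}.
Variables (beta a b : R) (K : borel_measure R) (omega : R).
Hypothesis beta_gt0 : 0 < beta.
Hypothesis a_ge0 : 0 <= a.
Hypothesis K_fin : (\int[K]_(y in `[(2^-1)%R, 1%R[) ((1 - y) ^+ 2)%:E < +oo)%E.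
Hypothesis omega_ge0 : 0 <= omega.
Hypothesis dom_omega : dom K omega.
Hypothesis kap_omega : kap a b K omega = 0.
Hypothesis kap_gt0 : forall q, omega < q -> 0 < kap a b K q.
Implicit Types (t z : R).

Local Notation T := (measurableTypeR R).
Local Notation P := (`[0, +oo[%classic : set T).
Local Notation coefG := (coefG beta a b K omega).
Local Notation genG := (genG beta a b K omega).
Local Notation leb := (@lebesgue_measure R).
Local Notation has_flow_moments := (has_flow_moments beta a b K omega 0).
Local Notation flow := (flow beta a b K omega 0).

Lemma flow0_Xn t k : flow t 'X^k = t ^+ k / k`!%:R * \prod_(1 <= j < k.+1) coefG j.
Proof.
rewrite /(flow _ _) expG_Xn horner_sum big_ord_recr/= subnn hornerZ expr0 hornerC mulr1.
rewrite big1 ?add0r// => -[l lk] _ /=.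
by rewrite hornerZ hornerXn expr0n subn_eq0 leqNgt lk/= mulr0.
Qed.

Variable nu : R -> borel_measure R.
Hypothesis nuM : forall t, 0 <= t -> has_flow_moments t (nu t).

Let zero01 : 0 <= (0 : R) <= 1. Proof. by rewrite lexx ler01. Qed.
Let mP : measurable P. Proof. exact: measurable_itv. Qed.

(* Self-similarity: [nu t] is the image of [nu 1] under [z |-> t z]. *)
Lemma flow0_atom t : 0 < t -> nu t [set 0] = nu 1 [set 0].
Proof.
move=> t0; have nuM1 := nuM ler01.
have mphi : measurable_fun setT ((fun z => t * z) : T -> T).
  by apply: continuous_measurable_fun => z; exact: mulrl_continuous.
have [M HM] := exists_weighted_image (nu 1) mP (measurable_cst (1 : R)) (fun=> ler01) mphi.
have indM A : measurable A -> M A = nu 1 (((fun z => t * z) @^-1` A) `&` P).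
  move=> mA; have mA' : measurable ((fun z => t * z) @^-1` A : set T).
    by rewrite -[_ @^-1` _]setTI; exact: mphi.
  have -> : M A = (\int[M]_y (\1_A y : R)%:E)%E by rewrite integral_indic// setIT.
  rewrite HM; last 2 first.
  - by apply/measurable_EFinP; exact: measurable_indic.
  - by move=> y; rewrite lee_fin.
  by rewrite -integral_indic//; apply: eq_integral => z _; rewrite mul1e !indicE.
have m0 : measurable ([set 0] : set T) by exact: measurable_set1.
have MM : has_flow_moments t M.
  split.
    rewrite indM; last exact: measurable_itv.
    rewrite (_ : _ `&` _ = set0) ?measure0//; apply/seteqP; split => // z [] /=.
    rewrite !in_itv/= andbT => tz z0; have := mulr_ge0 (ltW t0) z0.
    by rewrite leNgt tz.
  move=> k; have PP x : P x -> P (t * x).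
    by rewrite /= !in_itv/= !andbT => x0; rewrite mulr_ge0// ltW.
  have mX : measurable_fun P (fun z : T => z ^+ k : R) by exact: measurable_funTS.
  have [-> _] := weighted_image_funcs HM (fun=> ler01) mP PP mX.
  under eq_integral do rewrite mul1r exprMn EFinM.
  rewrite ge0_integralZl_EFin//; last 3 first.
  - by move=> z; rewrite /= in_itv/= andbT => z0; rewrite lee_fin exprn_ge0.
  - by apply/measurable_EFinP; exact: measurable_funTS.
  - by rewrite exprn_ge0// ltW.
  have [_ ->] := nuM1; rewrite -EFinM; congr EFin.
  by rewrite !flow0_Xn expr1n; ring.
rewrite (flow_measure_unique beta_gt0 a_ge0 K_fin omega_ge0 dom_omega kap_gt0 zero01 (ltW t0) (nuM (ltW t0)) MM m0).
rewrite indM//; congr (nu 1 _); apply/seteqP; split => z /=.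
  by move=> [/eqP]; rewrite mulf_eq0 gt_eqF//= => /eqP.
by move=> ->; rewrite mulr0 in_itv/= lexx.
Qed.

(** Divided by n, G (exp (- n z)) is - [c1] at 0, tends to 0 elsewhere and stays bounded, so its
    mean tends to - [c1] times the atom. By the evolution equation the time integral of these means
    is a bounded increment divided by n, so the constant atom must be 0. *)
Lemma no_atom_zero t : 0 < t -> nu t [set 0] = 0%E.
Proof.
move=> t0; rewrite flow0_atom//; have m0 : measurable ([set 0] : set T) by exact: measurable_set1.
have subP : [set 0 : T] `<=` P by move=> z ->; rewrite /= in_itv/= lexx.
have fin s : 0 <= s -> nu s [set 0] \is a fin_num.
  move=> s0; rewrite ge0_fin_numE ?measure_ge0// (@le_lt_trans _ _ (nu s P))//; last first.
    by rewrite (flow_mass (nuM s0)) ltry.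
  by apply: le_measure; rewrite ?inE.
set m := fine (nu 1 [set 0]).
suff m00 : m = 0 by rewrite -(fineK (fin 1 ler01)) -/m m00.
pose c1 := coefG 1; have c1_gt0 : 0 < c1 by exact: coefG_gt0.
pose e n : R -> R := expm 1 n.+1; pose e1 n z : R := - (n.+1%:R * 1) * e n z.
pose e2 n z : R := (n.+1%:R * 1) ^+ 2 * e n z.
have eC n : C2 (e n) (e1 n) (e2 n) by exact: C2_expm.
have eJ n (z : R) : 0 <= z -> jet_le (e n z) (e1 n z) (e2 n z) ((1 + n.+1%:R * 1) ^+ 2).
  by move=> z0; exact: (expm_jet_le ltr01 n.+1 z0).
have ee n := evolution beta_gt0 a_ge0 K_fin omega_ge0 dom_omega kap_omega kap_gt0 zero01 nuM
  (eC n) (eJ n) ler01 (eC n).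
pose k n : R := n.+1%:R; have k0 n : 0 < k n by rewrite ltr0n.
pose hh n z := (k n)^-1 * genG (e n) (e1 n) (e2 n) z.
have ule n u : 0 <= u -> k n * u * e n u <= 1.
  move=> u0; rewrite /e /expm mulr1 expRN ler_pdivrMr ?expR_gt0// mul1r.
  by have := expR_ge1Dx (k n * u); rewrite /k; lra.
have u2le n u : 0 <= u -> (k n * u) ^+ 2 * e n u <= 2.
  move=> u0; rewrite /e /expm mulr1 expRN ler_pdivrMr ?expR_gt0//.
  have := @expR_ge1Dxn R (k n * u) 1 (mulr_ge0 (ltW (k0 n)) u0).
  rewrite (_ : 2`! = 2%N)//= /k => H.
  by lra.
have en0 n u : 0 < e n u by exact: expm_gt0.
have en1 n u : 0 <= u -> e n u <= 1 by exact: (expm_le1 ltr01).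
have [C C0 HC] := genG_bound beta_gt0 a_ge0 K_fin omega_ge0 dom_omega kap_omega.
have [D D0 HD] := genG_decay b beta_gt0 a_ge0 K_fin omega_ge0 dom_omega.
have hC n z : 0 <= z -> `|hh n z| <= C * expR (0 * z).
  move=> z0; rewrite mul0r expR0 mulr1 /hh normrM gtr0_norm ?invr_gt0// ler_pdivrMl// mulrC.
  apply: HC => // u /andP[u0 uz]; have e0 := en0 n u; have l1 := en1 n u u0.
  rewrite /e1 /e2 mulr1 -/(k n); split.
    by rewrite normrM normrN (gtr0_norm (k0 n)) (gtr0_norm e0) ler_piMr// ltW.
  rewrite (_ : u * _ = k n * (k n * u * e n u)); last by ring.
  have ue : 0 <= k n * u * e n u by rewrite !mulr_ge0// ltW.
  by rewrite normrM (gtr0_norm (k0 n)) (ger0_norm ue) ler_piMr ?ule// ltW.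
have hlim z : 0 <= z -> hh n z @[n --> \oo] --> - c1 * (\1_[set 0] z : R).
  rewrite le_eqVlt => /predU1P[<-|z0].
    apply: cvg_near_cst; apply: nearW => n; rewrite indicE mem_set// /hh /(genG _ _) lexx mulr1.
    have -> : kap a b K (omega + beta) = c1 by rewrite /c1 /(coefG _) mulr1.
    have -> : e1 n 0 = - k n by rewrite /e1 /e /expm mulr0 oppr0 expR0 !mulr1.
    by field; rewrite gt_eqF.
  rewrite indicE memNset ?mulr0; last by move=> zE; rewrite zE ltxx in z0.
  have dec n : `|hh n z| <= D * 2 / z * (n.+1%:R)^-1.
    rewrite /hh normrM gtr0_norm ?invr_gt0// mulrC ler_wpM2r ?invr_ge0//.
    apply: HD => // u /andP[u0 _]; have ee0 := en0 n u; have l1 := en1 n u (ltW u0).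
    rewrite /e1 /e2 mulr1 -/(k n); split.
    - by rewrite gtr0_norm//; lra.
    - rewrite (_ : u * _ = - (k n * u * e n u)); last by ring.
      have := ule n u (ltW u0); have ue : 0 <= k n * u * e n u by rewrite !mulr_ge0// ltW.
      by rewrite normrN ger0_norm//; lra.
    - rewrite (_ : u ^+ 2 * _ = (k n * u) ^+ 2 * e n u); last by ring.
      by rewrite ger0_norm ?u2le ?(ltW u0)//; apply: mulr_ge0; [exact: sqr_ge0|exact: ltW].
  apply: norm_cvg0; apply: (@squeeze_cvgr _ _ _ _ (fun=> 0) (fun n => D * 2 / z * (n.+1%:R)^-1)).
  - by apply: nearW => n; rewrite normr_ge0 dec.
  - exact: cvg_cst.
  - by rewrite -[X in _ --> X](mulr0 (D * 2 / z)); apply: cvgM; [exact: cvg_cst|exact: cvg_harmonic].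
(* The exponential moment at rate 0: for a probability, constants suffice as dominating
   functions. *)
have mass (s : R) : 0 <= s -> (\int[nu s]_(z in P) (expR (0 * z))%:E <= 2%:E)%E.
  move=> s0; under eq_integral do rewrite mul0r expR0.
  by rewrite integral_cst// mul1e (flow_mass (nuM s0)) lee_fin; lra.
have Gi n (s : R) : 0 <= s <= 1 -> (nu s).-integrable P (fun z => (genG (e n) (e1 n) (e2 n) z)%:E).
  by move=> s01; have [/(_ s s01)[]] := ee n.
have mh n (s : R) : 0 <= s <= 1 -> measurable_fun P (hh n : T -> R).
  move=> s01; have := integrableZl_EFin mP (k n)^-1 (Gi n s s01).
  exact: measurable_fun_EFin_integrable.
have mean_h n (s : R) : 0 <= s <= 1 -> mean nu s (hh n) = (k n)^-1 * mean nu s (genG (e n) (e1 n) (e2 n)).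
  by move=> s01; rewrite /mean RintegralZl//; exact: Gi.
have m01 : measurable (`[0, 1]%classic : set T) by exact: measurable_itv.
have lim1 (s : R) : 0 <= s <= 1 -> mean nu s (hh n) @[n --> \oo] --> - c1 * fine (nu s [set 0]).
  move=> s01; have s0 : 0 <= s by case/andP: s01.
  have [_ _] := exp_dominated_cvg (mass s s0) (fun n => mh n s s01) hC hlim.
  have -> : \int[nu s]_(z in P) (- c1 * (\1_[set 0] z : R)) = - c1 * fine (nu s [set 0]).
    rewrite RintegralZl//; first by rewrite /Rintegral integral_indic// setIidl.
    apply: (le_integrable_EFin mP _ (integrable_expR (mass s s0))); first exact: measurable_indic.
    by move=> z _; rewrite mul0r expR0 indicE ger0_norm// lern1 leq_b1.
  by [].
have bd n (s : R) : 0 <= s <= 1 -> `|mean nu s (hh n)| <= C * 2.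
  move=> s01; have s0 : 0 <= s by case/andP: s01.
  by have [] := exp_dominated (mass s s0) (mh n s s01) C0 (hC n).
have [||||mm mi c2] := @Rintegral_dominated_cvg _ T R leb `[0, 1]%classic
    (fun n s => mean nu s (hh n)) (fun s => - c1 * fine (nu s [set 0])) (fun=> C * 2) m01.
- move=> n; have [_ mG _ _] := ee n.
  apply: (@eq_measurable_fun _ _ _ _ _ (fun s => (k n)^-1 * mean nu s (genG (e n) (e1 n) (e2 n)))).
    by move=> s; rewrite inE/= in_itv/= => s01; rewrite mean_h.
  by apply: measurable_funM; [exact: measurable_cst|exact: mG].
- apply: (@bounded_integrable R 1 _ (C * 2)) => [|s _|]; first exact: measurable_cst.
    by rewrite ger0_norm// mulr_ge0.
  by rewrite ler01 lexx.
- by move=> s; rewrite /= in_itv/=; exact: lim1.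
- by move=> n s; rewrite /= in_itv/=; exact: bd.
have I0 : \int[leb]_(s in `[0, 1]) (- c1 * fine (nu s [set 0])) = 0.
  have E n : \int[leb]_(s in `[0, 1]) mean nu s (hh n) = (k n)^-1 * (mean nu 1 (e n) - 1).
    have [_ mG [B bG] eG] := ee n; have i01 : 0 <= (1 : R) <= 1 by rewrite ler01 lexx.
    have e00 : e n 0 = 1 by rewrite /e /expm mulr0 oppr0 expR0.
    rewrite eG// e00 addrAC subrr add0r.
    rewrite -RintegralZl//; last exact: bounded_integrable mG bG i01.
    by apply: eq_Rintegral => s; rewrite inE/= in_itv/=; exact: mean_h.
  have EE : (fun n => \int[leb]_(s in `[0, 1]) mean nu s (hh n)) = (fun n => (k n)^-1 * (mean nu 1 (e n) - 1)).
    exact/funext.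
  rewrite EE in c2; suff c0 : (k n)^-1 * (mean nu 1 (e n) - 1) @[n --> \oo] --> (0 : R).
    exact: (cvg_unique _ c2 c0).
  apply: norm_cvg0; apply: (@squeeze_cvgr _ _ _ _ (fun=> 0) (fun n => 3 * (n.+1%:R)^-1)).
  - apply: nearW => n; rewrite normr_ge0/= normrM gtr0_norm ?invr_gt0// mulrC ler_wpM2r ?invr_ge0//.
    have me : measurable_fun P (e n : T -> R).
      by have [c _ _] := C2_continuous (eC n); exact: measurable_funTS (continuous_measurable_fun c).
    have [|_ Hm] := exp_dominated (mass 1 ler01) me ler01.
      by move=> z z0; rewrite mul0r expR0 mulr1 gtr0_norm// en1.
    by move: Hm; rewrite /mean mul1r !ler_norml; lra.
  - exact: cvg_cst.
  - by rewrite -[X in _ --> X](mulr0 3); apply: cvgM; [exact: cvg_cst|exact: cvg_harmonic].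
(* At time 0 the whole mass sits at 0, so the atom is constant for s > 0 only; the integral does not
   see the excluded time. *)
have EI : \int[leb]_(s in `]0, 1]) (- c1 * fine (nu s [set 0])) = - c1 * m.
  have -> : \int[leb]_(s in `]0, 1]) (- c1 * fine (nu s [set 0])) = \int[leb]_(s in `]0, 1]) (- c1 * m).
    by apply: eq_Rintegral => s; rewrite inE/= in_itv/= => /andP[s0 _]; rewrite flow0_atom.
  rewrite Rintegral_cst//.
  have L1 : leb (`]0, 1]%classic : set R) = 1%E.
    have := @lebesgue_measure_itv R `]0, 1]; rewrite /= lte_fin ltr01 -EFinB subr0; exact.
  by rewrite (_ : fine _ = 1) ?mulr1//; exact: (congr1 fine L1).
move: I0; rewrite -Rintegral_itv_obnd_cbnd; last first.
  apply: integrableS mi => //.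
  by move=> s /=; rewrite !in_itv/= => /andP[/ltW -> ->].
rewrite EI => /eqP; rewrite mulf_eq0 oppr_eq0 gt_eqF//= => /eqP.
by [].
Qed.

End no_atom_zero.

(** * Back to measures on the open half-line *)

Section tilted_measures.
Context {R : realType}.
Variables (beta a b : R) (K : borel_measure R) (omega : R).
Hypothesis beta_gt0 : 0 < beta.
Hypothesis a_ge0 : 0 <= a.
Hypothesis K_fin : (\int[K]_(y in `[(2^-1)%R, 1%R[) ((1 - y) ^+ 2)%:E < +oo)%E.
Hypothesis omega_ge0 : 0 <= omega.
Hypothesis dom_omega : dom K omega.
Hypothesis kap_omega : kap a b K omega = 0.
Hypothesis kap_gt0 : forall q, omega < q -> 0 < kap a b K q.
Implicit Types (t x z : R) (nu mu : borel_measure R).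

Local Notation T := (measurableTypeR R).
Local Notation P := (`[0, +oo[%classic : set T).
Local Notation Q := (`]0, +oo[%classic : set T).
Local Notation coefG := (coefG beta a b K omega).

Let mP : measurable P. Proof. exact: measurable_itv. Qed.
Let mQ : measurable Q. Proof. exact: measurable_itv. Qed.
Let Q_gt0 x : Q x = (0 < x) :> Prop. Proof. by rewrite /= in_itv/= andbT. Qed.
Let P_ge0 x : P x = (0 <= x) :> Prop. Proof. by rewrite /= in_itv/= andbT. Qed.

(* [mu] is carried by [Q] and its image by [x |-> x `^ beta] is [nu] with density
   [z `^ (- omega / beta)] there. *)
Definition is_tilt nu mu := forall f : T -> \bar R, measurable_fun setT f ->
  (forall y, 0 <= f y)%E ->
  (\int[mu]_y f y = \int[nu]_(z in Q) ((z `^ (- (omega / beta)))%:E * f (z `^ beta^-1)%R))%E.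

Definition is_untilt mu nu := forall f : T -> \bar R, measurable_fun setT f ->
  (forall y, 0 <= f y)%E ->
  (\int[nu]_y f y = \int[mu]_(x in Q) ((x `^ omega)%:E * f (x `^ beta)%R))%E.

Lemma exists_tilt nu : exists mu, is_tilt nu mu.
Proof.
exact: (exists_weighted_image nu mQ (measurable_powR _) (fun=> powR_ge0 _ _) (measurable_powR _)).
Qed.

Lemma exists_untilt mu : exists nu, is_untilt mu nu.
Proof.
exact: (exists_weighted_image mu mQ (measurable_powR _) (fun=> powR_ge0 _ _) (measurable_powR _)).
Qed.

Lemma powR_betaK x : 0 < x -> (x `^ beta) `^ beta^-1 = x.
Proof. by move=> x0; rewrite -powRrM mulfV ?gt_eqF// powRr1// ltW. Qed.

Lemma powR_betaVK z : 0 < z -> (z `^ beta^-1) `^ beta = z.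
Proof. by move=> z0; rewrite -powRrM mulVf ?gt_eqF// powRr1// ltW. Qed.

Lemma powR_tiltK z : 0 < z -> z `^ (- (omega / beta)) * (z `^ beta^-1) `^ omega = 1.
Proof.
move=> z0; rewrite -powRrM -powRD_gt0// (_ : _ + _ = 0) ?powRr0//.
by rewrite mulrC addNr.
Qed.

Lemma powR_untiltK x : 0 < x -> x `^ omega * (x `^ beta) `^ (- (omega / beta)) = 1.
Proof.
move=> x0; rewrite -powRrM -powRD_gt0// (_ : _ + _ = 0) ?powRr0//.
by field; rewrite gt_eqF.
Qed.

Lemma integral_PQ nu (f : R -> R) : f 0 = 0 ->
  (\int[nu]_(z in P) (f z)%:E = \int[nu]_(z in Q) (f z)%:E)%E.
Proof.
move=> f0; rewrite [LHS]integral_mkcond [RHS]integral_mkcond; apply: eq_integral => z _.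
rewrite !patchE; have [->|z0] := eqVneq z 0.
  by rewrite f0; do 2 case: ifP.
congr (if _ then _ else _); apply/idP/idP => /set_mem H; apply/mem_set; move: H.
  by rewrite P_ge0 Q_gt0 lt_neqAle eq_sym z0.
by rewrite P_ge0 Q_gt0 => /ltW.
Qed.

Lemma tilt_funcs nu mu (f : T -> R) : is_tilt nu mu -> measurable_fun Q f ->
  (\int[mu]_(x in Q) (f x)%:E = \int[nu]_(z in Q) (z `^ (- (omega / beta)) * f (z `^ beta^-1))%:E)%E /\
  (\int[mu]_(x in Q) `|(f x)%:E| = \int[nu]_(z in Q) `|(z `^ (- (omega / beta)) * f (z `^ beta^-1))%:E|)%E.
Proof.
move=> tl mf; apply: (weighted_image_funcs tl) => //; first by move=> x; exact: powR_ge0.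
by move=> x; rewrite !Q_gt0 => x0; exact: powR_gt0.
Qed.

Lemma tilt_carried nu mu : is_tilt nu mu -> carried_by Q mu.
Proof.
move=> tl; have mC : measurable (~` Q) by exact: measurableC.
rewrite /carried_by; have -> : mu (~` Q) = (\int[mu]_x (\1_(~` Q) x : R)%:E)%E.
  by rewrite integral_indic// setIT.
rewrite tl; last 2 first.
- by apply/measurable_EFinP; exact: measurable_indic.
- by move=> y; rewrite lee_fin.
apply: integral0_eq => z; rewrite Q_gt0 => z0.
by rewrite indicE memNset ?mule0//; apply; rewrite Q_gt0 powR_gt0.
Qed.

Lemma tilt_pairing nu mu k : is_tilt nu mu ->
  pairing mu (h (omega + beta * k%:R)) = (\int[nu]_(z in Q) (z ^+ k)%:E)%E.
Proof.
move=> tl; rewrite /pairing.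
have [-> _] := tilt_funcs tl (measurable_funTS (measurable_powR (omega + beta * k%:R))).
apply: eq_integral => z /set_mem; rewrite Q_gt0 => z0; rewrite /h powRD_gt0 ?powR_gt0//.
by rewrite mulrA powR_tiltK// mul1r -powRrM mulrA mulVf ?gt_eqF// mul1r powR_mulrn// ltW.
Qed.

Lemma untilt_moments mu nu z0 t : is_untilt mu nu ->
  (forall k, pairing mu (h (omega + beta * k%:R)) = (flow beta a b K omega z0 t 'X^k)%:E) ->
  has_flow_moments beta a b K omega z0 t nu.
Proof.
move=> ut mom; split.
  have mN : measurable (`]-oo, 0[%classic : set T) by exact: measurable_itv.
  have -> : nu `]-oo, 0[%classic = (\int[nu]_x (\1_(`]-oo, 0[%classic) x : R)%:E)%E.
    by rewrite integral_indic// setIT.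
  rewrite ut; last 2 first.
  - by apply/measurable_EFinP; exact: measurable_indic.
  - by move=> y; rewrite lee_fin.
  apply: integral0_eq => x _.
  by rewrite indicE memNset ?mule0//= in_itv/= ltNge powR_ge0.
move=> k; rewrite -mom /pairing.
have mX : measurable_fun P (fun z : T => z ^+ k : R) by exact: measurable_funTS.
have QP x : Q x -> P (x `^ beta) by move=> _; rewrite P_ge0 powR_ge0.
have [-> _] := weighted_image_funcs ut (fun=> powR_ge0 _ _) mP QP mX.
apply: eq_integral => x /set_mem; rewrite Q_gt0 => x0; congr EFin.
by rewrite /h -powR_mulrn ?powR_ge0// -powRrM -powRD_gt0.
Qed.

Lemma untilt_measureE mu nu (A : set T) : is_untilt mu nu -> carried_by Q mu -> measurable A ->
  mu A = (\int[nu]_z (z `^ (- (omega / beta)) * \1_A (z `^ beta^-1) * \1_Q z)%:E)%E.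
Proof.
move=> ut cmu mA; have mC : measurable (~` Q) by exact: measurableC.
have -> : mu A = mu (A `&` Q).
  rewrite -[in LHS](setIT A) -(setUv Q) setIUr measureU; last 3 first.
  - exact: measurableI.
  - exact: measurableI.
  - by rewrite setIACA setICr setI0.
  rewrite [X in (_ + X)%E](_ : _ = 0%E) ?adde0//.
  by apply: (subset_measure0 _ mC _ cmu); [exact: measurableI|exact: subIsetr].
rewrite ut; last 2 first.
- apply/measurable_EFinP; apply: measurable_funM; last exact: measurable_indic.
  apply: measurable_funM; first exact: measurable_powR.
  by apply: (measurableT_comp _ (measurable_powR _)); exact: measurable_indic.
- by move=> y; rewrite lee_fin !mulr_ge0// powR_ge0.
rewrite -integral_indic//; apply: eq_integral => x /set_mem; rewrite Q_gt0 => x0.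
rewrite -EFinM !mulrA powR_untiltK// mul1r powR_betaK// [\1_Q _]indicE mem_set ?mulr1//.
by rewrite Q_gt0 powR_gt0.
Qed.

(** Undoing the tilt gives two measures with the same flow moments, hence equal, and
    [untilt_measureE] recovers the original measures from them. *)
Lemma tilt_unique mu mu' z0 t : 0 <= z0 <= 1 -> 0 <= t -> carried_by Q mu -> carried_by Q mu' ->
  (forall k, pairing mu (h (omega + beta * k%:R)) = (flow beta a b K omega z0 t 'X^k)%:E) ->
  (forall k, pairing mu' (h (omega + beta * k%:R)) = (flow beta a b K omega z0 t 'X^k)%:E) ->
  measure_eq mu mu'.
Proof.
move=> z01 t0 cmu cmu' mom mom' A mA.
have [nu ut] := exists_untilt mu; have [nu' ut'] := exists_untilt mu'.
rewrite (untilt_measureE ut cmu mA) (untilt_measureE ut' cmu' mA).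
apply: eq_measure_integral => B mB _.
exact: (flow_measure_unique beta_gt0 a_ge0 K_fin omega_ge0 dom_omega kap_gt0 z01 t0
  (untilt_moments ut mom) (untilt_moments ut' mom')).
Qed.

(** Only an inequality, since tilting discards an atom of [nu] at 0; in this form it covers time 0
    in (ii). *)
Lemma tilt_mass nu mu z0 t : is_tilt nu mu -> has_flow_moments beta a b K omega z0 t nu ->
  (pairing mu (h omega) <= 1)%E.
Proof.
move=> tl nuM; have := tilt_pairing 0 tl; rewrite mulr0 addr0 => ->.
under eq_integral do rewrite expr0.
rewrite integral_cst// mul1e -(flow_mass nuM); apply: le_measure; rewrite ?inE//.
by move=> x; rewrite Q_gt0 P_ge0 => /ltW.
Qed.

(** For k >= 1 the integrand vanishes at 0; the absence of an atom gives the total mass, k = 0. *)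
Lemma tilt_flow_pairing nu mu z0 t k : is_tilt nu mu -> has_flow_moments beta a b K omega z0 t nu ->
  nu [set 0] = 0%E ->
  pairing mu (h (omega + beta * k%:R)) = (flow beta a b K omega z0 t 'X^k)%:E.
Proof.
move=> tl nuM n0; rewrite (tilt_pairing k tl); have [_ <-] := nuM.
case: k => [|k]; last by rewrite integral_PQ// expr0n.
under eq_integral do rewrite expr0; under [in RHS]eq_integral do rewrite expr0.
rewrite !integral_cst// !mul1e.
have -> : P = Q `|` [set 0].
  apply/seteqP; split => x /=; rewrite !in_itv/= !andbT le_eqVlt.
    by move=> /predU1P[<-|]; [right|left].
  by move=> [->|->]; rewrite ?eqxx ?orbT.
rewrite measureU//; last first.
  by apply/seteqP; split => // x []; rewrite Q_gt0 => + /= xE; rewrite xE ltxx.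
by rewrite [X in (_ = _ + X)%E]n0 adde0.
Qed.

Lemma kappa_coefG k : kappa a b K (omega - (- beta) * k%:R) = (coefG k)%:E.
Proof.
have [q0 dq] := dom_coefG beta_gt0 omega_ge0 dom_omega k.
by rewrite mulNr opprK kappa_dom.
Qed.

Lemma moment_exponent k : omega - k%:R * (- beta) = omega + beta * k%:R.
Proof. by ring. Qed.

Lemma moments_iP t mu : moments_i (- beta) a b K omega t mu <->
  forall k, pairing mu (h (omega + beta * k%:R)) = (flow beta a b K omega 1 t 'X^k)%:E.
Proof.
have E k : (1 + \sum_(1 <= l < k.+1) (\prod_((k - l).+1 <= j < k.+1) kappa a b K (omega - (- beta) * j%:R))
       * (t ^+ l / (l`!)%:R)%:E)%E = (flow beta a b K omega 1 t 'X^k)%:E.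
  rewrite /flow expG_Xn horner_sum big_ord_recl/= EFinD.
  rewrite expr0 fact0 divr1 mul1r subn0 (big_geq (leqnn k.+1)) hornerZ mul1r hornerXn expr1n.
  congr (_ + _)%E; rewrite big_add1 /= big_mkord -sumEFin; apply: eq_bigr => l _.
  rewrite (_ : (\prod_((k - l.+1).+1 <= j < k.+1) kappa a b K (omega - (- beta) * j%:R))%E =
    (\prod_((k - l.+1).+1 <= j < k.+1) coefG j)%:E).
    by rewrite -EFinM hornerZ hornerXn expr1n mulr1 mulrC.
  by rewrite -prodEFin; apply: eq_bigr => j _; rewrite kappa_coefG.
split=> [[m0 mk] [|k]|mom].
- by rewrite mulr0 addr0 m0 /flow expr0 expG1 hornerC.
- by rewrite -moment_exponent mk// E.
- split=> [|k k0]; last by rewrite moment_exponent mom E.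
  by have := mom 0%N; rewrite mulr0 addr0 /flow expr0 expG1 hornerC.
Qed.

Lemma moments_iiP t mu : moments_ii (- beta) a b K omega t mu <->
  forall k, pairing mu (h (omega + beta * k%:R)) = (flow beta a b K omega 0 t 'X^k)%:E.
Proof.
have E k : ((t ^+ k / (k`!)%:R)%:E * \prod_(1 <= j < k.+1) kappa a b K (omega - (- beta) * j%:R))%E =
    (flow beta a b K omega 0 t 'X^k)%:E.
  rewrite flow0_Xn [in RHS]EFinM (_ : (\prod_(1 <= j < k.+1) coefG j)%:E =
    (\prod_(1 <= j < k.+1) kappa a b K (omega - (- beta) * j%:R))%E)//.
  by rewrite -prodEFin; apply: eq_bigr => j _; rewrite kappa_coefG.
split=> [[m0 mk] [|k]|mom].
- by rewrite mulr0 addr0 m0 /flow expr0 expG1 hornerC.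
- by rewrite -moment_exponent mk// E.
- split=> [|k k0]; last by rewrite moment_exponent mom E.
  by have := mom 0%N; rewrite mulr0 addr0 /flow expr0 expG1 hornerC.
Qed.

Lemma tilt_locally_finite mu : carried_by Q mu -> (pairing mu (h omega) <= 1)%E -> locally_finite mu.
Proof.
move=> cmu mass C cC CQ.
have [m m0 Cm] : exists2 m, 0 < m & forall x, C x -> m <= x.
  have oC : open (~` C) by apply: closed_openC; exact: compact_closed.
  have C0 : (~` C) 0 by move=> /CQ; rewrite Q_gt0 ltxx.
  have /nbhs_ballP[e /= e0 eC] := open_nbhs_nbhs (conj oC C0).
  exists e => // x Cx; rewrite leNgt; apply/negP => xe.
  have x0 : 0 < x by rewrite -Q_gt0; exact: CQ.
  by apply: (eC x) => //; rewrite /ball/= sub0r normrN gtr0_norm.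
have mC : measurable (C : set T) by exact: compact_measurable.
have mo0 := powR_gt0 omega m0.
have -> : mu C = (\int[mu]_(x in Q) (\1_C x : R)%:E)%E.
  by rewrite integral_indic// setIidl.
apply: (@le_lt_trans _ _ (\int[mu]_(x in Q) ((m `^ omega)^-1 * x `^ omega)%:E)%E).
  apply: ge0_le_integral => //.
  - by apply/measurable_EFinP; exact: measurable_indic.
  - apply/measurable_EFinP; apply: measurable_funM => //.
    by apply: measurable_funTS; exact: measurable_powR.
  - move=> x; rewrite Q_gt0 => x0; rewrite lee_fin indicE.
    have [/set_mem Cx|_] := boolP (x \in C); last by rewrite mulr_ge0 ?powR_ge0// invr_ge0 ltW.
    rewrite ler_pdivlMl// mulr1; apply: ge0_ler_powR; rewrite ?nnegrE ?(ltW x0) ?(ltW m0)//.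
    exact: Cm.
under eq_integral do rewrite EFinM.
rewrite ge0_integralZl_EFin//; last 3 first.
- by move=> x _; rewrite lee_fin powR_ge0.
- by apply/measurable_EFinP; apply: measurable_funTS; exact: measurable_powR.
- by rewrite invr_ge0 ltW.
apply: (@le_lt_trans _ _ ((m `^ omega)^-1%:E * 1)%E); last by rewrite mule1 ltry.
by apply: lee_wpmul2l => //; rewrite lee_fin invr_ge0 ltW.
Qed.

End tilted_measures.

(** * Test functions seen in the variable z *)

Section test_functions.
Context {R : realType}.
Implicit Types (f g : R -> R) (x y z p q : R).

Lemma near_cst_is_derive f c x l : (\near x, f x = c) -> is_derive x 1 f l -> l = 0.
Proof.
move=> fc D; have D0 : is_derive x 1 f 0.
  by apply: near_eq_is_derive (is_derive_cst c x 1); apply: filterS fc => u ->.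
by rewrite -(@derive_val _ _ _ _ _ _ _ D) (@derive_val _ _ _ _ _ _ _ D0).
Qed.

Lemma C2_eventually_cst_bounded f f1 f2 c Z : C2 f f1 f2 -> (forall z, Z < z -> f z = c) ->
  exists S, forall z, 0 <= z -> jet_le (f z) (f1 z) (f2 z) S.
Proof.
move=> fC fZ; have [fd fd1 _] := fC.
have near_Z z : Z < z -> \near z, Z < z by exact: lt_nbhsr.
have f1Z z : Z < z -> f1 z = 0.
  by move=> Zz; apply: near_cst_is_derive (fd z); apply: filterS (near_Z z Zz) => u; exact: fZ.
have f2Z z : Z < z -> f2 z = 0.
  by move=> Zz; apply: near_cst_is_derive (fd1 z); apply: filterS (near_Z z Zz) => u; exact: f1Z.
have [M M0 HM] := C2_bounded Z fC.
exists (M + `|c|) => z z0; have [zZ|Zz] := leP z Z.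
  by apply: jet_le_trans (HM z _) _; rewrite ?z0 ?lerDl.
rewrite (fZ _ Zz) (f1Z _ Zz) (f2Z _ Zz) /jet_le normr0.
by split; rewrite ?lerDr ?addr_ge0.
Qed.

Lemma C2_pos_mul f f1 f2 g g1 g2 : C2_pos f f1 f2 -> C2_pos g g1 g2 ->
  C2_pos (fun z => f z * g z) (mul1 f f1 g g1) (mul2 f f1 f2 g g1 g2).
Proof.
move=> fC gC x x0; have [fd fd1] := fC x x0; have [gd gd1] := gC x x0; split.
  exact: is_derive_mul.
rewrite (_ : mul2 _ _ _ _ _ _ x = (f2 x * g x + f1 x * g1 x) + (f1 x * g1 x + f x * g2 x)).
  by apply: is_deriveD; exact: is_derive_mul.
by rewrite /mul2; ring.
Qed.

Lemma powR_continuous q x : 0 < x -> {for x, continuous (fun u => u `^ q)}.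
Proof. by move=> x0; have D := is_derive1_powR q x0; exact: is_derive_continuous D. Qed.

Lemma C2_pos_powR_comp f f1 f2 p q : C2 f f1 f2 -> exists F1 F2,
  C2_pos (fun z => z `^ q * f (z `^ p)) F1 F2 /\ forall x, 0 < x -> {for x, continuous F2}.
Proof.
move=> fC; have [fc f1c f2c] := C2_continuous fC; have [fd fd1 _] := fC.
pose E1 z := f1 (z `^ p) * (p * z `^ (p - 1)).
pose E2 z := f2 (z `^ p) * (p * z `^ (p - 1)) * (p * z `^ (p - 1)) +
  f1 (z `^ p) * (p * (p - 1) * z `^ (p - 2)).
have EC : C2_pos (fun z => f (z `^ p)) E1 E2.
  move=> z z0; have [Dp Dp1] := C2_pos_powR p z0; split.
    exact: (is_derive_comp (fd _) Dp).
  by apply: is_derive_mul => //; exact: (is_derive_comp (fd1 _) Dp).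
have FC := C2_pos_mul (C2_pos_powR q) EC.
set F1 := mul1 _ _ _ _ in FC; set F2 := mul2 _ _ _ _ _ _ in FC.
exists F1, F2; split=> // x x0.
have pc (r : R) : {for x, continuous (fun u => u `^ r)} by exact: powR_continuous.
have comp (k : R -> R) : continuous k -> {for x, continuous (fun z => k (z `^ p))}.
  by move=> kc; apply: (@continuous_comp _ _ _ (fun z => z `^ p) k); [exact: pc|exact: kc].
have cpc (c r : R) : {for x, continuous (fun z => c * z `^ r)}.
  by apply: cvgM; [exact: cvg_cst|exact: pc].
have E1c : {for x, continuous E1} by apply: cvgM; [exact: comp|exact: cpc].
have E2c : {for x, continuous E2}.
  apply: cvgD; last by apply: cvgM; [exact: comp|exact: cpc].
  by apply: cvgM; [apply: cvgM; [exact: comp|exact: cpc]|exact: cpc].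
apply: cvgD; [apply: cvgD|].
- by apply: cvgM; [exact: cpc|exact: comp].
- by apply: cvgM; [exact: cvg_cst|apply: cvgM; [exact: cpc|exact: E1c]].
- by apply: cvgM; [exact: pc|exact: E2c].
Qed.

Lemma Cc_infty_C2 f : Cc_infty f -> C2 f (derive1 f) (derive1n 2 f).
Proof.
move=> [fd _ _]; split.
- by move=> x; rewrite derive1E; apply: DeriveDef => //; exact: (fd 0%N x).
- by move=> x; rewrite /derive1n/= derive1E; apply: DeriveDef => //; exact: (fd 1%N x).
- move=> x; apply: differentiable_continuous; apply/derivable1_diffP; exact: (fd 2%N x).
Qed.

Lemma compact_pos_bounds (C : set R) : compact C -> C `<=` `]0, +oo[ ->
  exists m M, 0 < m /\ forall x, C x -> m <= x <= M.
Proof.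
move=> cC CQ.
have oC : open (~` C) by apply: closed_openC; exact: compact_closed.
have C0 : (~` C) 0 by move=> /CQ; rewrite /= in_itv/= ltxx.
have /nbhs_ballP[e /= e0 eC] := open_nbhs_nbhs (conj oC C0).
have [M [_ HM]] := compact_bounded cC.
exists e, (M + 1); split=> // x Cx; apply/andP; split.
  rewrite leNgt; apply/negP => xe.
  have x0 : 0 < x by have := CQ x Cx; rewrite /= in_itv/= andbT.
  by apply: (eC x) => //; rewrite /ball/= sub0r normrN gtr0_norm.
by apply: le_trans (ler_norm x) (HM _ _ _ Cx); rewrite ltrDl.
Qed.

End test_functions.

Section solution.
Context {R : realType}.
Variables (beta a b : R) (K : borel_measure R) (omega : R).
Hypothesis beta_gt0 : 0 < beta.
Hypothesis a_ge0 : 0 <= a.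
Hypothesis K_fin : (\int[K]_(y in `[(2^-1)%R, 1%R[) ((1 - y) ^+ 2)%:E < +oo)%E.
Hypothesis omega_ge0 : 0 <= omega.
Hypothesis dom_omega : dom K omega.
Hypothesis kap_omega : kap a b K omega = 0.
Hypothesis kap_gt0 : forall q, omega < q -> 0 < kap a b K q.

Local Notation T := (measurableTypeR R).
Local Notation P := (`[0, +oo[%classic : set T).
Local Notation Q := (`]0, +oo[%classic : set T).
Local Notation genG := (genG beta a b K omega).

(** The function whose tilt is [f]. The support of a test function stays away from 0, so this image
    vanishes near 0 and is of class C^2 on the line. *)
Definition test_image (f : R -> R) : R -> R :=
  extend (fun z => z `^ (- (omega / beta)) * f (z `^ beta^-1)) 0.

Lemma test_image_tilt f x : 0 < x -> tilt beta omega (test_image f) x = f x.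
Proof.
move=> x0; rewrite /tilt /test_image /extend powR_gt0// mulrA.
by rewrite (powR_untiltK omega beta_gt0 x0) mul1r (powR_betaK beta_gt0 x0).
Qed.

Lemma test_image_C2 f : Cc_infty f -> exists g1 g2 S,
  [/\ C2 (test_image f) g1 g2, g1 0 = 0 &
      forall z, 0 <= z -> jet_le (test_image f z) (g1 z) (g2 z) S].
Proof.
move=> fCc; have fC := Cc_infty_C2 fCc; have [_ cf fQ] := fCc.
have [m [M [m0 mM]]] := compact_pos_bounds cf fQ.
have fsupp x : ~ (m <= x <= M) -> f x = 0.
  by move=> xm; apply: contrapT => /eqP fx; apply/xm/mM; exact: subset_closure.
have [F1 [F2 [FC F2c]]] := C2_pos_powR_comp beta^-1 (- (omega / beta)) fC.
have mb := powR_gt0 beta m0; have bV : 0 < beta^-1 by rewrite invr_gt0.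
have lt_powR x y : 0 < x -> 0 < y -> x < y -> x `^ beta^-1 < y `^ beta^-1.
  by move=> x0 y0; apply: gt0_ltr_powR; rewrite ?nnegrE ?ltW.
have near0 x : 0 < x < m `^ beta -> x `^ (- (omega / beta)) * f (x `^ beta^-1) = 0.
  move=> /andP[x0 xm]; rewrite fsupp ?mulr0// => /andP[+ _].
  by have := lt_powR _ _ x0 mb xm; rewrite (powR_betaK beta_gt0 m0) ltNge => /negP.
have gC := C2_extend mb FC F2c near0.
pose Z := `|M| + 1; have Z0 : 0 < Z by rewrite ltr_wpDl.
have far z : Z `^ beta < z -> test_image f z = 0.
  move=> Zz; have z0 := lt_trans (powR_gt0 beta Z0) Zz.
  rewrite /test_image /extend z0 fsupp ?mulr0// => /andP[_].
  have := lt_powR _ _ (powR_gt0 beta Z0) z0 Zz; rewrite (powR_betaK beta_gt0 Z0) => h1 h2.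
  have := lt_le_trans h1 h2; rewrite /Z => h3; have := ler_norm M; lra.
have [S HS] := C2_eventually_cst_bounded gC far.
by exists (extend F1 0), (extend F2 0), S; split=> //; rewrite /extend ltxx.
Qed.

Lemma L_test_image f g1 g2 x : C2 (test_image f) g1 g2 -> 0 < x ->
  L (- beta) a b K f x = x `^ omega * genG (test_image f) g1 g2 (x `^ beta).
Proof.
move=> gC x0; have tC := C2_pos_tilt beta omega gC.
have fC : C2_pos f (tilt1 beta omega (test_image f) g1) (tilt2 beta omega (test_image f) g1 g2).
  move=> u u0; have [td td1] := tC u u0; split=> //.
  apply: near_eq_is_derive td; have near_u : \near u, 0 < u by exact: lt_nbhsr.
  by apply: filterS near_u => v; exact: test_image_tilt.
rewrite (L_genL (- beta) a b K fC x0) -genL_tilt//.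
by apply: genL_ext => // u u0; rewrite test_image_tilt.
Qed.

Variable z0 : R.
Hypothesis z01 : 0 <= z0 <= 1.
Variables (nu mu : R -> borel_measure R).
Hypothesis nuM : forall t, 0 <= t -> has_flow_moments beta a b K omega z0 t (nu t).
Hypothesis mu_tilt : forall t, is_tilt beta omega (nu t) (mu t).

(** The image of a test function and its [genG] both vanish at 0, so integrals against [nu t] over
    the open and the closed half-line agree even if there is an atom, as at time 0 in (ii). The
    equation of [evolution] then carries over, the two weights cancelling. *)
Lemma tilt_solves : solves (- beta) a b K mu.
Proof.
have mP : measurable P by exact: measurable_itv.
have mQ : measurable Q by exact: measurable_itv.
have Q_gt0 x : Q x = (0 < x) :> Prop by rewrite /= in_itv/= andbT.
have P_ge0 x : P x = (0 <= x) :> Prop by rewrite /= in_itv/= andbT.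
split.
  move=> t t0; have cm := tilt_carried (@mu_tilt t); split=> //.
  exact: tilt_locally_finite cm (tilt_mass beta_gt0 (@mu_tilt t) (nuM t0)).
move=> f fCc; have [g1 [g2 [S [gC g10 gS]]]] := test_image_C2 fCc.
set g := test_image f in gC gS; pose G := genG g g1 g2.
have ev (Tm : R) (T0 : 0 <= Tm) := evolution beta_gt0 a_ge0 K_fin omega_ge0 dom_omega kap_omega kap_gt0 z01 nuM gC gS T0 gC.
have evt (t : R) : 0 <= t -> (nu t).-integrable P (fun z => (g z)%:E) /\ (nu t).-integrable P (fun z => (G z)%:E).
  by move=> t0; have [/(_ t)H _ _ _] := ev t t0; apply: H; rewrite t0 lexx.
have g00 : g 0 = 0 by rewrite /g /test_image /extend ltxx.
have G00 : G 0 = 0 by rewrite /G /(genG _ _) lexx g10 mulr0.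
have meanE t (k : R -> R) : (nu t).-integrable P (fun z => (k z)%:E) -> k 0 = 0 ->
    (\int[nu t]_(z in Q) (k z)%:E = (mean nu t k)%:E)%E.
  move=> ki k0; rewrite -integral_PQ// /mean /Rintegral fineK//; exact: integrable_fin_num ki.
have mLf (t : R) : 0 <= t -> measurable_fun Q (L (- beta) a b K f : T -> R).
  move=> t0; have [_ Gi] := evt t t0.
  apply: (@eq_measurable_fun _ _ _ _ _ (fun x => x `^ omega * G (x `^ beta))).
    by move=> x /set_mem; rewrite Q_gt0 => x0; rewrite (L_test_image gC x0).
  apply: measurable_funM; first by apply: measurable_funTS; exact: measurable_powR.
  apply: (@measurable_comp _ _ _ T T R P G Q (fun x => x `^ beta)) => //.
  - by move=> _ [x _ <-]; rewrite P_ge0 powR_ge0.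
  - exact: measurable_fun_EFin_integrable Gi.
  - by apply: measurable_funTS; exact: measurable_powR.
have LG z : Q z -> z `^ (- (omega / beta)) * L (- beta) a b K f (z `^ beta^-1) = G z.
  rewrite Q_gt0 => z_gt0; rewrite (L_test_image gC) ?powR_gt0//.
  by rewrite mulrA (powR_tiltK _ _ z_gt0) mul1r (powR_betaVK beta_gt0 z_gt0).
have pairL (t : R) : 0 <= t -> pairing (mu t) (L (- beta) a b K f) = (mean nu t G)%:E.
  move=> t0; have [_ Gi] := evt t t0; rewrite /pairing.
  have [-> _] := tilt_funcs (@mu_tilt t) (mLf t t0); rewrite -meanE//.
  by apply: eq_integral => z /set_mem Qz; rewrite LG.
have [fc _ _] := C2_continuous (Cc_infty_C2 fCc).
have pairf (t : R) : 0 <= t -> pairing (mu t) f = (mean nu t g)%:E.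
  move=> t0; have [gi _] := evt t t0; rewrite /pairing.
  have mf : measurable_fun Q (f : T -> R) by exact: measurable_funTS (continuous_measurable_fun fc).
  have [-> _] := tilt_funcs (@mu_tilt t) mf; rewrite -meanE//.
  by apply: eq_integral => z /set_mem; rewrite Q_gt0 /g /test_image /extend => ->.
have Li (Tm t : R) : 0 <= t <= Tm -> (@lebesgue_measure R).-integrable `[0, t]
    (fun s => pairing (mu s) (L (- beta) a b K f)).
  move=> /andP[t0 tT]; have [_ mG [B bG] _] := ev t t0.
  have := bounded_integrable mG bG; move=> /(_ t); rewrite t0 lexx => /(_ isT).
  apply: eq_integrable => [|s]; first exact: measurable_itv.
  by rewrite inE/= in_itv/= => /andP[s0 _]; rewrite pairL.
split.
- move=> t t0; have [_ Gi] := evt t t0.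
  apply/integrableP; split; first by apply/measurable_EFinP; exact: mLf t0.
  have [_ ->] := tilt_funcs (@mu_tilt t) (mLf t t0).
  have QP : Q `<=` P by move=> x; rewrite Q_gt0 P_ge0 => /ltW.
  have /integrableP[_ lty] := integrableS mP mQ QP Gi.
  rewrite (_ : (\int[_]_(z in _) _)%E = (\int[nu t]_(z in Q) `|(G z)%:E|)%E)//.
  by apply: eq_integral => z /set_mem Qz; rewrite LG.
- by move=> Tm T0; apply: (Li Tm); rewrite T0 lexx.
- move=> t t0; rewrite (pairf t t0) (pairf 0 (lexx _)).
  have [_ mG [B bG] eG] := ev t t0.
  have tt : 0 <= t <= t by rewrite t0 lexx.
  have e0 := eG 0 ltac:(by rewrite lexx t0); rewrite set_itv1 Rintegral_set1 addr0 in e0.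
  rewrite (eG t tt) e0 EFinD; congr (_ + _)%E.
  rewrite /Rintegral fineK; last first.
    exact: integrable_fin_num (bounded_integrable mG bG tt).
  by apply: eq_integral => s; rewrite inE/= in_itv/= => /andP[s0 _]; rewrite pairL.
Qed.

End solution.

Lemma dirac_borelE (R : realType) (c : R) (A : set (measurableTypeR R)) :
  (\d_(c : measurableTypeR R) : borel_measure R) A = (c \in A)%:R%:E.
Proof. exact: diracE. Qed.

(** * The two families of measures *)

Theorem theorem4p1 (R : realType) (alpha a b : R) (K : borel_measure R)
    (alpha_lt0 : alpha < 0) (a_ge0 : 0 <= a)
    (K_carrier : carried_by `[2^-1, 1[ K)
    (K_fin : (\int[K]_(y in `[(2^-1)%R, 1%R[) ((1 - y) ^+ 2)%:E < +oo)%E)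
    (kappa_not_nonincreasing :
      ~ (forall p q : R, 0 <= p -> p <= q ->
           (kappa a b K q <= kappa a b K p)%E))
    (kappa_inf_lt0 :
      (ereal_inf [set kappa a b K q | q in `[0%R, +oo[ ] < 0)%E) :
  exists omega : R,
    [/\ unique (is_omega_plus a b K) omega,
        exists mu : R -> borel_measure R,
          [/\ forall t : R, 0 <= t ->
                the_unique_measure_on `]0, +oo[
                  (moments_i alpha a b K omega t) (mu t),
              measure_eq (mu 0) \d_(1%R : measurableTypeR R) &
              solves alpha a b K mu] &
        exists gamma : R -> borel_measure R,
          [/\ forall t : R, 0 < t ->
                the_unique_measure_on `]0, +oo[
                  (moments_ii alpha a b K omega t) (gamma t),
              measure_eq (gamma 0) mzero &
              solves alpha a b K gamma]].
Proof.
have [omega [r [r_omega dr kr [kw kw_gt0] w_unique]]] :=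
  omega_exists a_ge0 K_fin kappa_not_nonincreasing kappa_inf_lt0.
exists omega.
have /andP[r0 rw] := r_omega; have w0 : 0 <= omega by lra.
have dw : dom K omega by exact: dom_le (ltW rw) dr.
pose beta := - alpha; have b0 : 0 < beta by rewrite oppr_gt0.
have -> : alpha = - beta by rewrite opprK.
have mQ : measurable (`]0, +oo[%classic : set (measurableTypeR R)) by exact: measurable_itv.
have family (z0 : R) : 0 <= z0 <= 1 -> exists nu mu : R -> borel_measure R,
    (forall t, 0 <= t -> has_flow_moments beta a b K omega z0 t (nu t)) /\
    (forall t, is_tilt beta omega (nu t) (mu t)).
  move=> z01.
  have /choice[nu nuM] (t : R) : exists nu, 0 <= t -> has_flow_moments beta a b K omega z0 t nu.
    have [t0|t0] := leP 0 t.
      have [nu nuM] := exists_flow_measure b0 a_ge0 K_fin w0 dw kw kw_gt0 z01 t0.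
      by exists nu.
    (* A dummy value for negative times. *)
    by exists mzero.
  have /choice[mu mu_tilt] : forall t, exists mu, is_tilt beta omega (nu t) mu.
    by move=> t; exact: exists_tilt.
  by exists nu, mu.
split; first exact: w_unique.
- have one01 : 0 <= (1 : R) <= 1 by rewrite ler01 lexx.
  have [nu [mu [nuM mu_tilt]]] := family 1 one01.
  have uniq (t : R) : 0 <= t -> the_unique_measure_on `]0, +oo[ (moments_i (- beta) a b K omega t) (mu t).
    move=> t0; have cm := tilt_carried (mu_tilt t).
    have mom k := tilt_flow_pairing b0 k (mu_tilt t) (nuM t t0)
      (no_atom_one b0 a_ge0 K_fin w0 dw kw kw_gt0 r_omega dr kr nuM t0).
    split=> //; first exact/moments_iP.
    move=> mu' cm' /(moments_iP _ _ b0 K_fin w0 dw) mom'.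
    exact: (tilt_unique b0 a_ge0 K_fin w0 dw kw_gt0 one01 t0 cm' cm mom' mom).
  exists mu; split=> //; last exact: (tilt_solves b0 a_ge0 K_fin w0 dw kw kw_gt0 one01 nuM mu_tilt).
  (* The measure at time 0 is identified by uniqueness: the Dirac mass at 1 has the same moments. *)
  have [cm m1 H] := uniq 0 (lexx _).
  have := H \d_(1%R : measurableTypeR R); rewrite /measure_eq => H1 A mA; apply/esym/H1 => //.
    by rewrite /carried_by dirac_borelE memNset//=; apply; rewrite in_itv/= ltr01.
  apply/moments_iP => // k; rewrite /pairing integral_dirac//; last first.
    by apply/measurable_EFinP; apply: measurable_funTS; exact: measurable_powR.
  rewrite dirac_borelE mem_set ?mul1e /h ?powR1 /flow ?expG0 ?hornerXn ?expr1n//.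
  by rewrite /= in_itv/= ltr01.
- have zero01 : 0 <= (0 : R) <= 1 by rewrite lexx ler01.
  have [nu [mu [nuM mu_tilt]]] := family 0 zero01.
  exists mu; split.
  + move=> t t0; have cm := tilt_carried (mu_tilt t).
    have mom k := tilt_flow_pairing b0 k (mu_tilt t) (nuM t (ltW t0))
      (no_atom_zero b0 a_ge0 K_fin w0 dw kw kw_gt0 nuM t0).
    split=> //; first exact/moments_iiP.
    move=> mu' cm' /(moments_iiP _ _ b0 K_fin w0 dw) mom'.
    exact: (tilt_unique b0 a_ge0 K_fin w0 dw kw_gt0 zero01 (ltW t0) cm' cm mom' mom).
  + move=> A mA.
    (* At time 0 the flow started from 0 is the Dirac mass at 0. By determinacy it is [nu 0], and
       tilting discards it entirely. *)
    have d0M : has_flow_moments beta a b K omega 0 0 \d_(0%R : measurableTypeR R).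
      split; first by rewrite dirac_borelE memNset//= in_itv/= ltxx.
      move=> k; rewrite integral_dirac//; last first.
        by apply/measurable_EFinP; exact: measurable_funTS.
      by rewrite dirac_borelE mem_set ?mul1e /flow ?expG0 ?hornerXn//= in_itv/= lexx.
    have -> : mu 0%R A = (\int[mu 0%R]_x (\1_A x : R)%:E)%E by rewrite integral_indic// setIT.
    rewrite mu_tilt; last 2 first.
    * by apply/measurable_EFinP; exact: measurable_indic.
    * by move=> y; rewrite lee_fin.
    rewrite (eq_measure_integral \d_(0%R : measurableTypeR R)); last first.
      by move=> B mB _; exact: (flow_measure_unique b0 a_ge0 K_fin w0 dw kw_gt0 zero01 (lexx _) (nuM 0 (lexx _)) d0M mB).
    rewrite integral_dirac//; last first.
      apply: emeasurable_funM; apply/measurable_EFinP; apply: measurable_funTS.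
        exact: measurable_powR.
      by apply: (measurableT_comp _ (measurable_powR _)); exact: measurable_indic.
    by rewrite dirac_borelE memNset ?mul0e//= in_itv/= ltxx.
  + exact: (tilt_solves b0 a_ge0 K_fin w0 dw kw kw_gt0 zero01 nuM mu_tilt).
Qed.
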